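(* Let $T^2_*$ be a randomly and uniformly selected punctured torus from the moduli space. The probability density function $\Sigma(r)$, $r>0$, of the Teichmüller distance from $T^2_*$ to a rectangular punctured torus is $$\Sigma(r)=\begin{cases}\dfrac6\pi\,\cosh(r)\,\log\left(\dfrac{\coth(r)}2\right), & r\le\tanh^{-1}(1/2),\\[2mm] 0, & r\ge\tanh^{-1}(1/2).\end{cases}$$
   Context: Let $\mathbb{H}^2=\{z\in\mathbb{C}:\Im z>0\}$ be the upper half-plane with the hyperbolic metric of curvature $-1$ (area form $|dz|^2/(\Im z)^2$), and let $\Omega=\{z:\Im z>0,\ |z|\ge1,\ -\frac12<\Re z\le\frac12\}$ be the fundamental domain of the modular group, of hyperbolic area $\pi/3$. For $\tau\in\mathbb{H}^2$ let $\Lambda_\tau=\{z\mapsto z+m+n\tau:m,n\in\mathbb Z\}$, with orbit $\Lambda_\tau(0)=\{m+n\tau:m,n\in\mathbb Z\}$. Every punctured torus (once-punctured torus with its complete hyperbolic metric) is conformally equivalent to $T^2_*(\tau)=(\mathbb{C}\setminus\Lambda_\tau(0))/\Lambda_\tau$ for some $\tau\in\Omega$. The moduli space of punctured tori is identified with $\mathbb{S}^2_{(2,3,\infty)}=\mathbb{H}^2/PSL(2,\mathbb{Z})$. Uniformly selected means that $\tau$ is distributed on $\Omega$ according to normalised hyperbolic area $\frac3\pi\frac{dx\,dy}{y^2}$. The Teichmüller distance between two punctured tori is the logarithm of the least distortion (maximal linear dilatation) of a quasiconformal homeomorphism between them; it equals the distance between the corresponding points in the quotient hyperbolic metric of $\mathbb{S}^2_{(2,3,\infty)}$.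 A rectangular punctured torus is one conformally equivalent to $\mathbb{D}/\langle f,g\rangle$, $\mathbb{D}$ the unit disk, where for some $r,s>0$ with $rs=1$, $f(z)=\frac{\sqrt{r^2+1}\,z+1}{z+\sqrt{r^2+1}}$ and $g(z)=\frac{\sqrt{s^2+1}\,z+i}{-iz+\sqrt{s^2+1}}$; these are the punctured tori coming from rectangular lattices, i.e. conformally equivalent to $T^2_*(it)$ for some real $t\ge1$. The Teichmüller distance from $T^2_*$ to a rectangular punctured torus means the minimum of the Teichmüller distances from $T^2_*$ to all rectangular punctured tori. *)

(* Defs.v *)
(* Points x + iy of the complex plane are pairs (x, y) : R * R. *)
From HB Require Import structures.
From mathcomp Require Import all_boot all_order all_algebra.
From mathcomp Require Import all_classical all_reals all_analysis.

Set Implicit Arguments.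
Unset Strict Implicit.
Unset Printing Implicit Defensive.

Import Order.TTheory GRing.Theory Num.Theory.
Import numFieldNormedType.Exports.

Local Open Scope classical_set_scope.
Local Open Scope ring_scope.

Section PuncturedTori.
Context {R : realType}.
Implicit Types (tau z w v : R * R) (F G : R * R -> R * R).

Local Notation leb2 := (@lebesgue_measure R \x @lebesgue_measure R)%E.

Definition cmod z : R := Num.sqrt (z.1 ^+ 2 + z.2 ^+ 2).

Definition cmul z w : R * R :=
  (z.1 * w.1 - z.2 * w.2, z.1 * w.2 + z.2 * w.1).

Definition upper_half_plane : set (R * R) := [set z | 0 < z.2].

Definition modular_domain : set (R * R) :=
  [set z | [/\ 0 < z.2, 1 <= cmod z & - (1 / 2) < z.1 <= 1 / 2]].

(* Hyperbolic area normalised by the area pi/3 of the domain. *)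
Definition uniform_moduli (B : set (R * R)) : \bar R :=
  (\int[leb2]_(z in B `&` modular_domain) (3 / (pi * z.2 ^+ 2))%:E)%E.

Definition lattice tau : set (R * R) :=
  [set z | exists m n : int, z = (1, 0) *~ m + tau *~ n].

Definition punctured_plane tau : set (R * R) := ~` lattice tau.

(* The punctured torus T(tau) is the quotient of punctured_plane tau by the
   translations in lattice tau.  This covering corresponds to the commutator
   subgroup of the (free) fundamental group, which is characteristic, so a
   homeomorphism T(tau) -> T(tau') is the same thing as a homeomorphism F
   between the punctured planes that respects, in both directions, equality of
   points of the quotients.  Values of F on the lattice are irrelevant. *)
Definition torus_homeo tau tau' F : Prop :=
  exists G,
  [/\ (forall z, punctured_plane tau z ->
         punctured_plane tau' (F z) /\ G (F z) = z),
      (forall w, punctured_plane tau' w ->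
         punctured_plane tau (G w) /\ F (G w) = w),
      {within punctured_plane tau, continuous F},
      {within punctured_plane tau', continuous G} &
      forall z w, punctured_plane tau z -> punctured_plane tau w ->
        (lattice tau (z - w) <-> lattice tau' (F z - F w))].

(* The real function u has partial derivatives p, q in the Sobolev (W^{1,2})
   sense on the open set U: absolute continuity of u on almost all segments of
   U parallel to the axes, stated as u being there the integral of its
   derivative, and p, q square integrable on bounded parts of U. *)
Definition sobolev_derivatives (U : set (R * R)) (u p q : R * R -> R) : Prop :=
  [/\ measurable_fun U p /\ measurable_fun U q,
      forall r : R,
        leb2.-integrable (U `&` [set z | cmod z <= r])
          (fun z => (p z ^+ 2 + q z ^+ 2)%:E),
      {ae @lebesgue_measure R, forall y, forall a b, a <= b ->
         (forall x, a <= x <= b -> U (x, y)) ->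
         u (b, y) - u (a, y) =
           \int[@lebesgue_measure R]_(x in `[a, b]) p (x, y)} &
      {ae @lebesgue_measure R, forall x, forall a b, a <= b ->
         (forall y, a <= y <= b -> U (x, y)) ->
         u (x, b) - u (x, a) =
           \int[@lebesgue_measure R]_(y in `[a, b]) q (x, y)}].

(* Image of v under the real-linear map with columns Fx (the x-derivative)
   and Fy (the y-derivative). *)
Definition directional (Fx Fy v : R * R) : R * R :=
  (v.1 * Fx.1 + v.2 * Fy.1, v.1 * Fx.2 + v.2 * Fy.2).

Definition jacobian_det (Fx Fy : R * R) : R := Fx.1 * Fy.2 - Fx.2 * Fy.1.

(* K-quasiconformal homeomorphisms T(tau) -> T(tau'): orientation preserving
   W^{1,2} homeomorphisms whose linear dilatation
   max_v |dF v| / min_v |dF v| (v of modulus 1) is at most K almost everywhere.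
   Square integrability near the punctures is automatic, as
   |dF|^2 <= K det dF and det dF integrates to at most the area of the target
   torus. *)
Definition quasiconformal (K : R) tau tau' F : Prop :=
  torus_homeo tau tau' F /\
  exists Fx Fy : R * R -> R * R,
  [/\ sobolev_derivatives (punctured_plane tau)
        (fun z => (F z).1) (fun z => (Fx z).1) (fun z => (Fy z).1),
      sobolev_derivatives (punctured_plane tau)
        (fun z => (F z).2) (fun z => (Fx z).2) (fun z => (Fy z).2),
      {ae leb2, forall z, punctured_plane tau z ->
         0 <= jacobian_det (Fx z) (Fy z)} &
      {ae leb2, forall z, punctured_plane tau z ->
         forall v w, cmod v = 1 -> cmod w = 1 ->
           cmod (directional (Fx z) (Fy z) v) <=
             K * cmod (directional (Fx z) (Fy z) w)}].

Definition teichmuller_dist tau tau' : R :=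
  ln (inf [set K | 1 <= K /\ exists F, quasiconformal K tau tau' F]).

Definition conformally_equivalent tau tau' : Prop :=
  exists F F' : R * R -> R * R,
  [/\ torus_homeo tau tau' F,
      (forall z, punctured_plane tau z ->
         is_diff z F (cmul (F' z)) /\ F' z != 0) &
      {within punctured_plane tau, continuous F'}].

Definition rectangular : set (R * R) :=
  [set tau | upper_half_plane tau /\
     exists t : R, 1 <= t /\ conformally_equivalent tau (0, t)].

Definition is_minimum (S : set R) (m : R) : Prop := S m /\ lbound S m.

Definition sinh (r : R) : R := (expR r - expR (- r)) / 2.
Definition cosh (r : R) : R := (expR r + expR (- r)) / 2.
Definition coth (r : R) : R := cosh r / sinh r.
Definition artanh (x : R) : R := ln ((1 + x) / (1 - x)) / 2.

Definition Sigma (r : R) : R :=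
  if r <= artanh (1 / 2) then 6 / pi * cosh r * ln (coth r / 2) else 0.

End PuncturedTori.

(* Main.v *)
(* A quasiconformal map of tori, lifted to the plane, stays at bounded distance
   from a real-linear map L.  Groetzsch's argument gives
   K + 1/K >= |L|^2 / det L, with |L| the Hilbert-Schmidt norm: the map is
   absolutely continuous on almost every line, its difference quotients have mean
   L over a period cell, their determinant has mean det L when forward
   and backward quotients are mixed suitably, and one concludes by Fatou's lemma.
   Affine maps attain equality.

   A conformal map of tori has a conformal linear part, so a rectangular torus has
   a lattice similar to Z + itZ.  Minimising |L|^2 / det L over such lattices is an
   inequality on binary forms of discriminant 1; the distance of tau = x + iy from
   the rectangular tori is ln ((|tau| + |x|) / y) = arsinh (|x| / y), attained at
   i|tau|.  Substituting x = y sinh r turns dx dy / y^2 into cosh r dr dy / y on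
   1 / cosh r <= y < 1 / (2 sinh r), and the integral over y yields the density. *)

Require Import Defs.
From HB Require Import structures.
From mathcomp Require Import all_boot all_order all_algebra.
From mathcomp Require Import all_classical all_reals all_analysis.
From mathcomp Require Import measurable_realfun.
From mathcomp Require Import ring lra zify.

Set Implicit Arguments.
Unset Strict Implicit.
Unset Printing Implicit Defensive.

Import Order.TTheory GRing.Theory Num.Theory.
Import numFieldNormedType.Exports.

Local Open Scope classical_set_scope.
Local Open Scope ring_scope.

(** * Linear dilatation *)

Section Dilatation.
Variable R : realType.
Implicit Types (e f v w : R * R) (K : R).

(** A quasiconformal map is absolutely continuous only on almost every line, so Stokes' theorem
    gives no direct access to the integral of its jacobian; everything passes through difference
    quotients. Their determinant has the exact mean [det L] but no sign, so almost everywhere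
    convergence alone does not carry it to the limit. What saves the limit is a bound from above on
    the energy of the quotients: over a cell, with step [s], it is at most the energy of the map
    over the cell enlarged by [s]. Twice the determinant plus this energy is a sum of squares, and
    Fatou's lemma gives the one direction that is needed, namely that the integral of the jacobian
    is at most that of [det L].

    The punctures are the other obstacle: nothing is assumed about the map there, and a priori it
    could wander off near them. That it does not follows from compactness of the target torus away
    from its puncture.

    Orientation is not visible in the topological part, which yields a lattice isomorphism of
    determinant 1 or -1. The sign is settled only by the final inequality, whose right-hand side
    would be negative for -1. *)

Definition hs e f : R := e.1 ^+ 2 + e.2 ^+ 2 + f.1 ^+ 2 + f.2 ^+ 2.

Lemma cmod_sqr (z : R * R) : cmod z ^+ 2 = z.1 ^+ 2 + z.2 ^+ 2.
Proof. by rewrite /cmod sqr_sqrtr// addr_ge0// sqr_ge0. Qed.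

Lemma cmod_ge0 (z : R * R) : 0 <= cmod z.
Proof. exact: sqrtr_ge0. Qed.

(** Writing [(a, b)] as [r (cos u, sin u)], the vector [v] is [(cos (u / 2), sin (u / 2))]. It is an
    eigenvector, for the eigenvalue [r], of the traceless symmetric matrix with rows [(a, b)] and
    [(b, - a)]. *)
Lemma half_angle (a b r : R) : 0 <= r -> r ^+ 2 = a ^+ 2 + b ^+ 2 ->
  exists v, [/\ v.1 ^+ 2 + v.2 ^+ 2 = 1,
    r * (v.1 ^+ 2 - v.2 ^+ 2) = a & r * (2 * v.1 * v.2) = b].
Proof.
rewrite le_eqVlt => /predU1P[<-|r0] rE.
  have a0 : a = 0 by apply/eqP; rewrite -sqrf_eq0; apply/eqP; nra.
  have b0 : b = 0 by apply/eqP; rewrite -sqrf_eq0; apply/eqP; nra.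
  by exists (1, 0); split => /=; rewrite ?a0 ?b0; lra.
have ar : - r <= a <= r by apply/andP; split; nra.
pose c := a / r; pose s := b / r.
have ac : a = c * r by rewrite /c divfK// gt_eqF.
have bs : b = s * r by rewrite /s divfK// gt_eqF.
have cs : c ^+ 2 + s ^+ 2 = 1.
  apply: (@mulIf _ (r ^+ 2)); first by rewrite sqrf_eq0 gt_eqF.
  by rewrite mul1r mulrDl -!exprMn -ac -bs.
have c1 : -1 <= c <= 1 by apply/andP; split; nra.
pose x := Num.sqrt ((1 + c) / 2).
(* As [x] is nonnegative, [y] has to carry the sign of the sine [s = 2 x y]. *)
pose y := (if 0 <= s then 1 else -1) * Num.sqrt ((1 - c) / 2).
have x2 : x ^+ 2 = (1 + c) / 2 by rewrite sqr_sqrtr//; lra.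
have y2 : y ^+ 2 = (1 - c) / 2.
  by rewrite exprMn sqr_sqrtr; [case: ifP => _; lra|lra].
have xy : 2 * x * y = s.
  have s2 : (2 * x * y) ^+ 2 = s ^+ 2.
    by rewrite (_ : (2 * x * y) ^+ 2 = 4 * x ^+ 2 * y ^+ 2); [rewrite x2 y2; lra|ring].
  have x0 : 0 <= x by rewrite sqrtr_ge0.
  move: s2 => /eqP; rewrite eqf_sqr => /orP[/eqP//|/eqP sE].
  move: sE; rewrite /y; have := sqrtr_ge0 ((1 - c) / 2).
  set u := Num.sqrt _ => u0; case: (lerP 0 s) => s0 sE; nra.
by exists (x, y); split => /=; rewrite ?x2 ?y2 ?xy ?ac ?bs; nra.
Qed.

(* Testing the dilatation on the eigenvectors of the Gram matrix gives
   [l1 <= K ^ 2 * l2] for its eigenvalues [l1 >= l2], whose product is the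
   squared jacobian. *)
Lemma dilatation_hs K e f : 1 <= K -> 0 <= jacobian_det e f ->
  (forall v w, cmod v = 1 -> cmod w = 1 ->
     cmod (directional e f v) <= K * cmod (directional e f w)) ->
  hs e f <= (K + K^-1) * jacobian_det e f.
Proof.
move=> K1 J0 H.
have K0 : 0 < K by lra.
pose p := e.1 ^+ 2 + e.2 ^+ 2; pose q := f.1 ^+ 2 + f.2 ^+ 2.
pose m := e.1 * f.1 + e.2 * f.2.
pose r := Num.sqrt (((p - q) / 2) ^+ 2 + m ^+ 2).
have r2 : r ^+ 2 = ((p - q) / 2) ^+ 2 + m ^+ 2.
  by rewrite sqr_sqrtr// addr_ge0// sqr_ge0.
have r0 : 0 <= r by rewrite sqrtr_ge0.
have [v [v1 vp vm]] := half_angle r0 r2.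
pose w : R * R := (- v.2, v.1).
have cv : cmod v = 1 by rewrite /cmod v1 sqrtr1.
have cw : cmod w = 1 by rewrite /cmod /= sqrrN addrC v1 sqrtr1.
have Hvw := H v w cv cw.
set T := hs e f.
have TE : T = p + q by rewrite /T /hs /p /q; ring.
pose J := jacobian_det e f.
have JE : J ^+ 2 = p * q - m ^+ 2.
  by rewrite /J /jacobian_det /p /q /m; ring.
have dE u : cmod (directional e f u) ^+ 2 =
    (p + q) / 2 * (u.1 ^+ 2 + u.2 ^+ 2)
    + (p - q) / 2 * (u.1 ^+ 2 - u.2 ^+ 2) + m * (2 * u.1 * u.2).
  by rewrite cmod_sqr /directional /p /q /m /=; field.
have dv : cmod (directional e f v) ^+ 2 = T / 2 + r.
  rewrite dE v1 mulr1 -vp -vm -addrA.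
  have -> : r * (v.1 ^+ 2 - v.2 ^+ 2) * (v.1 ^+ 2 - v.2 ^+ 2) +
    r * (2 * v.1 * v.2) * (2 * v.1 * v.2) = r * (v.1 ^+ 2 + v.2 ^+ 2) ^+ 2 by ring.
  by rewrite v1; lra.
have dw : cmod (directional e f w) ^+ 2 = T / 2 - r.
  rewrite dE /= sqrrN [v.2 ^+ 2 + _]addrC v1 mulr1 -addrA.
  have -> : 2 * - v.2 * v.1 = - (2 * v.1 * v.2) by ring.
  suff : (p - q) / 2 * (v.2 ^+ 2 - v.1 ^+ 2) + m * - (2 * v.1 * v.2) = - r.
    by move=> ->; rewrite TE.
  have -> : - r = - (r * (v.1 ^+ 2 + v.2 ^+ 2) ^+ 2) by rewrite v1 expr1n mulr1.
  by rewrite -vp -vm; ring.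
have a0 := cmod_ge0 (directional e f v).
have b0 := cmod_ge0 (directional e f w).
set a := cmod (directional e f v) in Hvw dv a0.
set b := cmod (directional e f w) in Hvw dw b0.
have ab : a * b = J.
  have : (a * b) ^+ 2 = J ^+ 2.
    rewrite exprMn dv dw JE TE.
    have -> : ((p + q) / 2 + r) * ((p + q) / 2 - r) = ((p + q) / 2) ^+ 2 - r ^+ 2 by ring.
    by rewrite r2; field.
  have ab0 := mulr_ge0 a0 b0.
  move=> /eqP; rewrite eqf_sqr => /orP[/eqP//|/eqP E].
  have J0' : 0 <= J by [].
  by lra.
have T2 : T = a ^+ 2 + b ^+ 2 by rewrite dv dw; lra.
have ba : b <= a by rewrite -(@ler_pXn2r _ 2)// dv dw; lra.
(* With the singular values [a] and [b], the claim is the expansion of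
   [(K b - a) (K a - b) >= 0]. *)
have KJ : K * T <= (K ^+ 2 + 1) * J.
  rewrite -ab T2.
  have h1 : 0 <= K * b - a by lra.
  have h2 : 0 <= K * a - b by nra.
  have := mulr_ge0 h1 h2; nra.
rewrite -/J -(ler_pM2l K0); apply: le_trans KJ _.
by rewrite le_eqVlt; apply/orP; left; apply/eqP; field; rewrite gt_eqF.
Qed.

Lemma psd2 (a b c x y : R) : 0 <= a + c -> b ^+ 2 <= a * c ->
  0 <= a * x ^+ 2 + 2 * b * x * y + c * y ^+ 2.
Proof.
move=> ac bac.
have [a0 c0] : 0 <= a /\ 0 <= c.
  have := sqr_ge0 b => b0; have ac0 := le_trans b0 bac.
  by split; rewrite leNgt; apply/negP => h; nra.
have [a00|a1] := eqVneq a 0.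
  have b0 : b = 0 by apply/eqP; rewrite -sqrf_eq0 eq_le sqr_ge0 andbT (le_trans bac)// a00 mul0r.
  by rewrite a00 b0; have := sqr_ge0 y; nra.
have ap : 0 < a by rewrite lt_def a1.
rewrite -(pmulr_rge0 _ ap).
have -> : a * (a * x ^+ 2 + 2 * b * x * y + c * y ^+ 2) =
  (a * x + b * y) ^+ 2 + (a * c - b ^+ 2) * y ^+ 2 by ring.
by rewrite addr_ge0// ?sqr_ge0// mulr_ge0 ?sqr_ge0//; lra.
Qed.

(** Equality makes [K J] and [J / K] the two roots of the characteristic polynomial of the Gram
    matrix, whose trace is [(K + 1 / K) J] and whose determinant is [J ^ 2]. Its quadratic form on
    unit vectors therefore lies between them. *)
Lemma hs_dilatation K e f : 1 <= K -> 0 < jacobian_det e f ->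
  hs e f = (K + K^-1) * jacobian_det e f ->
  forall v w, cmod v = 1 -> cmod w = 1 ->
     cmod (directional e f v) <= K * cmod (directional e f w).
Proof.
move=> K1 J0 H v w cv cw.
have K0 : 0 < K by lra.
pose p := e.1 ^+ 2 + e.2 ^+ 2; pose q := f.1 ^+ 2 + f.2 ^+ 2.
pose m := e.1 * f.1 + e.2 * f.2.
set J := jacobian_det e f in J0 H.
have JE : J ^+ 2 = p * q - m ^+ 2.
  by rewrite /J /jacobian_det /p /q /m; ring.
have T : p + q = (K + K^-1) * J by rewrite -H /hs /p /q; ring.
have dE u : cmod (directional e f u) ^+ 2 =
    p * u.1 ^+ 2 + 2 * m * u.1 * u.2 + q * u.2 ^+ 2.
  by rewrite cmod_sqr /directional /p /q /m /=; ring.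
pose k := K^-1.
have kK : k * K = 1 by rewrite /k mulVf// gt_eqF.
have k0 : 0 < k by rewrite invr_gt0.
have k1 : k <= 1 by rewrite invf_le1.
rewrite -/k in T.
have v1 : v.1 ^+ 2 + v.2 ^+ 2 = 1 by rewrite -cmod_sqr cv expr1n.
have w1 : w.1 ^+ 2 + w.2 ^+ 2 = 1 by rewrite -cmod_sqr cw expr1n.
have det c : (c - K) * (c - k) = 0 -> (c * J - p) * (c * J - q) = m ^+ 2.
  move=> c0; transitivity ((c * J) ^+ 2 - c * J * (p + q) + p * q); first by ring.
  rewrite T (_ : p * q = J ^+ 2 + m ^+ 2); last by rewrite JE; ring.
  transitivity ((c - K) * (c - k) * J ^+ 2 + (1 - k * K) * J ^+ 2 + m ^+ 2); first by ring.
  by rewrite c0 kK subrr !mul0r !add0r.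
have detK : (K * J - p) * (K * J - q) = m ^+ 2 by apply: det; rewrite subrr mul0r.
have detk : (k * J - p) * (k * J - q) = m ^+ 2 by apply: det; rewrite subrr mulr0.
have tr : 0 <= (K - k) * J by rewrite mulr_ge0//; lra.
have hv : cmod (directional e f v) ^+ 2 <= K * J.
  rewrite dE -subr_ge0 -[K * J]mulr1 -[X in K * J * X]v1.
  rewrite (_ : _ - _ = (K * J - p) * v.1 ^+ 2 + 2 * (- m) * v.1 * v.2 + (K * J - q) * v.2 ^+ 2).
    by apply: psd2; [move: T tr; lra|rewrite sqrrN detK].
  by ring.
have hw : k * J <= cmod (directional e f w) ^+ 2.
  rewrite dE -subr_ge0 -[k * J]mulr1 -[X in k * J * X]w1.
  rewrite (_ : _ - _ = (p - k * J) * w.1 ^+ 2 + 2 * m * w.1 * w.2 + (q - k * J) * w.2 ^+ 2).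
    by apply: psd2; [move: T tr; lra|rewrite -detk; lra].
  by ring.
rewrite -(@ler_pXn2r _ 2)// ?nnegrE ?cmod_ge0 ?mulr_ge0 ?cmod_ge0 ?(ltW K0)//.
apply: le_trans hv _; rewrite exprMn.
have -> : K * J = K ^+ 2 * (k * J).
  by rewrite -[LHS]mul1r -kK; ring.
by rewrite ler_pM2l ?exprn_gt0.
Qed.

Lemma dilatation_exists (kappa : R) : 2 <= kappa ->
  exists K : R, 1 <= K /\ K + K^-1 = kappa.
Proof.
move=> k2; pose d := Num.sqrt (kappa ^+ 2 - 4).
have d2 : d ^+ 2 = kappa ^+ 2 - 4 by rewrite sqr_sqrtr//; nra.
have d0 : 0 <= d by rewrite sqrtr_ge0.
exists ((kappa + d) / 2); split; first lra.
rewrite (_ : (_ / 2)^-1 = (kappa - d) / 2); first lra.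
apply: (@mulfI _ ((kappa + d) / 2)); first by rewrite gt_eqF//; lra.
rewrite mulfV; last by rewrite gt_eqF//; lra.
have -> : (kappa + d) / 2 * ((kappa - d) / 2) = (kappa ^+ 2 - d ^+ 2) / 4 by field.
by rewrite d2; lra.
Qed.

Lemma dilatation_mono (K K' : R) : 1 <= K -> 1 <= K' ->
  K' + K'^-1 <= K + K^-1 -> K' <= K.
Proof.
move=> K1 K'1 H; rewrite leNgt; apply/negP => KK'.
have K0 : 0 < K by lra.
have K'0 : 0 < K' by lra.
have : (K' + K'^-1) * (K * K') <= (K + K^-1) * (K * K').
  by rewrite ler_pM2r// mulr_gt0.
rewrite (_ : (K' + _) * _ = K * K' ^+ 2 + K); last by field; rewrite gt_eqF.
rewrite (_ : (K + _) * _ = K' * K ^+ 2 + K'); last by field; rewrite gt_eqF.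
have h1 : 0 < K' - K by lra.
have h2 : 0 < K * K' - 1 by nra.
have := mulr_gt0 h1 h2; nra.
Qed.

End Dilatation.

(** * Lattices *)

Section Lattice.
Variable R : realType.
Implicit Types (tau z w : R * R).

Lemma nbhs_boxP z (P : set (R * R)) : nbhs z P <->
  exists2 e : R, 0 < e &
    forall w, `|z.1 - w.1| < e -> `|z.2 - w.2| < e -> P w.
Proof.
split=> [/nbhs_ballP[e /= e0 H]|[e e0 H]].
  by exists e => // w h1 h2; apply: H; split.
by apply/nbhs_ballP; exists e => //= w [h1 h2]; exact: H.
Qed.

Definition lattice_point tau (m n : int) : R * R :=
  (m%:~R + tau.1 * n%:~R, tau.2 * n%:~R).

Lemma latticeE tau z :
  lattice tau z <-> exists m n : int, z = lattice_point tau m n.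
Proof.
have E (m n : int) : (1, 0) *~ m + tau *~ n = lattice_point tau m n.
  have h (x : R * R) (k : int) : x *~ k = (x.1 *~ k, x.2 *~ k).
    by rewrite [LHS]surjective_pairing; congr pair; exact: raddfMz.
  rewrite !h /lattice_point /= mul0rz; congr pair => /=.
    by rewrite -[tau.1 *~ n]mulrzr.
  by rewrite add0r mulrzr.
by split=> -[m [n ->]]; exists m, n; rewrite E.
Qed.

(* Coordinates of [z] in the basis [1], [tau]. *)
Definition coord1 tau z : R := z.1 - z.2 / tau.2 * tau.1.
Definition coord2 tau z : R := z.2 / tau.2.

Lemma coord_lattice tau z : 0 < tau.2 -> lattice tau z <->
  exists m n : int, coord1 tau z = m%:~R /\ coord2 tau z = n%:~R.
Proof.
move=> t0; have tn : tau.2 != 0 by rewrite gt_eqF.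
split=> [/latticeE[m [n ->]]|[m [n [h1 h2]]]].
  exists m, n; rewrite /coord1 /coord2 /=.
  by split; field.
apply/latticeE; exists m, n; rewrite [z]surjective_pairing /lattice_point.
rewrite -h1 -h2 /coord1 /coord2; congr pair; by field.
Qed.

Lemma lattice_pointD tau m n m' n' :
  lattice_point tau m n + lattice_point tau m' n' =
  lattice_point tau (m + m') (n + n').
Proof. by rewrite /lattice_point; congr pair => /=; rewrite !intrD; ring. Qed.

Lemma lattice_pointN tau m n :
  - lattice_point tau m n = lattice_point tau (- m) (- n).
Proof. by rewrite /lattice_point; congr pair => /=; rewrite !intrN; ring. Qed.

Lemma lattice_latticeD tau z m n :
  lattice tau (z + lattice_point tau m n) <-> lattice tau z.
Proof.
split=> /latticeE[j [k E]]; apply/latticeE.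
  exists (j - m), (k - n); rewrite -lattice_pointD -lattice_pointN -E addrK //.
by exists (j + m), (k + n); rewrite -lattice_pointD E.
Qed.

Lemma lattice_pointP tau m n : lattice tau (lattice_point tau m n).
Proof. by apply/latticeE; exists m, n. Qed.

Lemma lattice0 tau : lattice tau (0, 0).
Proof.
apply/latticeE; exists 0, 0.
by rewrite /lattice_point; congr pair; rewrite mulr0 ?addr0.
Qed.

Lemma lattice_point_inj tau m n m' n' : 0 < tau.2 ->
  lattice_point tau m n = lattice_point tau m' n' -> m = m' /\ n = n'.
Proof.
move=> t0 [h1 h2].
have : n%:~R = n'%:~R :> R by apply: (mulfI (lt0r_neq0 t0)).
move=> /(@intr_inj R) E; rewrite E in h1.
by move/addIr : h1 => /(@intr_inj R) ->.
Qed.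

Lemma int_gap (m n : int) (x : R) :
  n%:~R < x -> x < n%:~R + 1 -> x != m%:~R.
Proof.
move=> h1 h2; apply/eqP => E; move: h1 h2; rewrite E -[1]/(1%:~R) -intrD !ltr_int.
by move=> ? ?; lia.
Qed.

Lemma notint_gap (x : R) : (forall m : int, x != m%:~R) ->
  exists n : int, n%:~R < x < n%:~R + 1.
Proof.
move=> H; exists (Num.floor x); have /andP[h1 h2] := floor_itv x.
by rewrite lt_def h1 (H (Num.floor x)) /=; rewrite intrD in h2.
Qed.

Lemma near_notint (x : R) : (forall m : int, x != m%:~R) ->
  exists2 e : R, 0 < e & forall y, `|x - y| < e -> forall m : int, y != m%:~R.
Proof.
move=> /notint_gap[n /andP[h1 h2]].
exists (Num.min (x - n%:~R) (n%:~R + 1 - x)).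
  by rewrite lt_min !subr_gt0 h1 h2.
move=> y; rewrite lt_min !ltr_norml => /andP[/andP[a b] /andP[c d]] m.
by apply: (@int_gap _ n); lra.
Qed.

Lemma near_int (n : int) (x y : R) : `|n%:~R - y| < 1 ->
  forall m : int, y = m%:~R -> m = n.
Proof.
move=> h m E; move: h; rewrite E -intrB -intr_norm -[1]/(1%:~R) ltr_int.
lia.
Qed.

Lemma open_punctured_plane tau : 0 < tau.2 -> open (punctured_plane tau).
Proof.
move=> t0; rewrite openE => z Uz; apply/nbhs_boxP.
have tn : tau.2 != 0 by rewrite gt_eqF.
(* If [z] lies on a row of lattice points, the bound [tau.2] on the vertical distance forces nearby
   lattice points onto the same row, and the horizontal coordinate separates them from [z].
   Otherwise [z] has a neighbourhood between two rows. *)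
have [[n En]|H] := pselect (exists n : int, coord2 tau z = n%:~R).
  have nz : forall m : int, z.1 - n%:~R * tau.1 != m%:~R.
    move=> m; apply/eqP => E; apply: Uz; apply/coord_lattice => //.
    by exists m, n; split => //; rewrite /coord1 -En in E *.
  have [e e0 He] := near_notint nz.
  exists (Num.min e tau.2); first by rewrite lt_min e0.
  move=> w; rewrite !lt_min => /andP[w1 _] /andP[_ w2] /coord_lattice -/(_ t0).
  move=> [m [n' [E1 E2]]].
  have nn : n' = n.
    apply: (@near_int n (coord2 tau w)) E2; rewrite -En /coord2 -mulrBl normrM.
    by rewrite [`|_^-1|]gtr0_norm ?invr_gt0// ltr_pdivrMr ?mul1r.
  have := He (w.1 - n%:~R * tau.1); rewrite opprB addrA subrK => /(_ w1 m).
  by rewrite -E1 /coord1 -/(coord2 tau w) E2 nn eqxx.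
have nz : forall m : int, coord2 tau z != m%:~R.
  by move=> m; apply/eqP => E; apply: H; exists m.
have [e e0 He] := near_notint nz.
exists (e * tau.2); first by rewrite mulr_gt0.
move=> w _ w2 /coord_lattice -/(_ t0) [m [n [_ E2]]].
have := He (coord2 tau w); rewrite /coord2 -mulrBl normrM.
rewrite [`|_^-1|]gtr0_norm ?invr_gt0// ltr_pdivrMr// => /(_ w2 n).
by rewrite -/(coord2 tau w) E2 eqxx.
Qed.

(** To leave the band around [k], the function would have to take a value [k + 1 / 2] or [k - 1 / 2]
    by the intermediate value theorem, and these are not within [1 / 2] of any integer. *)
Lemma near_int_itv (g : R -> R) (a b : R) (k : int) : a <= b ->
  {within `[a, b], continuous g} ->
  (forall t, a <= t <= b -> exists m : int, `|g t - m%:~R| < 1 / 2) ->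
  `|g a - k%:~R| < 1 / 2 -> `|g b - k%:~R| < 1 / 2.
Proof.
move=> ab cg H ga.
have key (s : R) : s = 1 / 2 \/ s = - (1 / 2) ->
    Num.min (g a) (g b) <= k%:~R + s <= Num.max (g a) (g b) -> False.
  move=> sE /(IVT ab cg)[c]; rewrite in_itv /= => cab gc.
  have [m] := H c cab; rewrite gc.
  have -> : k%:~R + s - m%:~R = (k - m)%:~R + s by rewrite intrB; ring.
  move: (k - m) => d; rewrite ltr_norml => /andP[h1 h2].
  case: sE => sE; rewrite sE in h1 h2.
    have d1 : (-1)%:~R < (d%:~R : R) by rewrite intrN; lra.
    have d2 : (d%:~R : R) < 0%:~R by lra.
    by move: d1 d2; rewrite !ltr_int; lia.
  have d1 : 0%:~R < (d%:~R : R) by lra.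
  have d2 : (d%:~R : R) < 1%:~R by lra.
  by move: d1 d2; rewrite !ltr_int; lia.
move: ga; rewrite !ltr_norml => /andP[g1 g2]; rewrite ltNge [X in _ && X]ltNge.
apply/andP; split; apply/negP => h.
  apply: (key (- (1 / 2))); first by right.
  by rewrite ge_min le_max; apply/andP; split; apply/orP; [right|left]; lra.
apply: (key (1 / 2)); first by left.
by rewrite ge_min le_max; apply/andP; split; apply/orP; [left|right]; lra.
Qed.

(* Any two points of the punctured plane are joined by axis-parallel segments:
   cross the [n]-th row of punctures halfway between two of them. *)
Lemma punctured_plane_connected (T : Type) tau (g : R * R -> T) : 0 < tau.2 ->
  (forall x a b, a <= b ->
    (forall t, a <= t <= b -> punctured_plane tau (x, t)) ->
    g (x, a) = g (x, b)) ->
  (forall y a b, a <= b ->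
    (forall t, a <= t <= b -> punctured_plane tau (t, y)) ->
    g (a, y) = g (b, y)) ->
  forall z w, punctured_plane tau z -> punctured_plane tau w -> g z = g w.
Proof.
move=> t0 gv gh.
have tn : tau.2 != 0 by rewrite gt_eqF.
have gv' x a b : (forall t, Num.min a b <= t <= Num.max a b ->
    punctured_plane tau (x, t)) -> g (x, a) = g (x, b).
  by case: (leP a b) => ab H; [apply: gv|apply/esym/gv; [exact: ltW|]].
have gh' y a b : (forall t, punctured_plane tau (t, y)) -> g (a, y) = g (b, y).
  by move=> H; case: (leP a b) => ab; [apply: gh|apply/esym/gh; [exact: ltW|]].
pose P (n : int) : R * R := (n%:~R * tau.1 + 1 / 2, n%:~R * tau.2).
pose mid (n : int) : R := (n%:~R + 1 / 2) * tau.2.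
have Umid n x : punctured_plane tau (x, mid n).
  move=> /coord_lattice -/(_ t0) [m [n' [_ E]]].
  move: E; rewrite /coord2 /mid /= mulfK// => E.
  have : n%:~R + 1 / 2 != n'%:~R :> R by apply: (@int_gap _ n); lra.
  by rewrite E eqxx.
have Urow n x t : n%:~R * tau.2 < t -> t < (n%:~R + 1) * tau.2 -> punctured_plane tau (x, t).
  move=> h1 h2 /coord_lattice -/(_ t0) [m [n' [_ E]]].
  have : t / tau.2 != n'%:~R :> R.
    by apply: (@int_gap _ n); rewrite ?ltr_pdivlMr ?ltr_pdivrMr.
  by rewrite -E eqxx.
have UP n : punctured_plane tau (P n).
  move=> /coord_lattice -/(_ t0) [m [n' [E1 E2]]].
  move: E1; rewrite /coord1 /P /= mulfK// [X in X - _]addrC addrK => E.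
  have : 1 / 2 != m%:~R :> R by apply: (@int_gap _ 0); lra.
  by rewrite E eqxx.
have up z : punctured_plane tau z -> g z = g (P (Num.floor (z.2 / tau.2))).
  move=> Uz; have /andP[h1 h2] := floor_itv (z.2 / tau.2).
  set n := Num.floor _ in h1 h2 *.
  rewrite intrD in h2.
  rewrite ler_pdivlMr// in h1; rewrite ltr_pdivrMr// in h2.
  rewrite [z]surjective_pairing in Uz *.
  transitivity (g (z.1, mid n)).
    apply: gv' => t; rewrite /mid => /andP[t1 t2].
    have [->//|tz] := eqVneq t z.2.
    apply: (Urow n).
      move: t1; rewrite ge_min => /orP[t1|t1]; last by apply: lt_le_trans t1; nra.
      by apply: le_lt_trans h1 _; rewrite lt_def tz.
    by apply: le_lt_trans t2 _; rewrite gt_max h2/=; nra.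
  transitivity (g (n%:~R * tau.1 + 1 / 2, mid n)); first exact: gh'.
  apply: gv' => t; rewrite /mid => /andP[t1 t2].
  have [->|tz] := eqVneq t (n%:~R * tau.2); first exact: UP.
  apply: (Urow n).
    move: t1; rewrite ge_min => /orP[t1|t1]; first by apply: lt_le_trans t1; nra.
    by rewrite lt_def tz.
  by apply: le_lt_trans t2 _; rewrite gt_max; apply/andP; split; nra.
have PS (n : int) : g (P n) = g (P (n + 1)).
  transitivity (g (n%:~R * tau.1 + 1 / 2, mid n)).
    apply: gv' => t; rewrite /mid => /andP[t1 t2].
    have [->|tz] := eqVneq t (n%:~R * tau.2); first exact: UP.
    apply: (Urow n).
      move: t1; rewrite ge_min => /orP[t1|t1]; last by apply: lt_le_trans t1; nra.
      by rewrite lt_def tz.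
    by apply: le_lt_trans t2 _; rewrite gt_max; apply/andP; split; nra.
  transitivity (g ((n + 1)%:~R * tau.1 + 1 / 2, mid n)); first exact: gh'.
  apply: gv' => t; rewrite /mid => /andP[t1 t2].
  have [->|tz] := eqVneq t ((n + 1)%:~R * tau.2); first exact: UP.
  apply: (Urow n).
    move: t1; rewrite ge_min => /orP[t1|t1]; apply: lt_le_trans t1; rewrite ?intrD; nra.
  rewrite intrD in tz t2.
  by move: t2; rewrite le_max => /orP[t2|t2]; [apply: le_lt_trans t2 _; nra|rewrite lt_def eq_sym tz].
have PP (n : int) : g (P n) = g (P 0).
  elim/int_ind: n => [//|n IH|n IH].
    by rewrite intS addrC -PS.
  by rewrite PS -IH; congr (g (P _)); rewrite intS; ring.
by move=> z w Uz Uw; rewrite (up z Uz) (up w Uw) PP [RHS]PP.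
Qed.

End Lattice.

(** * Homeomorphisms of punctured tori *)

Section TorusHomeo.
Variable R : realType.
Implicit Types (tau z w : R * R) (F : R * R -> R * R).

Lemma continuous_box (U : set (R * R)) F z (e : R) : open U ->
  {within U, continuous F} -> U z -> 0 < e ->
  exists2 d : R, 0 < d & forall w, `|z.1 - w.1| < d -> `|z.2 - w.2| < d ->
    [/\ U w, `|(F z).1 - (F w).1| < e & `|(F z).2 - (F w).2| < e].
Proof.
move=> oU; rewrite continuous_open_subspace// => cF Uz e0.
have cz : F w @[w --> z] --> F z by apply: cF; rewrite inE.
have : nbhs z (fun w => U w /\ ball (F z) e (F w)).
  near=> w; split.
    by near: w; exact: open_nbhs_nbhs.
  by near: w; apply: cz; exact: nbhsx_ballx.
move=> /nbhs_boxP[d d0 H]; exists d => // w h1 h2.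
by have [? [? ?]] := H w h1 h2; split.
Unshelve. all: by end_near. Qed.

Lemma linear_continuous_box F (U : set (R * R)) (p q x y u v : R) (a b : R) :
  open U -> {within U, continuous F} ->
  (forall t, a <= t <= b -> U (x + t * u, y + t * v)) ->
  {within `[a, b], continuous
    (fun t => p * (F (x + t * u, y + t * v)).1 + q * (F (x + t * u, y + t * v)).2)}.
Proof.
move=> oU cF H; apply: continuous_in_subspaceT => t; rewrite inE /= in_itv /= => tab.
have cFt : {for (x + t * u, y + t * v), continuous F}.
  by move: cF; rewrite continuous_open_subspace//; apply; rewrite inE; exact: H.
have line (c w : R) : c + s * w @[s --> t] --> c + t * w.
  by apply: cvgD; [exact: cvg_cst|apply: cvgM; [exact: cvg_id|exact: cvg_cst]].
have Ft := cvg_comp _ _ (cvg_pair (line x u) (line y v)) cFt.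
apply: cvgD; apply: cvgM; try exact: cvg_cst.
  by apply: (@continuous_comp _ _ _ (fun s : R => F (x + s * u, y + s * v)) fst); [exact: Ft|exact: cvg_fst].
by apply: (@continuous_comp _ _ _ (fun s : R => F (x + s * u, y + s * v)) snd); [exact: Ft|exact: cvg_snd].
Qed.

Lemma int_norm_lt1 (m : int) : `|m%:~R| < 1 :> R -> m = 0.
Proof. by rewrite -intr_norm -[1]/(1%:~R) ltr_int; lia. Qed.

(** The inverse of the coordinate map given by [coord1 tau] and [coord2 tau]. *)
Definition of_coord tau (st : R * R) : R * R :=
  (st.1 + st.2 * tau.1, st.2 * tau.2).

Lemma of_coord_box tau st (d : R) : 0 < tau.2 -> 0 < d ->
  exists2 c : R, 0 < c & forall w, `|st.1 - w.1| < c -> `|st.2 - w.2| < c ->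
    `|(of_coord tau st).1 - (of_coord tau w).1| < d /\
    `|(of_coord tau st).2 - (of_coord tau w).2| < d.
Proof.
move=> t0 d0; have q1 := normr_ge0 tau.1.
have V0 : 0 < 1 + `|tau.1| + tau.2 by lra.
exists (d / (1 + `|tau.1| + tau.2)); first by rewrite divr_gt0.
move=> w; rewrite !ltr_pdivlMr// => b1 b2.
have q2 := normr_ge0 (st.1 - w.1); have q3 := normr_ge0 (st.2 - w.2).
rewrite /of_coord /= -mulrBl normrM (gtr0_norm t0).
rewrite opprD addrACA -mulrBl; split; last first.
  by apply: le_lt_trans b2; have := mulr_ge0 q3 q1; nra.
apply: (le_lt_trans (ler_normD _ _)); rewrite normrM.
move: b1 b2 q1 q2 q3 V0.
move: `|st.1 - w.1| `|st.2 - w.2| `|tau.1| => A B T b1 b2 q1 q2 q3 V0.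
have [AB|AB] := lerP A B.
  by apply: le_lt_trans b2; have := mulr_ge0 q3 (ltW t0); nra.
by apply: le_lt_trans b1; have := mulr_ge0 q2 (ltW t0); nra.
Qed.

Lemma near_int_itvC (g : R -> R) (a b : R) (k : int) :
  {within `[Num.min a b, Num.max a b], continuous g} ->
  (forall t, Num.min a b <= t <= Num.max a b ->
    exists m : int, `|g t - m%:~R| < 1 / 2) ->
  `|g a - k%:~R| < 1 / 2 -> `|g b - k%:~R| < 1 / 2.
Proof.
case: (leP a b) => ab cg H; first exact: near_int_itv.
have [m mb] := H b (introT andP (conj (lexx b) (ltW ab))).
have ma := near_int_itv (ltW ab) cg H mb.
move=> ka; suff -> : k = m by [].
have : `|(k - m)%:~R| < 1 :> R.
  move: ka ma; rewrite intrB !ltr_norml => /andP[? ?] /andP[? ?].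
  by apply/andP; split; lra.
by rewrite -intr_norm -[1]/(1%:~R) ltr_int; lia.
Qed.

Section Homeo.
Variables (tau tau' : R * R) (F G : R * R -> R * R).
Hypotheses (t0 : 0 < tau.2) (t0' : 0 < tau'.2).
Local Notation U := (punctured_plane tau).
Local Notation U' := (punctured_plane tau').
Hypothesis FK : forall z, U z -> U' (F z) /\ G (F z) = z.
Hypothesis GK : forall w, U' w -> U (G w) /\ F (G w) = w.
Hypothesis cF : {within U, continuous F}.
Hypothesis cG : {within U', continuous G}.
Hypothesis FG : forall z w, U z -> U w ->
  (lattice tau (z - w) <-> lattice tau' (F z - F w)).

Let oU : open U := open_punctured_plane t0.
Let oU' : open U' := open_punctured_plane t0'.

Lemma punctured_planeD z m n : U (z + lattice_point tau m n) <-> U z.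
Proof. by split; apply: contra_not => /lattice_latticeD. Qed.

(** Puts the coordinates in the shape of [linear_continuous_box], which makes them continuous along
    segments. *)
Lemma coord1E z : coord1 tau' z = 1 * z.1 + (- (tau'.1 / tau'.2)) * z.2.
Proof. by rewrite /coord1; field; rewrite gt_eqF. Qed.
Lemma coord2E z : coord2 tau' z = 0 * z.1 + (tau'.2)^-1 * z.2.
Proof. by rewrite /coord2; field; rewrite gt_eqF. Qed.

Lemma continuous_translate z0 : {within (fun z => U (z + z0)), continuous (fun z => F (z + z0))}.
Proof.
have oUz : open [set z | U (z + z0)].
  by apply: (@open_comp _ _ (fun z => z + z0)) => // z _; apply: cvgD; [exact: cvg_id|exact: cvg_cst].
rewrite (continuous_open_subspace _ oUz) => z; rewrite inE => /= Uz.
move: cF; rewrite continuous_open_subspace// => cF'.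
apply: (@continuous_comp _ _ _ (fun z => z + z0) F).
  by apply: cvgD; [exact: cvg_id|exact: cvg_cst].
by apply: cF'; rewrite inE.
Qed.

(** The increment [F (z + l) - F z] is continuous with values in a discrete lattice, hence constant
    along axis-parallel segments, and these connect the punctured plane. *)
Lemma homeo_translate m n : exists j k : int,
  forall z, U z -> F (z + lattice_point tau m n) = F z + lattice_point tau' j k.
Proof.
pose l := lattice_point tau m n.
pose g : R * R -> R * R := fun z => F (z + l) - F z.
have gL z : U z -> lattice tau' (g z).
  move=> Uz; rewrite /g -FG//; last exact/punctured_planeD.
  by rewrite [z + l]addrC addrK; exact: lattice_pointP.
have cg : {within U, continuous g}.
  rewrite continuous_open_subspace// => z Uz.
  apply: cvgB.
    have := @continuous_translate l.
    have -> : (fun z => U (z + l)) = U by apply/funext => w; apply/propext; exact: punctured_planeD.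
    by rewrite continuous_open_subspace//; exact.
  by move: cF; rewrite continuous_open_subspace//; exact.
have seg (x y u v a b : R) : a <= b ->
    (forall t, a <= t <= b -> U (x + t * u, y + t * v)) ->
    g (x + a * u, y + a * v) = g (x + b * u, y + b * v).
  move=> ab H.
  have Ha : a <= a <= b by rewrite lexx.
  have Hb : a <= b <= b by rewrite lexx ab.
  have /latticeE[j [k E]] := gL _ (H a Ha).
  have /latticeE[j' [k' E']] := gL _ (H b Hb).
  have int0 (i : int) : `|i%:~R - i%:~R| < 1 / 2 :> R by rewrite subrr normr0.
  have tn : tau'.2 != 0 by rewrite gt_eqF.
  have c1 i1 i2 : coord1 tau' (lattice_point tau' i1 i2) = i1%:~R.
    by rewrite /coord1 /=; field.
  have c2 i1 i2 : coord2 tau' (lattice_point tau' i1 i2) = i2%:~R.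
    by rewrite /coord2 /=; field.
  have eqi (i1 i2 : int) : `|i1%:~R - i2%:~R| < 1 / 2 :> R -> i1 = i2.
    rewrite -intrB -intr_norm => h.
    have : (`|i1 - i2|%:~R : R) < 1%:~R by lra.
    by rewrite ltr_int; lia.
  have h1 : `|coord1 tau' (g (x + b * u, y + b * v)) - j%:~R| < 1 / 2.
    rewrite coord1E.
    apply: (@near_int_itv _ (fun t => 1 * (g (x + t * u, y + t * v)).1 +
      - (tau'.1 / tau'.2) * (g (x + t * u, y + t * v)).2) a) => //.
      exact: (@linear_continuous_box g U 1 (- (tau'.1 / tau'.2)) x y u v a b oU cg H).
      move=> t /H /gL /latticeE[i1 [i2 ->]]; exists i1.
      by rewrite -coord1E c1.
    by rewrite -coord1E E c1.
  have h2 : `|coord2 tau' (g (x + b * u, y + b * v)) - k%:~R| < 1 / 2.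
    rewrite coord2E.
    apply: (@near_int_itv _ (fun t => 0 * (g (x + t * u, y + t * v)).1 +
      tau'.2^-1 * (g (x + t * u, y + t * v)).2) a) => //.
      exact: (@linear_continuous_box g U 0 (tau'.2^-1) x y u v a b oU cg H).
      move=> t /H /gL /latticeE[i1 [i2 ->]]; exists i2.
      by rewrite -coord2E c2.
    by rewrite -coord2E E c2.
  rewrite E' c1 in h1; rewrite E' c2 in h2.
  by rewrite E E' (eqi _ _ h1) (eqi _ _ h2).
have gc z w : U z -> U w -> g z = g w.
  apply: (punctured_plane_connected t0) => [x a b ab H|y a b ab H].
    have := seg x 0 0 1 a b ab; rewrite !mulr0 !mulr1 !addr0 !add0r; apply.
    by move=> t /H; rewrite mulr0 mulr1 add0r addr0.
  have := seg 0 y 1 0 a b ab; rewrite !mulr0 !mulr1 !addr0 !add0r; apply.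
  by move=> t /H; rewrite mulr0 mulr1 add0r addr0.
have U0 : U (1 / 2, 0).
  move=> /coord_lattice -/(_ t0) [i1 [i2 [+ _]]].
  rewrite /coord1 /= mul0r mul0r subr0 => E.
  have : 1 / 2 != i1%:~R :> R by apply: (@int_gap _ _ 0); lra.
  by rewrite E eqxx.
have /latticeE[j [k E]] := gL _ U0.
exists j, k => z Uz.
by rewrite -E -(gc z _ Uz U0) /g [RHS]addrC subrK.
Qed.

(* Near the puncture [F] stays close to the lattice: the part of the target
   torus away from its puncture is compact, hence so is its image under [G]. *)
Lemma near_puncture_lattice : exists2 d : R, 0 < d &
  forall z, z != (0, 0) -> `|z.1| < d -> `|z.2| < d ->
  [/\ U z, exists m : int, `|coord1 tau' (F z) - m%:~R| < 1 / 2 &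
    exists m : int, `|coord2 tau' (F z) - m%:~R| < 1 / 2].
Proof.
have tn : tau.2 != 0 by rewrite gt_eqF.
have tn' : tau'.2 != 0 by rewrite gt_eqF.
have tp : 0 < tau.2 := t0.
pose W := of_coord tau'.
pose I01 : set R := `[0, 1]%classic.
pose Imid : set R := `[1 / 4, 3 / 4]%classic.
(* [C] consists of the points of the unit square with some coordinate at distance at least [1 / 4]
   from the integers. It is compact and free of lattice points; outside it both coordinates are
   within [1 / 4] of an integer. *)
pose C := (Imid `*` I01) `|` (I01 `*` Imid).
have cC : compact C.
  by apply: compactU; apply: compact_setX; exact: segment_compact.
have mid_gap (x : R) (m : int) : 1 / 4 <= x <= 3 / 4 -> x = m%:~R -> False.
  move=> /andP[h1 h2] E; have : x != m%:~R by apply: (@int_gap _ _ 0); lra.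
  by rewrite E eqxx.
have UW st : C st -> U' (W st).
  move=> Cst /coord_lattice -/(_ t0') [m [n []]].
  rewrite /coord1 /coord2 /W /of_coord /= mulfK// addrK => E1 E2.
  by case: Cst => -[]; rewrite /Imid /= !in_itv /=; [move=> /mid_gap/(_ E1)|move=> _ /mid_gap/(_ E2)].
(* [P d st] says that [G (W st)] keeps distance [d], in the maximum norm, from the lattice of [tau].
   Compactness of [C] makes one [d] serve for all of its points. *)
pose P (d : R) (st : R * R) := forall m n : int,
  ~ (`|(G (W st)).1 - (lattice_point tau m n).1| < d /\
     `|(G (W st)).2 - (lattice_point tau m n).2| < d).
have /compact_near_coveringP := cC.
move=> /(_ R (0 : R)^'+ P _) [].
  move=> st Cst.
  have [UG FGW] := GK (UW _ Cst).
  have [r r0 Hr] : exists2 r : R, 0 < r & forall w, `|(G (W st)).1 - w.1| < r ->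
      `|(G (W st)).2 - w.2| < r -> U w.
    by apply/nbhs_boxP; exact: open_nbhs_nbhs.
  have r20 : 0 < r / 2 by rewrite divr_gt0.
  have [d d0 Hd] := continuous_box oU' cG (UW _ Cst) r20.
  have [c c0 Hc] := of_coord_box st t0' d0.
  exists ([set w | ball st c w], [set e | e < r / 2]) => /=.
    split; first exact: nbhsx_ballx.
    by apply: nbhs_right_lt.
  move=> [w e] /= [[b1 b2] er] m n [h1 h2].
  have [W1 W2] := Hc w b1 b2.
  have [//|//|] := Hd (W w).
  move=> _ g1 g2; apply: (Hr (lattice_point tau m n)); last exact: lattice_pointP.
    apply: (le_lt_trans (ler_distD (G (W w)).1 _ _)); lra.
  apply: (le_lt_trans (ler_distD (G (W w)).2 _ _)); lra.
move=> d0 /= d0p Hd0.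
(* The bound [d0 / 2] leaves room below the uniform distance; the bounds [1 / 2] and [tau.2 / 2]
   leave the origin as the only lattice point in the box. *)
pose d := Num.min (d0 / 2) (Num.min (1 / 2) (tau.2 / 2)).
have dd0 : d < d0.
  by rewrite gt_min; apply/orP; left; lra.
have d1 : d < 1 by rewrite !gt_min; apply/orP; right; apply/orP; left; lra.
have dt : d < tau.2 by rewrite !gt_min; apply/orP; right; apply/orP; right; lra.
have dp : 0 < d by rewrite !lt_min; apply/and3P; split; lra.
have Ubox z : z != (0, 0) -> `|z.1| < d -> `|z.2| < d -> U z.
  move=> z0 z1 z2 /latticeE[m [n E]].
  move: z1 z2 z0; rewrite E /= => z1 z2.
  have n0 : n = 0.
    apply: int_norm_lt1; rewrite -(ltr_pM2l t0) mulr1.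
    by apply: le_lt_trans (lt_trans z2 dt); rewrite normrM (gtr0_norm t0).
  have m0 : m = 0.
    move: z1; rewrite n0 mulr0 addr0 => z1.
    by apply: int_norm_lt1; rewrite (lt_trans z1).
  by rewrite /lattice_point n0 m0 !mulr0 addr0 eqxx.
exists d => // z z0 z1 z2.
  have Uz := Ubox z z0 z1 z2.
  set al := coord1 _ _; set be := coord2 _ _.
  have Fz : F z = (al + be * tau'.1, be * tau'.2).
    by rewrite [LHS]surjective_pairing /al /be /coord1 /coord2; congr pair; field.
  have /andP[a1 a2] := floor_itv al; have /andP[b1 b2] := floor_itv be.
  rewrite intrD in a2; rewrite intrD in b2.
  set i := Num.floor al in a1 a2; set j := Num.floor be in b1 b2.
  pose st : R * R := (al - i%:~R, be - j%:~R).
  (* [F z] and [W st] differ by a lattice vector of [tau'], so [z] and [G (W st)] differ by one of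
     [tau]. As [z] is within [d] of the origin, this would put [G (W st)] too close to the
     lattice. *)
  have nC : ~ C st.
    move=> Cst.
    have [UG FGW] := GK (UW _ Cst).
    have : lattice tau (G (W st) - z).
      apply/FG => //; rewrite FGW Fz; apply/latticeE; exists (- i), (- j).
      by rewrite /W /of_coord /lattice_point !intrN; congr pair => /=; ring.
    move=> /latticeE[m [n E]].
    have E' : G (W st) = z + lattice_point tau m n by rewrite -E addrC subrK.
    have : P ((d + d0) / 2) st.
      by apply: Hd0 => //=; rewrite ?sub0r ?normrN ?gtr0_norm; lra.
    move=> /(_ m n); apply; rewrite E' /=.
    rewrite addrK addrK; split; lra.
  have midd (x : R) (k : int) : k%:~R <= x -> x < k%:~R + 1 ->
      ~ (1 / 4 <= x - k%:~R <= 3 / 4) -> exists m : int, `|x - m%:~R| < 1 / 2.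
    move=> x1 x2 nx; have [h|h] := ltP (x - k%:~R) (1 / 4).
      by exists k; rewrite ger0_norm; lra.
    exists (k + 1); rewrite intrD ler0_norm; last lra.
    suff : 3 / 4 < x - k%:~R by lra.
    by rewrite ltNge; apply/negP => h'; apply: nx; rewrite h h'.
  split => //.
    apply: (midd _ i) => // h; apply: nC; left; split => //=.
    by rewrite /I01 /= in_itv /=; apply/andP; split; lra.
  apply: (midd _ j) => // h; apply: nC; right; split => //=.
  by rewrite /I01 /= in_itv /=; apply/andP; split; lra.
Qed.

(** A punctured box is connected, so the integers nearest to the two coordinates of [F] cannot
    change on it; [j] and [k] are read off at the point [(d / 2, d / 2)]. *)
Lemma near_puncture : exists2 d : R, 0 < d & exists j k : int,
  forall z, z != (0, 0) -> `|z.1| < d -> `|z.2| < d ->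
  [/\ U z, `|coord1 tau' (F z) - j%:~R| < 1 / 2 &
      `|coord2 tau' (F z) - k%:~R| < 1 / 2].
Proof.
have [d dp near] := near_puncture_lattice.
pose S z := [/\ z != (0, 0), `|z.1| < d & `|z.2| < d].
pose near_int (p q : R) (j : int) z := `|p * (F z).1 + q * (F z).2 - j%:~R| < 1 / 2.
have SU z : S z -> U z by case=> w0 w1 w2; have [] := near z w0 w1 w2.
have move (p q : R) : (forall z, S z -> exists m, near_int p q m z) ->
    forall (x y u v a b : R) (j : int),
    (forall t, Num.min a b <= t <= Num.max a b -> S (x + t * u, y + t * v)) ->
    near_int p q j (x + a * u, y + a * v) ->
    near_int p q j (x + b * u, y + b * v).
  move=> H x y u v a b j HS.
  apply: (@near_int_itvC (fun t => p * (F (x + t * u, y + t * v)).1 + q * (F (x + t * u, y + t * v)).2) a b j).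
    apply: (@linear_continuous_box F U p q x y u v _ _ oU cF) => t tab.
    exact/SU/HS.
  by move=> t tab; apply: H; exact: HS.
have d2 : `|d / 2| < d by rewrite gtr0_norm; lra.
have mm (a b t : R) : `|a| < d -> `|b| < d -> Num.min a b <= t <= Num.max a b -> `|t| < d.
  rewrite !ltr_norml => /andP[a1 a2] /andP[b1 b2] /andP[].
  by rewrite ge_min le_max => /orP[h1|h1] /orP[h2|h2]; apply/andP; split; lra.
have connect (p q : R) : (forall z, S z -> exists m, near_int p q m z) ->
    forall j : int, near_int p q j (d / 2, d / 2) ->
    forall z, S z -> near_int p q j z.
  move=> H j Hj z [z0 z1 z2].
  (* Two legs lead from [(d / 2, d / 2)] to [z]. Their order is chosen so that the last leg avoids
     the origin: it is horizontal if [z] lies on the vertical axis, and vertical otherwise. *)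
  have [zx|zx] := eqVneq z.1 0.
    have zy : z.2 != 0.
      by apply: contra z0 => /eqP zy; rewrite [z]surjective_pairing zx zy.
    have s1 : near_int p q j (d / 2, z.2).
      have := @move p q H (d / 2) 0 0 1 (d / 2) z.2 j.
      rewrite !mulr0 !mulr1 !addr0 !add0r; apply => // t tab.
      rewrite mulr0 mulr1 addr0 add0r; split => //=; last exact: mm tab.
      by rewrite xpair_eqE negb_and gt_eqF// divr_gt0.
    have zE : z = (0, z.2) by rewrite -zx -surjective_pairing.
    suff : near_int p q j (0, z.2) by rewrite -zE.
    have := @move p q H 0 z.2 1 0 (d / 2) 0 j.
    rewrite !mulr0 !mulr1 !addr0 !add0r; apply => // t tab.
    rewrite mulr0 mulr1 addr0 add0r; split => //=; last by apply: mm tab; rewrite ?normr0.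
    by rewrite xpair_eqE negb_and zy orbT.
  have s1 : near_int p q j (z.1, d / 2).
    have := @move p q H 0 (d / 2) 1 0 (d / 2) z.1 j.
    rewrite !mulr0 !mulr1 !addr0 !add0r; apply => // t tab.
    rewrite mulr0 mulr1 addr0 add0r; split => //=; last exact: mm tab.
    by rewrite xpair_eqE negb_and [d / 2 == 0]gt_eqF ?orbT// divr_gt0.
  have := @move p q H z.1 0 0 1 (d / 2) z.2 j.
  rewrite !mulr0 !mulr1 !addr0 !add0r -surjective_pairing; apply => // t tab.
  rewrite mulr0 mulr1 addr0 add0r; split => //=; last exact: mm tab.
  by rewrite xpair_eqE negb_and zx.
have S0 : S (d / 2, d / 2).
  by split => //=; rewrite xpair_eqE negb_and gt_eqF// divr_gt0.
have [_ [j Hj] [k Hk]] := near _ (let: And3 a _ _ := S0 in a) d2 d2.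
exists d => //; exists j, k => z z0 z1 z2; have Sz : S z by split.
split; first exact: SU.
  rewrite coord1E; apply: (connect _ _ _ j) => //; last by rewrite /near_int -coord1E.
  by move=> w [w0 w1 w2]; have [_ [m ?] _] := near w w0 w1 w2; exists m; rewrite /near_int -coord1E.
rewrite coord2E; apply: (connect _ _ _ k) => //; last by rewrite /near_int -coord2E.
by move=> w [w0 w1 w2]; have [_ _ [m ?]] := near w w0 w1 w2; exists m; rewrite /near_int -coord2E.
Qed.

(** [F] induces a homomorphism of translation groups. [e] is the image of [1], and [f] is solved
    from [tau.1 e + tau.2 f], the image of [tau]. The determinant is known only up to sign, because
    a homeomorphism may reverse orientation. *)
Lemma lattice_hom : exists a b c d : int,
  let e := lattice_point tau' a b in
  let f := ((lattice_point tau' c d).1 / tau.2 - tau.1 / tau.2 * e.1,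
            (lattice_point tau' c d).2 / tau.2 - tau.1 / tau.2 * e.2) in
  [/\ (a * d - b * c) ^+ 2 = 1, directional e f tau = lattice_point tau' c d &
  forall z m n, U z -> F (z + lattice_point tau m n) =
    F z + directional e f (lattice_point tau m n)].
Proof.
have tn : tau.2 != 0 by rewrite gt_eqF.
have tn' : tau'.2 != 0 by rewrite gt_eqF.
have [a [b Hab]] := homeo_translate 1 0.
have [c [d Hcd]] := homeo_translate 0 1.
exists a, b, c, d => e f.
have mult m n j k : (forall z, U z ->
    F (z + lattice_point tau m n) = F z + lattice_point tau' j k) ->
    forall (i : int) z, U z ->
    F (z + lattice_point tau (i * m) (i * n)) = F z + lattice_point tau' (i * j) (i * k).
  move=> H; elim/int_ind => [|i IH|i IH] z Uz.
  - rewrite !mul0r; have l0 t : lattice_point t 0 0 = 0 by rewrite /lattice_point mulr0 addr0 mulr0.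
    by rewrite !l0 !addr0.
  - have -> : i.+1%:Z = i%:Z + 1 by rewrite intS addrC.
    rewrite !mulrDl !mul1r -!lattice_pointD !addrA H; last exact/punctured_planeD.
    by rewrite IH.
  - have := H (z + lattice_point tau (- i.+1%:Z * m) (- i.+1%:Z * n)).
    have E x : - i.+1%:Z * x + x = - i%:Z * x by rewrite intS; ring.
    rewrite -addrA lattice_pointD !E IH// => HH.
    have {}HH := HH (iffRL (punctured_planeD _ _ _) Uz).
    apply: (addIr (lattice_point tau' j k)); rewrite -HH.
    by rewrite -addrA lattice_pointD !E.
have FE z m n : U z -> F (z + lattice_point tau m n) =
    F z + lattice_point tau' (m * a + n * c) (m * b + n * d).
  move=> Uz; have := mult _ _ _ _ Hcd n (z + lattice_point tau (m * 1) (m * 0)).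
  rewrite (mult _ _ _ _ Hab)// -addrA lattice_pointD !mulr0 !mulr1 add0r addr0.
  by move=> ->; [rewrite -addrA lattice_pointD|exact/punctured_planeD].
have dE m n : directional e f (lattice_point tau m n) =
    lattice_point tau' (m * a + n * c) (m * b + n * d).
  rewrite /directional /f /e /lattice_point /= !intrD !intrM; congr pair; by field.
split.
- have U1 : exists w, U' w.
    exists (1 / 2, 0) => /coord_lattice -/(_ t0') [i1 [i2 [+ _]]].
    rewrite /coord1 /= mul0r mul0r subr0 => E.
    have : 1 / 2 != i1%:~R :> R by apply: (@int_gap _ _ 0); lra.
    by rewrite E eqxx.
  have [w Uw] := U1.
  (* Transporting a translation back through [G] shows that the homomorphism is onto. Preimages of
     the two basis vectors then form an integer inverse of the matrix, so its determinant is a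
     unit. *)
  have hit j k : exists m n : int, m * a + n * c = j /\ m * b + n * d = k.
    have Uw' : U' (w + lattice_point tau' j k).
      by move: Uw; apply: contra_not => /lattice_latticeD.
    have [U2 F2] := GK Uw; have [U3 F3] := GK Uw'.
    have : lattice tau (G (w + lattice_point tau' j k) - G w).
      apply/FG => //; rewrite F2 F3 [w + _]addrC addrK; exact: lattice_pointP.
    move=> /latticeE[m [n E]]; exists m, n.
    apply: (lattice_point_inj t0').
    have := FE (G w) m n U2; rewrite -E [G w + _]addrC subrK F3 F2.
    by move=> /addrI.
  have [m [n [h1 h2]]] := hit 1 0; have [m' [n' [h3 h4]]] := hit 0 1.
  have D : (m * n' - m' * n) * (a * d - b * c) = 1.
    have -> : (m * n' - m' * n) * (a * d - b * c) =
      (m * a + n * c) * (m' * b + n' * d) - (m' * a + n' * c) * (m * b + n * d) by ring.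
    by rewrite h1 h2 h3 h4.
  move: (m * n' - m' * n) (a * d - b * c) D => x y D.
  move/(congr1 absz): D; rewrite abszM => /eqP; rewrite muln_eq1 => /andP[_ /eqP y1].
  by have [->|->] : y = 1 \/ y = -1 by lia.
- have := dE 0 1; rewrite !mul0r !mul1r !add0r (_ : lattice_point tau 0 1 = tau)//.
  by rewrite /lattice_point add0r !mulr1 -surjective_pairing.
- by move=> z m n Uz; rewrite FE// dE.
Qed.

(** By equivariance it is enough to bound [F] on one compact cell. The cell is centred at the
    origin, so that its only lattice point is the origin, where [near_puncture] bounds [F];
    elsewhere continuity does. *)
Lemma near_linear_bounded e f :
  (forall z m n, U z -> F (z + lattice_point tau m n) =
    F z + directional e f (lattice_point tau m n)) ->
  exists M : R, forall z, U z ->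
    `|(F z).1 - (directional e f z).1| <= M /\
    `|(F z).2 - (directional e f z).2| <= M.
Proof.
move=> per.
have tn : tau.2 != 0 by rewrite gt_eqF.
have tn' : tau'.2 != 0 by rewrite gt_eqF.
pose I12 : set R := `[- (1 / 2), 1 / 2]%classic.
have cI : compact (I12 `*` I12) by apply: compact_setX; exact: segment_compact.
pose P (M : R) st := U (of_coord tau st) ->
  `|(F (of_coord tau st)).1| <= M /\ `|(F (of_coord tau st)).2| <= M.
have Hloc st : (I12 `*` I12) st -> exists d B : R, 0 < d /\
    forall w, `|(of_coord tau st).1 - w.1| < d -> `|(of_coord tau st).2 - w.2| < d ->
    U w -> `|(F w).1| <= B /\ `|(F w).2| <= B.
  move=> [/=]; rewrite /I12 /= !in_itv /= => s1 s2.
  have [/coord_lattice -/(_ t0) [m [n []]]|Ust] := pselect (lattice tau (of_coord tau st)).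
    rewrite /coord1 /coord2 /of_coord /= mulfK// addrK => E1 E2.
    have m0 : m = 0 by apply: int_norm_lt1; rewrite -E1 ltr_norml; lra.
    have n0 : n = 0 by apply: int_norm_lt1; rewrite -E2 ltr_norml; lra.
    have [d d0 [j [k H]]] := near_puncture.
    exists d, ((`|j%:~R| + 1 / 2) + (`|k%:~R| + 1 / 2) * (`|tau'.1| + tau'.2)).
    split => // w; rewrite E1 E2 m0 n0 /= mul0r mul0r addr0 !sub0r !normrN => w1 w2 Uw.
    have [|_ h1 h2] := H w _ w1 w2.
      by apply/eqP => w0; apply: Uw; rewrite w0; exact: lattice0.
    have F1 : (F w).1 = coord1 tau' (F w) + coord2 tau' (F w) * tau'.1.
      by rewrite /coord1 /coord2; field.
    have F2 : (F w).2 = coord2 tau' (F w) * tau'.2.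
      by rewrite /coord2; field.
    have b1 : `|coord1 tau' (F w)| <= `|j%:~R| + 1 / 2.
      rewrite -[coord1 _ _](subrK j%:~R) addrC (le_trans (ler_normD _ _))// lerD2l.
      by rewrite ltW.
    have b2 : `|coord2 tau' (F w)| <= `|k%:~R| + 1 / 2.
      rewrite -[coord2 _ _](subrK k%:~R) addrC (le_trans (ler_normD _ _))// lerD2l.
      by rewrite ltW.
    rewrite F1 F2; split.
      apply: (le_trans (ler_normD _ _)); rewrite normrM.
      apply: lerD => //; apply: ler_pM => //.
      by rewrite lerDl ltW.
    rewrite normrM (gtr0_norm t0') -[leLHS]add0r; apply: lerD.
      by rewrite addr_ge0// divr_ge0.
    by apply: ler_pM => //; [exact: ltW|rewrite lerDr].
  have [d d0 H] := continuous_box oU cF Ust ltr01; set w0 := F (of_coord tau st) in H *.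
  exists d, (1 + `|w0.1| + `|w0.2|); split => // w w1 w2 _.
  have [_ h1 h2] := H w w1 w2.
  have n1 := normr_ge0 w0.1; have n2 := normr_ge0 w0.2.
  have k1 : `|(F w).1| <= `|w0.1| + `|w0.1 - (F w).1|.
    by rewrite -[X in `|X| <= _](subKr w0.1) ler_normB.
  have k2 : `|(F w).2| <= `|w0.2| + `|w0.2 - (F w).2|.
    by rewrite -[X in `|X| <= _](subKr w0.2) ler_normB.
  by move: h1 h2 n1 n2 k1 k2; clear; move: `|w0.1| `|w0.2| => A B *; split; lra.
have /compact_near_coveringP := cI.
move=> /(_ R +oo%R P _) [].
  move=> st Ist; have [d [B [d0 HB]]] := Hloc st Ist.
  have [c c0 Hc] := of_coord_box st t0 d0.
  exists ([set w | ball st c w], [set M | B < M]) => /=.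
    split; first exact: nbhsx_ballx.
    by exists B; split => //; exact: num_real.
  move=> [w M] /= [[b1 b2] BM] Uw.
  have [w1 w2] := Hc w b1 b2.
  have [h1 h2] := HB _ w1 w2 Uw.
  by split; [exact: (le_trans h1 (ltW BM))|exact: (le_trans h2 (ltW BM))].
move=> M0 [_ HM0].
pose M := M0 + 1.
have HM st : (I12 `*` I12) st -> P M st by apply: HM0; rewrite /M ltrDl.
pose X := 1 / 2 + 1 / 2 * `|tau.1|; pose Y := 1 / 2 * tau.2.
exists (M + ((`|e.1| + `|e.2|) * X + (`|f.1| + `|f.2|) * Y)) => z Uz.
pose m := Num.floor (coord1 tau z + 1 / 2); pose n := Num.floor (coord2 tau z + 1 / 2).
pose st : R * R := (coord1 tau z - m%:~R, coord2 tau z - n%:~R).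
have /andP[m1 m2] := floor_itv (coord1 tau z + 1 / 2).
have /andP[n1 n2] := floor_itv (coord2 tau z + 1 / 2).
rewrite -/m -/n !intrD in m1 m2 n1 n2.
have I1 : - (1 / 2) <= st.1 <= 1 / 2 by rewrite /st /=; apply/andP; split; lra.
have I2 : - (1 / 2) <= st.2 <= 1 / 2 by rewrite /st /=; apply/andP; split; lra.
have Ist : (I12 `*` I12) st by split; rewrite /I12 /= in_itv /=.
have zE : z = of_coord tau st + lattice_point tau m n.
  rewrite [LHS]surjective_pairing /of_coord /lattice_point /st /coord1 /coord2.
  congr pair => /=; by field.
have Ust : U (of_coord tau st) by rewrite zE in Uz; exact: (iffLR (punctured_planeD _ _ _) Uz).
have [h1 h2] := HM st Ist Ust.
have LD v w : directional e f (v + w) = directional e f v + directional e f w.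
  rewrite /directional; congr pair => /=; by ring.
have -> : F z = F (of_coord tau st) + directional e f (lattice_point tau m n).
  by rewrite {1}zE per.
have -> : directional e f z = directional e f (of_coord tau st) + directional e f (lattice_point tau m n).
  by rewrite -LD -zE.
have c1 (p q r : R * R) : (p + r).1 - (q + r).1 = p.1 - q.1 by rewrite /=; ring.
have c2 (p q r : R * R) : (p + r).2 - (q + r).2 = p.2 - q.2 by rewrite /=; ring.
rewrite c1 c2.
have Xb : `|(of_coord tau st).1| <= X.
  apply: (le_trans (ler_normD _ _)); rewrite normrM; apply: lerD; first by rewrite ler_norml.
  by rewrite ler_wpM2r// ler_norml.
have Yb : `|(of_coord tau st).2| <= Y.
  by rewrite normrM (gtr0_norm t0) ler_wpM2r ?(ltW t0)// ler_norml.
have XY (x y p q p' q' : R) : `|x| <= X -> `|y| <= Y ->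
    `|x * p + y * q| <= (`|p| + `|p'|) * X + (`|q| + `|q'|) * Y.
  move=> xX yY; apply: (le_trans (ler_normD _ _)).
  rewrite !normrM [`|x| * _]mulrC [`|y| * _]mulrC.
  by apply: lerD; apply: ler_pM => //; rewrite lerDl.
split; apply: (le_trans (ler_normB _ _)); apply: lerD => //; first exact: XY.
rewrite [`|e.1| + _]addrC [`|f.1| + _]addrC; exact: XY.
Qed.

End Homeo.

Lemma torus_homeo_linear tau tau' F : 0 < tau.2 -> 0 < tau'.2 ->
  torus_homeo tau tau' F ->
  exists (a b c d : int) (e f : R * R) (M : R),
  [/\ (a * d - b * c) ^+ 2 = 1, e = lattice_point tau' a b,
      directional e f tau = lattice_point tau' c d,
      forall z m n, punctured_plane tau z ->
        F (z + lattice_point tau m n) = F z + directional e f (lattice_point tau m n) &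
      forall z, punctured_plane tau z ->
        `|(F z).1 - (directional e f z).1| <= M /\
        `|(F z).2 - (directional e f z).2| <= M].
Proof.
move=> t0 t0' [G [FK GK cF cG FG]].
have [a [b [c [d /= [abcd ef per]]]]] := lattice_hom t0 t0' GK cF FG.
have [M HM] := near_linear_bounded t0 t0' GK cF cG FG per.
by exists a, b, c, d; do 2 eexists; exists M; split; [exact: abcd| |exact: ef|exact: per|exact: HM].
Qed.

End TorusHomeo.

(** * Measure theory on the plane *)

Lemma ae_mono d (T : measurableType d) (R : realType) (m : {measure set T -> \bar R}) (P Q : T -> Prop) :
  (forall x, P x -> Q x) -> {ae m, forall x, P x} -> {ae m, forall x, Q x}.
Proof. by move=> PQ; apply: filterS. Qed.
Lemma ae_and d (T : measurableType d) (R : realType) (m : {measure set T -> \bar R}) (P Q : T -> Prop) :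
  {ae m, forall x, P x} -> {ae m, forall x, Q x} -> {ae m, forall x, P x /\ Q x}.
Proof. by move=> p q; apply: filterI. Qed.

Lemma measurable_preimage d d' (T : measurableType d) (T' : measurableType d')
    (f : T -> T') (B : set T') :
  measurable_fun [set: T] f -> measurable B -> measurable (f @^-1` B).
Proof. by move=> mf mB; rewrite -[X in measurable X]setTI; exact: mf. Qed.

Section PlaneMeasurability.
Variable R : realType.

Lemma measurable_cmod : measurable_fun [set: R * R] (@cmod R).
Proof.
apply: measurableT_comp => //.
  by apply: continuous_measurable_fun; exact: sqrt_continuous.
by apply: measurable_funD; apply: measurable_funX; [exact: measurable_fst|exact: measurable_snd].
Qed.

Lemma measurable_disk (r : R) : measurable [set z : R * R | cmod z <= r].
Proof.
rewrite (_ : [set z | _] = @cmod R @^-1` `]-oo, r]%classic).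
  by apply: measurable_preimage; [exact: measurable_cmod|exact: measurable_itv].
by apply/seteqP; split => z /=; rewrite in_itv.
Qed.

Lemma ler_norm_cmod (z : R * R) : `|z.1| <= cmod z /\ `|z.2| <= cmod z.
Proof.
split; rewrite -(@ler_pXn2r _ 2)// ?nnegrE ?cmod_ge0// cmod_sqr real_normK ?num_real//.
  by rewrite lerDl sqr_ge0.
by rewrite lerDr sqr_ge0.
Qed.

Lemma measurable_translate (w : R * R) :
  measurable_fun [set: R * R] (fun z : R * R => z + w).
Proof.
apply/measurable_fun_pairP; split => /=.
  by apply: measurable_funD; [exact: measurable_fst|exact: measurable_cst].
by apply: measurable_funD; [exact: measurable_snd|exact: measurable_cst].
Qed.

End PlaneMeasurability.

(** * Open sets of the plane and translations of the line *)

Section LebesgueBasics.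
Variable R : realType.
Local Notation mu := (@lebesgue_measure R).

(** Measurability in the plane refers to the product sigma-algebra, so an open set is written as a
    countable union of boxes with rational centres. *)
Lemma open_measurable2 (U : set (R * R)) : open U -> measurable U.
Proof.
move=> oU.
pose B (q : rat * rat * nat) : set (R * R) :=
  ball (ratr q.1.1 : R) (q.2.+1%:R^-1) `*` ball (ratr q.1.2 : R) (q.2.+1%:R^-1).
have -> : U = \bigcup_(q in [set q | B q `<=` U]) B q.
  apply/seteqP; split => [z Uz|z [q] /= qU Bz]; last exact: qU.
  have /nbhs_boxP[e e0 He] : nbhs z U by exact: open_nbhs_nbhs.
  have [n _ Hn] := near_infty_natSinv_lt (PosNum (divr_gt0 e0 (ltr0n R 2))).
  have {}Hn := Hn n (leqnn n); rewrite /= in Hn.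
  have n0 : 0 < n.+1%:R^-1 :> R by rewrite invr_gt0.
  have tri (x y r : R) : `|r - x| < n.+1%:R^-1 -> `|r - y| < n.+1%:R^-1 -> `|x - y| < e.
    move=> h1 h2; apply: (le_lt_trans (ler_distD r _ _)); rewrite distrC.
    by rewrite [ltRHS]splitr ltrD// (lt_trans _ Hn).
  have ap (x : R) : exists q : rat, `|ratr q - x| < n.+1%:R^-1.
    have [|q] := @rat_in_itvoo R (x - n.+1%:R^-1) (x + n.+1%:R^-1).
      by rewrite ltrD2l gtrN.
    rewrite in_itv /= => /andP[h1 h2]; exists q.
    by rewrite ltr_norml ltrBDr ltrBlDr [- _ + _]addrC h1 addrC.
  have [q1 h1] := ap z.1; have [q2 h2] := ap z.2.
  exists (q1, q2, n) => //= w [/= w1 w2].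
  rewrite /ball /= in w1 w2.
  by apply: He; [exact: tri h1 w1|exact: tri h2 w2].
rewrite bigcup_mkcond; apply: countable_bigcupT_measurable => // q; case: ifP => // _.
by apply: measurableX; exact: measurable_ball.
Qed.

Lemma continuous_measurable2 (U : set (R * R)) (f : R * R -> R) : open U ->
  {in U, continuous f} -> measurable_fun U f.
Proof.
move=> oU cf mU; apply: (measurability _ (@RGenOpens.measurableE R)).
move=> /= _ [_ [a [b ->] <-]]; rewrite -/(U `&` f @^-1` _).
apply: open_measurable2; rewrite openE => z [Uz fz]; apply: filterI.
  exact: open_nbhs_nbhs.
by apply: (cf z (mem_set Uz)); apply: open_nbhs_nbhs; split.
exact: mU.
Qed.

Lemma lebesgue_measureD (a : R) (A : set R) : measurable A ->
  pushforward mu ((fun x => x + a) : _ -> measurableTypeR R) A = mu A.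
Proof.
have mp : measurable_fun [set: measurableTypeR R] ((fun x => x + a) : measurableTypeR R -> measurableTypeR R).
  exact: measurable_funD.
pose m' := [the measure _ _ of pushforward mu ((fun x => x + a) : measurableTypeR R -> measurableTypeR R)].
move=> mA; apply/esym/(lebesgue_measure_unique (mu := m' mp)) => //= _ [[u v]] _ <-.
rewrite /pushforward (_ : _ @^-1` _ = `]u - a, v - a]%classic).
  by rewrite !lebesgue_measure_itv/= !lte_fin ltrD2r; case: ifP => // _; congr EFin; ring.
apply/seteqP; split => x /=; rewrite !in_itv /= => /andP[h1 h2]; apply/andP; split; lra.
Qed.

Lemma ge0_integral_translate (a : R) (D : set R) (f : R -> \bar R) :
  measurable D -> measurable_fun D f -> (forall x, D x -> (0 <= f x)%E) ->
  (\int[mu]_(x in D) f x =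
   \int[mu]_(x in (fun x => x + a)%R @^-1` D) f (x + a)%R)%E.
Proof.
move=> mD mf f0.
have mp : measurable_fun [set: measurableTypeR R] ((fun x => x + a) : measurableTypeR R -> measurableTypeR R).
  exact: measurable_funD.
rewrite -[RHS](@ge0_integral_pushforward _ _ _ _ _ _ mp mu D f)//; last first.
  by move=> x; rewrite inE; exact: f0.
by apply: eq_measure_integral => //= A mA AS; exact/esym/lebesgue_measureD.
Qed.

Lemma itv_finite (u v : R) : (mu `[u, v]%classic < +oo)%E.
Proof. by rewrite lebesgue_measure_itv /=; case: ifP => _; rewrite ?ltry. Qed.

Lemma bounded_integrable d (T : measurableType d) (m : {measure set T -> \bar R})
    (D : set T) (f : T -> R) (M : R) : measurable D -> (m D < +oo)%E ->
  measurable_fun D f -> (forall x, D x -> `|f x| <= M) ->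
  m.-integrable D (EFin \o f).
Proof.
move=> mD Doo mf fM; apply: measurable_bounded_integrable => //.
exists M; split; first exact: num_real.
by move=> x Mx z Dz; apply: le_trans (ltW Mx); exact: fM.
Qed.

Lemma Rintegral_translate (a u v : R) (f : R -> R) (M : R) :
  measurable_fun [set: R] f -> (forall x, `|f x| <= M) ->
  \int[mu]_(x in `[u, v]) f (x + a) = \int[mu]_(x in `[(u + a)%R, (v + a)%R]) f x.
Proof.
move=> mf fM; rewrite /Rintegral.
have mp : measurable_fun [set: measurableTypeR R] ((fun x => x + a) : measurableTypeR R -> measurableTypeR R).
  exact: measurable_funD.
have pre : (fun x : R => x + a) @^-1` `[u + a, v + a]%classic = `[u, v]%classic.
  by apply/seteqP; split => x /=; rewrite !in_itv /= => /andP[h1 h2]; apply/andP; split; lra.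
congr fine.
rewrite -[in LHS]pre.
rewrite -[LHS](@integral_pushforward _ _ _ _ _ _ mp mu _ (EFin \o f))//.
- by apply: eq_measure_integral => //= A mA AS; exact: lebesgue_measureD.
- exact/measurable_EFinP.
- rewrite pre; apply: (@bounded_integrable _ _ _ _ _ M) => //.
    exact: itv_finite.
  by apply: measurable_funTS; apply: measurableT_comp.
Qed.

Lemma itv_integrable (u v : R) (f : R -> R) (M : R) :
  measurable_fun [set: R] f -> (forall x, `|f x| <= M) ->
  mu.-integrable `[u, v] (EFin \o f).
Proof.
move=> mf fM; apply: (@bounded_integrable _ _ _ _ _ M) => //.
  exact: itv_finite.
exact: measurable_funTS.
Qed.

Lemma Rintegral_split (f : R -> R) (a b c : R) : a <= b -> b <= c ->
  mu.-integrable `[a, c] (EFin \o f) ->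
  \int[mu]_(x in `[a, c]) f x =
  \int[mu]_(x in `[a, b]) f x + \int[mu]_(x in `[b, c]) f x.
Proof.
move=> ab bc intf.
have := @Rintegral_itvB R f (BLeft a) (BRight c) b intf.
rewrite !bnd_simp => /(_ ab bc); rewrite Rintegral_itv_obnd_cbnd.
  by move=> <-; rewrite addrC subrK.
apply: integrableS intf => // x /=; rewrite !in_itv /= => /andP[h1 ->].
by rewrite andbT (le_trans ab)// ltW.
Qed.

Lemma Rintegral_periodic (f : R -> R) (p c a M : R) : 0 < p ->
  measurable_fun [set: R] f -> (forall x, `|f x| <= M) ->
  (forall x, f (x + p) = f x) ->
  \int[mu]_(x in `[c, (c + p)%R]) f (x + a) = \int[mu]_(x in `[c, (c + p)%R]) f x.
Proof.
move=> p0 mf fM fp.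
rewrite (Rintegral_translate a _ _ mf fM).
suff H b b' : b <= b' -> \int[mu]_(x in `[b, (b + p)%R]) f x =
    \int[mu]_(x in `[b', (b' + p)%R]) f x.
  rewrite addrAC; case: (leP c (c + a)) => h; first exact/esym/H.
  by apply: H; exact: ltW.
move=> bb.
have int := itv_integrable _ _ mf fM.
(* [h1] and [h2] split the same interval [[b, b' + p]]; the pieces [[b, b']] and [[b + p, b' + p]]
   carry equal integrals by periodicity. *)
have h1 := Rintegral_split (_ : b <= b + p) (_ : b + p <= b' + p) (int _ _).
have h2 := Rintegral_split (_ : b <= b') (_ : b' <= b' + p) (int _ _).
have h3 := Rintegral_translate p b b' mf fM.
have h4 : \int[mu]_(x in `[b, b']) f (x + p) = \int[mu]_(x in `[b, b']) f x.
  by apply: eq_Rintegral => x _; rewrite fp.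
have pp : b <= b + p by rewrite lerDl ltW.
have pp2 : b + p <= b' + p by rewrite lerD2r.
have pp3 : b' <= b' + p by rewrite lerDl ltW.
by have := h1 pp pp2; rewrite (h2 bb pp3) -h3 h4 addrC => /addIr.
Qed.

End LebesgueBasics.

(** * Conformal maps *)

Section Components.
Variables (R : realType) (tau e f : R * R) (F : R * R -> R * R) (M : R).
Local Notation U := (punctured_plane tau).

Lemma continuous_components (U : set (R * R)) : {in U, continuous F} ->
  {in U, continuous (fun z => (F z).1)} /\ {in U, continuous (fun z => (F z).2)}.
Proof.
move=> cF; split => z Uz.
  by apply: (@continuous_comp _ _ _ F fst); [exact: cF|exact: cvg_fst].
by apply: (@continuous_comp _ _ _ F snd); [exact: cF|exact: cvg_snd].
Qed.

Lemma period_components :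
  (forall z m n, U z ->
     F (z + lattice_point tau m n) = F z + directional e f (lattice_point tau m n)) ->
  (forall z m n, U z -> (F (z + lattice_point tau m n)).1 =
     (F z).1 + (e.1 * (lattice_point tau m n).1 + f.1 * (lattice_point tau m n).2)) /\
  (forall z m n, U z -> (F (z + lattice_point tau m n)).2 =
     (F z).2 + (e.2 * (lattice_point tau m n).1 + f.2 * (lattice_point tau m n).2)).
Proof.
by move=> per; split => z m n Uz; rewrite per//=; congr (_ + _); rewrite /directional /=; ring.
Qed.

Lemma bound_components :
  (forall z, U z -> `|(F z).1 - (directional e f z).1| <= M /\
     `|(F z).2 - (directional e f z).2| <= M) ->
  (forall z, U z -> `|(F z).1 - (e.1 * z.1 + f.1 * z.2)| <= M) /\
  (forall z, U z -> `|(F z).2 - (e.2 * z.1 + f.2 * z.2)| <= M).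
Proof.
move=> bnd; split => z /bnd[b1 b2].
  by rewrite mulrC [f.1 * _]mulrC.
by rewrite mulrC [f.2 * _]mulrC.
Qed.

End Components.

Lemma continuous_pairl (R : realType) (y : R) : continuous (fun x : R => (x, y)).
Proof.
move=> x P /nbhs_boxP[e e0 H]; exists e => //= t xt.
by apply: H => //=; rewrite subrr normr0.
Qed.

(** * Row averages of periodic functions *)

Section RowAverage.
Variable R : realType.
Local Notation mu := (@lebesgue_measure R).
Variables (tau : R * R) (G : R * R -> R) (M : R).
Hypothesis mG : measurable_fun [set: R * R] G.
Hypothesis GM : forall z, `|G z| <= M.
Hypothesis pG : forall z m n, G (z + lattice_point tau m n) = G z.

Lemma row_average_translate a y :
  \int[mu]_(x in `[0, 1]) G (x + a, y) = \int[mu]_(x in `[0, 1]) G (x, y).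
Proof.
have := @Rintegral_periodic _ (fun x => G (x, y)) 1 0 a _ ltr01
  (measurable_fun_pair1 y mG) (fun x => GM (x, y)).
rewrite add0r; apply => x.
have := pG (x, y) 1 0.
rewrite /lattice_point mulr0 addr0 mulr0 => <-; congr G.
by congr pair; rewrite /= ?addr0.
Qed.

(** Translation by [tau] also slides the row by [tau.1], which an average over a full horizontal
    period does not notice. *)
Lemma row_average_period y :
  \int[mu]_(x in `[0, 1]) G (x, y + tau.2) = \int[mu]_(x in `[0, 1]) G (x, y).
Proof.
rewrite -(row_average_translate (- tau.1) y).
apply: eq_Rintegral => x _.
have := pG (x - tau.1, y) 0 1.
rewrite /lattice_point !mulr1 add0r => <-; congr G.
by congr pair => /=; rewrite subrK.
Qed.

End RowAverage.

Section PeriodicPart.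
Variable R : realType.
Local Notation mu := (@lebesgue_measure R).
Variables (tau : R * R) (g : R * R -> R) (l1 l2 M : R).
Hypothesis t0 : 0 < tau.2.
Local Notation U := (punctured_plane tau).
Hypothesis cg : {in U, continuous g}.
Hypothesis per : forall z m n, U z ->
  g (z + lattice_point tau m n) =
  g z + (l1 * (lattice_point tau m n).1 + l2 * (lattice_point tau m n).2).
Hypothesis bnd : forall z, U z -> `|g z - (l1 * z.1 + l2 * z.2)| <= M.

(** The values of [g] on the lattice are arbitrary. Replacing them by 0 makes the difference from
    the linear part bounded, periodic and measurable on the whole plane. *)
Definition periodic_part : R * R -> R :=
  (fun z => g z - (l1 * z.1 + l2 * z.2)) \_ U.
Local Notation k := periodic_part.

Lemma periodic_partE z : U z -> k z = g z - (l1 * z.1 + l2 * z.2).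
Proof. by move=> Uz; rewrite /periodic_part patchE mem_set. Qed.

Lemma periodic_part_bound z : `|k z| <= `|M|.
Proof.
rewrite /periodic_part patchE; case: ifPn => [|_]; last by rewrite normr0.
by rewrite inE => Uz; rewrite (le_trans (bnd Uz))// ler_norm.
Qed.

Lemma periodic_part_period z m n : k (z + lattice_point tau m n) = k z.
Proof.
have [Uz|nUz] := pselect (U z).
  rewrite !periodic_partE//; last first.
    by move: Uz; apply: contra_not => /lattice_latticeD.
  by rewrite per//=; ring.
rewrite /periodic_part !patchE !memNset//.
by apply: contra_not nUz; apply: contra_not => /lattice_latticeD.
Qed.

Lemma measurable_periodic_part : measurable_fun [set: R * R] k.
Proof.
have oU := open_punctured_plane t0.
apply/(measurable_restrictT _ (open_measurable2 oU)).
apply: measurable_funB; first exact: continuous_measurable2.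
apply: measurable_funD; apply: measurable_funM => //.
  by apply: measurable_funTS; exact: measurable_fst.
by apply: measurable_funTS; exact: measurable_snd.
Qed.

(** The abscissas of lattice points may be dense, but they are countable. *)
Lemma ae_vertical : {ae mu, forall x, forall y, U (x, y)}.
Proof.
pose A := [set x : R | exists q : int * int, x = q.1%:~R + tau.1 * q.2%:~R].
have cA : countable A.
  have -> : A = (fun q : int * int => q.1%:~R + tau.1 * q.2%:~R) @` setT.
    by apply/seteqP; split => x [q]; [exists q|move=> _ <-; exists q].
  exact: (sub_countable (card_image_le _ _)).
exists A; split; first exact: countable_measurable.
  exact: countable_lebesgue_measure0.
move=> x /= H; apply: contrapT => nA; apply: H => y /latticeE[m [n [xE _]]].
by apply: nA; exists (m, n).
Qed.

Lemma ae_horizontal : {ae mu, forall y, forall x, U (x, y)}.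
Proof.
pose A := [set y : R | exists q : int, y = tau.2 * q%:~R].
have cA : countable A.
  have -> : A = (fun q : int => tau.2 * q%:~R) @` setT.
    by apply/seteqP; split => x [q]; [exists q|move=> _ <-; exists q].
  exact: (sub_countable (card_image_le _ _)).
exists A; split; first exact: countable_measurable.
  exact: countable_lebesgue_measure0.
move=> y /= H; apply: contrapT => nA; apply: H => x /latticeE[m [n [_ yE]]].
by apply: nA; exists n.
Qed.

Lemma horizontal_strip x y : 0 < y < tau.2 -> U (x, y).
Proof.
move=> /andP[y0 yt] /coord_lattice -/(_ t0) [m [n [_]]]; rewrite /coord2 /= => E.
have : y / tau.2 != n%:~R.
  by apply: (@int_gap _ _ 0); rewrite ?add0r ?divr_gt0// ltr_pdivrMr ?mul1r.
by rewrite E eqxx.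
Qed.

Lemma measurable_periodic_part1 y : measurable_fun [set: R] (fun x => k (x, y)).
Proof. exact: (measurable_fun_pair1 y measurable_periodic_part). Qed.

Let gamma y := \int[mu]_(x in `[0, 1]) k (x, y).

Lemma average_period y : gamma (y + tau.2) = gamma y.
Proof.
exact: (row_average_period measurable_periodic_part periodic_part_bound
  periodic_part_period).
Qed.

Variables gx gy : R * R -> R.
Hypothesis cgx : {in U, continuous gx}.
Hypothesis cgy : {in U, continuous gy}.
Hypothesis dgx : forall x y, U (x, y) -> is_derive x 1 (fun t : R => g (t, y)) (gx (x, y)).
Hypothesis dgy : forall x y, U (x, y) -> is_derive y 1 (fun t : R => g (x, t)) (gy (x, y)).

Lemma dky x y : U (x, y) -> is_derive y 1 (fun t : R => k (x, t)) (gy (x, y) - l2).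
Proof.
move=> Uxy.
have dg := dgy Uxy.
have : is_derive y 1 (fun t : R => g (x, t) - (l1 * x + l2 * t)) (gy (x, y) - l2).
  have := is_deriveB dg (is_deriveD (is_derive_cst (l1 * x : R) y 1) (is_deriveZ l2 (is_derive_id y (1 : R)))).
  by rewrite add0r /GRing.scale /= mulr1.
apply: near_eq_is_derive.
have : nbhs (x, y) U by apply: open_nbhs_nbhs; split => //; exact: open_punctured_plane.
move=> /nbhs_boxP[d d0 H].
exists d => //= t yt; rewrite periodic_partE//; apply: H => //=.
by rewrite subrr normr0.
Qed.

Lemma bounded_on (K : set (R * R)) (h : R * R -> R) : compact K -> K `<=` U ->
  {in U, continuous h} -> exists B : R, forall z, K z -> `|h z| <= B.
Proof.
move=> cK KU ch.
have : {within K, continuous h}.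
  by apply: continuous_in_subspaceT => z; rewrite inE => /KU Uz; apply: ch; rewrite inE.
move=> /continuous_compact -/(_ cK) /compact_bounded[B [_ HB]].
exists (B + 1) => z Kz; apply: (HB (B + 1)); first by rewrite ltrDl.
by exists z.
Qed.

(** This includes the rows of punctures, where it is needed at the endpoints of the interval of the
    mean value theorem. Almost every vertical line misses the lattice, and the integrand is bounded,
    so the integral passes to the limit. *)
Lemma average_continuous : continuous gamma.
Proof.
move=> y.
have := @continuity_under_integral R _ _ mu (fun y x => k (x, y)) `[0%R, 1%R]%classic
  (measurable_itv _) (y - 1) (y + 1) _ _ (cst `|M|) _ _ y.
apply.
- move=> t _; apply: itv_integrable; first exact: measurable_periodic_part1.
  by move=> x; exact: periodic_part_bound.
- apply: ae_mono ae_vertical.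
  move=> x Hx _ t _.
  by have /derivable1_diffP/differentiable_continuous := @ex_derive _ _ _ _ _ _ _ (dky (Hx t)).
- apply: (@itv_integrable _ _ _ (cst `|M|) `|M|); first exact: measurable_cst.
  by move=> x; rewrite /= normr_id.
- by move=> t _; apply: aeW => x _; exact: periodic_part_bound.
- by rewrite inE /= in_itv /= ltrBlDr !ltrDl ltr01.
Qed.

(** [gy] may blow up at the punctures, so the integral is differentiated on a closed strip between
    [u] and [v], strictly between two rows of punctures; there [gy] is bounded by compactness. *)
Lemma average_derive y : 0 < y < tau.2 ->
  is_derive y 1 gamma (\int[mu]_(x in `[0, 1]) gy (x, y) - l2).
Proof.
move=> /andP[y0 yt].
pose u := y / 2; pose v := (y + tau.2) / 2.
have u0 : 0 < u by rewrite /u divr_gt0.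
have uy : u < y by rewrite /u ltr_pdivrMr// ltr_pMr// ltr1n.
have yv : y < v by rewrite /v ltr_pdivlMr// mulr_natr mulr2n ltrD2l.
have vt : v < tau.2 by rewrite /v ltr_pdivrMr// mulr_natr mulr2n ltrD2r.
pose K : set (R * R) := `[0%R, 1%R]%classic `*` `[u, v]%classic.
have cK : compact K by apply: compact_setX; exact: segment_compact.
have KU : K `<=` U.
  move=> [x s] [_ /=]; rewrite in_itv /= => /andP[us sv].
  by apply: horizontal_strip; rewrite (lt_le_trans u0 us) (le_lt_trans sv vt).
have [B HB] := bounded_on cK KU cgy.
have dk x s : `]u, v[%classic s -> is_derive s 1 (fun t : R => k (x, t)) (gy (x, s) - l2).
  rewrite /= in_itv /= => /andP[us sv]; apply: dky; apply: horizontal_strip.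
  by rewrite (lt_trans u0 us) (lt_trans sv vt).
have Iy : `]u, v[%classic y by rewrite /= in_itv /= uy.
have ik s : mu.-integrable `[0, 1] (EFin \o (fun x => k (x, s))).
  apply: itv_integrable; first exact: measurable_periodic_part1.
  by move=> x; exact: periodic_part_bound.
have d1 s x : `]u, v[%classic s -> partial1of2 (fun s x => k (x, s)) s x = gy (x, s) - l2.
  by move=> Is; rewrite partial1of2E; exact: (@derive_val _ _ _ _ _ _ _ (dk x s Is)).
have D : derivable gamma y 1 /\ gamma^`()%classic y = \int[mu]_(x in `[0, 1]) partial1of2 (fun s x => k (x, s)) y x.
  have GB x : `[0%R, 1%R]%classic x -> forall s, `]u, v[%classic s ->
      `|partial1of2 (fun s x => k (x, s)) s x| <= cst (`|B| + `|l2|) x.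
    move=> Ix s Is; rewrite d1//; apply: (le_trans (ler_normB _ _)); rewrite lerD2r.
    apply: le_trans (ler_norm _); apply: HB; split => //=.
    by move: Is; rewrite /= !in_itv /= => /andP[/ltW -> /ltW ->].
  have iG : mu.-integrable `[0, 1] (EFin \o cst (`|B| + `|l2|)).
    apply: (@itv_integrable _ _ _ (cst (`|B| + `|l2|)) (`|B| + `|l2|)); first exact: measurable_cst.
    by move=> x; rewrite /= ger0_norm// addr_ge0.
  have dd s x : `]u, v[%classic s -> `[0%R, 1%R]%classic x -> derivable (fun t => k (x, t)) s 1.
    by move=> Is _; exact: (@ex_derive _ _ _ _ _ _ _ (dk x s Is)).
  split.
    apply: (@derivable_under_integral _ _ _ mu (fun s x => k (x, s)) `[0%R, 1%R]%classic
      (measurable_itv _) y u v Iy (fun s _ => ik s) dd (cst (`|B| + `|l2|)) _ iG).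
      by move=> x; rewrite addr_ge0.
    by move=> s x Is Ix; exact: GB.
  apply: (@differentiation_under_integral _ _ _ mu (fun s x => k (x, s)) `[0%R, 1%R]%classic
      (measurable_itv _) y u v Iy (fun s _ => ik s) dd (cst (`|B| + `|l2|)) _ iG).
    by move=> x; rewrite addr_ge0.
  by move=> s x Is Ix; exact: GB.
apply: DeriveDef; first exact: D.1.
rewrite -derive1E D.2.
transitivity (\int[mu]_(x in `[0, 1]) (gy (x, y) - l2)).
  by apply: eq_Rintegral => x _; rewrite d1.
rewrite RintegralB//.
- congr (_ - _).
  rewrite Rintegral_cst//= lebesgue_measure_itv /= lte_fin ltr01 oppr0 adde0 /=.
  by rewrite mulr1.
- apply: continuous_compact_integrable; first exact: segment_compact.
  apply: continuous_in_subspaceT => x _.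
  have Uxy : U (x, y) by apply: horizontal_strip; rewrite y0.
  apply: (@continuous_comp _ _ _ (fun x => (x, y)) gy); last by apply: cgy; rewrite inE.
  exact: continuous_pairl.
- apply: (@itv_integrable _ _ _ (cst l2) `|l2|); first exact: measurable_cst.
  by move=> x.
Qed.

(* The average of the periodic part over rows is periodic, so its derivative
   vanishes somewhere. *)
Lemma average_dy : exists2 y, 0 < y < tau.2 & \int[mu]_(x in `[0, 1]) gy (x, y) = l2.
Proof.
have [|y] := @MVT R gamma (fun y => \int[mu]_(x in `[0, 1]) gy (x, y) - l2) 0 tau.2 t0 _
  (continuous_subspaceT average_continuous).
  by move=> y; rewrite in_itv /=; exact: average_derive.
rewrite in_itv /= => yt.
rewrite -{1}[tau.2]add0r average_period subrr subr0 => /esym/eqP.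
by rewrite mulf_eq0 [tau.2 == 0]gt_eqF// orbF subr_eq0 => /eqP; exists y.
Qed.

(** Every row without punctures serves here: the fundamental theorem of calculus gives the increment
    of [g] over the period 1. Only the mean of [gy] needs a special row. *)
Lemma average_dx y : 0 < y < tau.2 -> \int[mu]_(x in `[0, 1]) gx (x, y) = l1.
Proof.
move=> yt.
have Uxy x : U (x, y) by exact: horizontal_strip.
have D x := dgx (Uxy x).
rewrite /Rintegral (@continuous_FTC2 _ (fun x => gx (x, y)) (fun x => g (x, y)) 0 1) //=.
- have := per 1 0 (Uxy 0).
  have -> : (0, y) + lattice_point tau 1 0 = (1, y).
    by rewrite /lattice_point mulr0 addr0 mulr0; congr pair; rewrite /= ?add0r ?addr0.
  by move=> ->; rewrite /lattice_point /= !mulr0 !addr0 mulr1; ring.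
- apply: continuous_in_subspaceT => x _.
  apply: (@continuous_comp _ _ _ (fun x => (x, y)) gx); last by apply: cgx; rewrite inE.
  exact: continuous_pairl.
- have cD x : {for x, continuous (fun x => g (x, y))}.
    by apply/differentiable_continuous/derivable1_diffP; exact: (@ex_derive _ _ _ _ _ _ _ (D x)).
  split.
  + by move=> x _; exact: (@ex_derive _ _ _ _ _ _ _ (D x)).
  + by apply: cvg_at_right_filter; exact: cD.
  + by apply: cvg_at_left_filter; exact: cD.
- by move=> x _; rewrite derive1E; exact: (@derive_val _ _ _ _ _ _ _ (D x)).
Qed.

End PeriodicPart.

Section Conformal.
Variable R : realType.
Implicit Types (tau z w : R * R) (F : R * R -> R * R).

Lemma is_diff_is_derive (g L : R -> R) (x : R) :
  is_diff x g L -> is_derive x 1 g (L 1).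
Proof.
move=> dg; apply: DeriveDef; first by apply: diff_derivable; exact: ex_diff.
by rewrite deriveE ?diff_val//; exact: ex_diff.
Qed.

Lemma is_diff_fst z : is_diff z (fst : R * R -> R) fst.
Proof.
apply: DiffDef.
  by apply: (@linear_differentiable _ _ _ (fst : {linear (R * R)%type -> R})) => w; exact: cvg_fst.
by apply: (@diff_lin _ _ _ (fst : {linear (R * R)%type -> R})) => w; exact: cvg_fst.
Qed.

Lemma is_diff_snd z : is_diff z (snd : R * R -> R) snd.
Proof.
apply: DiffDef.
  by apply: (@linear_differentiable _ _ _ (snd : {linear (R * R)%type -> R})) => w; exact: cvg_snd.
by apply: (@diff_lin _ _ _ (snd : {linear (R * R)%type -> R})) => w; exact: cvg_snd.
Qed.

Lemma is_diff_partials F L (x y : R) : is_diff (x, y) F L ->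
  [/\ is_derive x 1 (fun t : R => (F (t, y)).1) (L (1, 0)).1,
      is_derive x 1 (fun t : R => (F (t, y)).2) (L (1, 0)).2,
      is_derive y 1 (fun t : R => (F (x, t)).1) (L (0, 1)).1 &
      is_derive y 1 (fun t : R => (F (x, t)).2) (L (0, 1)).2].
Proof.
move=> dF.
have dx : is_diff x (fun t : R => (t, y)) (fun h => (h, 0)).
  exact: (is_diff_pair (is_diff_id x) (is_diff_cst y x)).
have dy : is_diff y (fun t : R => (x, t)) (fun h => (0, h)).
  exact: (is_diff_pair (is_diff_cst x y) (is_diff_id y)).
have Fx := is_diff_comp dx dF; have Fy := is_diff_comp dy dF.
split.
- exact: (is_diff_is_derive (is_diff_comp Fx (is_diff_fst _))).
- exact: (is_diff_is_derive (is_diff_comp Fx (is_diff_snd _))).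
- exact: (is_diff_is_derive (is_diff_comp Fy (is_diff_fst _))).
- exact: (is_diff_is_derive (is_diff_comp Fy (is_diff_snd _))).
Qed.

(** By the Cauchy-Riemann equations the row means of the [y]-derivatives are, up to sign, row means
    of [x]-derivatives. The two components may use different rows, since the means of the
    [x]-derivatives are the same on all rows off the punctures. *)
Lemma conformal_linear_part tau F F' (e f : R * R) (M : R) : 0 < tau.2 ->
  (forall z, punctured_plane tau z -> is_diff z F (cmul (F' z))) ->
  {within punctured_plane tau, continuous F'} ->
  (forall z m n, punctured_plane tau z ->
     F (z + lattice_point tau m n) = F z + directional e f (lattice_point tau m n)) ->
  (forall z, punctured_plane tau z ->
     `|(F z).1 - (directional e f z).1| <= M /\
     `|(F z).2 - (directional e f z).2| <= M) ->
  f = (- e.2, e.1).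
Proof.
move=> t0 dF cF' per bnd.
pose U := punctured_plane tau.
have oU : open U := open_punctured_plane t0.
have {}cF' : {in U, continuous F'} by rewrite -continuous_open_subspace.
have cF : {in U, continuous F}.
  move=> z; rewrite inE => Uz.
  by have dz := dF z Uz; apply: differentiable_continuous; exact: ex_diff.
have cN (H : R * R -> R) : {in U, continuous H} -> {in U, continuous (fun z => - H z)}.
  by move=> cH z Uz; apply: cvgN; exact: cH.
have dFx x y : U (x, y) -> is_derive x 1 (fun t : R => (F (t, y)).1) (F' (x, y)).1 /\
    is_derive x 1 (fun t : R => (F (t, y)).2) (F' (x, y)).2.
  move=> Uxy; have [+ + _ _] := is_diff_partials (dF _ Uxy).
  by rewrite /cmul /= !mulr1 !mulr0 subr0 add0r.
have dFy x y : U (x, y) -> is_derive y 1 (fun t : R => (F (x, t)).1) (- (F' (x, y)).2) /\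
    is_derive y 1 (fun t : R => (F (x, t)).2) (F' (x, y)).1.
  move=> Uxy; have [_ _ + +] := is_diff_partials (dF _ Uxy).
  by rewrite /cmul /= !mulr1 !mulr0 sub0r addr0.
have [c1 c2] := continuous_components cF; have [c1' c2'] := continuous_components cF'.
have [per1 per2] := period_components per; have [bnd1 bnd2] := bound_components bnd.
have [y yt Hy] := average_dy t0 c1 per1 bnd1 (cN _ c2')
  (fun x y Uxy => (dFy x y Uxy).1).
have [y' yt' Hy'] := average_dy t0 c2 per2 bnd2 c1'
  (fun x y Uxy => (dFy x y Uxy).2).
have Hx := average_dx t0 per1 c1' (fun x y Uxy => (dFx x y Uxy).1) yt'.
have Hx' := average_dx t0 per2 c2' (fun x y Uxy => (dFx x y Uxy).2) yt.
rewrite [LHS]surjective_pairing -Hy' Hx; congr pair.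
rewrite -Hy -Hx'.
transitivity (\int[lebesgue_measure]_(x in `[0, 1]) ((-1) * (F' (x, y)).2)).
  by apply: eq_Rintegral => x _; rewrite mulN1r.
rewrite RintegralZl ?mulN1r//.
apply: continuous_compact_integrable; first exact: segment_compact.
apply: continuous_in_subspaceT => x _.
have Uxy : U (x, y) by apply: horizontal_strip.
apply: (@continuous_comp _ _ _ (fun x => (x, y)) (fun z => (F' z).2)); first exact: continuous_pairl.
by apply: c2'; rewrite inE.
Qed.

End Conformal.

(** * Difference quotients *)

Section DifferenceQuotients.
Variable R : realType.
Local Notation mu := (@lebesgue_measure R).
Implicit Types (w g : R -> R).

Lemma sqr_integrable d (T : measurableType d) (m : {measure set T -> \bar R})
    (D : set T) (g : T -> R) : measurable D -> (m D < +oo)%E -> measurable_fun D g ->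
  m.-integrable D (EFin \o (fun x => g x ^+ 2)) -> m.-integrable D (EFin \o g).
Proof.
move=> mD Dfin mg ig.
have i1 : m.-integrable D (EFin \o cst (1 : R)).
  apply: (@bounded_integrable _ _ _ m D (cst 1) 1) => // x _.
  by rewrite /= normr1.
have := integrableD mD i1 ig; apply: le_integrable => //.
  exact/measurable_EFinP.
move=> x Dx; rewrite /= lee_fin [leRHS]ger0_norm ?addr_ge0 ?sqr_ge0//.
rewrite -(@real_normK _ (g x)) ?num_real//.
have := normr_ge0 (g x); set t := `|g x| => t0.
by have := sqr_ge0 (t - 1); nra.
Qed.

Lemma lebesgue_measure_segment (a b : R) : a <= b -> mu `[a, b]%classic = (b - a)%:E.
Proof.
rewrite le_eqVlt => /predU1P[->|ab]; rewrite lebesgue_measure_itv /= lte_fin.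
  by rewrite ltxx subrr.
by rewrite ab EFinB.
Qed.

(** Integrate [(g - m) ^ 2 >= 0], where [m] is the mean of [g]. *)
Lemma jensen_sqr g (x s : R) : 0 < s -> measurable_fun [set: R] g ->
  mu.-integrable `[x, x + s] (EFin \o (fun t => g t ^+ 2)) ->
  ((\int[mu]_(t in `[x, x + s]) g t) / s) ^+ 2 <=
    s^-1 * \int[mu]_(t in `[x, x + s]) (g t ^+ 2).
Proof.
move=> s0 mg ig2.
set I := `[x, x + s]%classic.
have mI : measurable (I : set (measurableTypeR R)) by exact: measurable_itv.
have Ifin : (mu I < +oo)%E by exact: itv_finite.
have muI : mu I = s%:E.
  by rewrite /I lebesgue_measure_segment ?lerDl ?ltW// [x + s]addrC addrK.
have ig : mu.-integrable I (EFin \o g).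
  by apply: sqr_integrable => //; exact: measurable_funTS.
pose m := (\int[mu]_(t in I) g t) / s.
have im : mu.-integrable I (EFin \o cst (m ^+ 2)).
  by apply: (@bounded_integrable _ _ _ _ _ _ `|m ^+ 2|) => //; exact: measurable_cst.
have iZ : mu.-integrable I (EFin \o (fun t => 2 * m * g t)).
  by have := integrableZl mI (2 * m) ig; apply: eq_integrable.
have : 0 <= \int[mu]_(t in I) ((g t ^+ 2 - 2 * m * g t) + m ^+ 2).
  apply: Rintegral_ge0 => t _.
  by rewrite (_ : _ + _ = (g t - m) ^+ 2) ?sqr_ge0//; ring.
rewrite RintegralD//; last first.
  by have := integrableB mI ig2 iZ; apply: eq_integrable.
rewrite RintegralB// RintegralZl// Rintegral_cst//= muI /=.
have -> : \int[mu]_(t in I) g t = m * s by rewrite /m divfK// gt_eqF.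
move=> h; rewrite -(ler_pM2l s0) mulVKf ?gt_eqF// mulfK ?gt_eqF//.
by move: h; move: (Rintegral _ _ _) => X; nra.
Qed.

Definition fwd (s : R) w (x : R) := (w (x + s) - w x) / s.

Lemma window_measurable (a b s : R) : measurable
  ((`[a, b]%classic `*` setT) `&` (fun z : R * R => z.2 - z.1) @^-1` `[0, s]%classic).
Proof.
apply: measurableI; first exact: measurableX.
rewrite -[X in measurable X]setTI.
have mf : measurable_fun [set: R * R] (fun z : R * R => z.2 - z.1).
  by apply: measurable_funB; [exact: measurable_snd|exact: measurable_fst].
exact: mf.
Qed.

(* Averaging over windows of length [s] and integrating over [a, b] counts each
   point of [a, b + s] at most once. *)
Lemma window_tonelli (h : R -> R) (a b s : R) : 0 < s -> measurable_fun [set: R] h ->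
  (forall t, 0 <= h t) ->
  measurable_fun `[a, b] (fun x => (s^-1)%:E * \int[mu]_(t in `[x, (x + s)%R]) (h t)%:E)%E /\
  (\int[mu]_(x in `[a, b]) ((s^-1)%:E * \int[mu]_(t in `[x, (x + s)%R]) (h t)%:E) <=
   \int[mu]_(t in `[a, (b + s)%R]) (h t)%:E)%E.
Proof.
move=> s0 mh h0.
pose W := (`[a, b]%classic `*` setT) `&` (fun z : R * R => z.2 - z.1) @^-1` `[0, s]%classic.
have mW : measurable W := window_measurable a b s.
pose H z : \bar R := (s^-1 * h z.2 * \1_W z)%:E.
have mH : measurable_fun [set: R * R] H.
  apply/measurable_EFinP; apply: measurable_funM; last exact: measurable_indic.
  apply: measurable_funM; first exact: measurable_cst.
  by apply: measurableT_comp => //; exact: measurable_snd.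
have H0 z : (0 <= H z)%E.
  by rewrite lee_fin mulr_ge0// mulr_ge0// invr_ge0 ltW.
have WE x t : W (x, t) <-> (a <= x <= b /\ x <= t <= x + s).
  rewrite /W /= !in_itv /= subr_ge0 lerBlDl.
  by split => [[[-> _] ->]|[-> ->]].
have Lx x : a <= x <= b ->
    ((s^-1)%:E * \int[mu]_(t in `[x, (x + s)%R]) (h t)%:E = \int[mu]_t H (x, t))%E.
  move=> xab; rewrite -ge0_integralZl//; last 3 first.
  - by apply/measurable_EFinP; exact: measurable_funTS.
  - by move=> t _; rewrite lee_fin.
  - by rewrite lee_fin invr_ge0 ltW.
  rewrite integral_mkcond; apply: eq_integral => t _; rewrite patchE /H /=.
  case: ifPn => [|tn].
    rewrite inE /= in_itv /= => txs.
    by rewrite indicE mem_set ?mulr1//; apply/WE.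
  rewrite indicE memNset ?mulr0//; apply: contraNnot tn => /WE[_ txs].
  by rewrite inE /= in_itv.
split.
  apply: (eq_measurable_fun (fun x => \int[mu]_t H (x, t))%E).
    by move=> x; rewrite inE /= in_itv /= => xab; rewrite Lx.
  by apply: measurable_funTS; exact: (@measurable_fun_fubini_tonelli_F _ _ _ _ _ mu H mH H0).
have -> : (\int[mu]_(x in `[a, b]) ((s^-1)%:E * \int[mu]_(t in `[x, (x + s)%R]) (h t)%:E) =
    \int[mu]_x \int[mu]_t H (x, t))%E.
  rewrite integral_mkcond; apply: eq_integral => x _; rewrite patchE.
  case: ifPn => [|xab]; first by rewrite inE /= in_itv /= => /Lx.
  rewrite [RHS]integral0_eq// => t _; rewrite /H indicE memNset ?mulr0//.
  by apply: contraNnot xab => /WE[? _]; rewrite inE /= in_itv.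
rewrite (@fubini_tonelli _ _ _ _ _ mu mu H mH H0).
rewrite [leRHS]integral_mkcond; apply: ge0_le_integral => //.
- by move=> t _; exact: integral_ge0.
- exact: (@measurable_fun_fubini_tonelli_G _ _ _ _ _ mu H mH H0).
- apply/(measurable_restrictT _ (measurable_itv `[a, b + s])).
  by apply/measurable_EFinP; exact: measurable_funTS.
move=> t _; rewrite patchE; case: ifPn => [|tab].
  rewrite inE /= in_itv /= => tab.
  (* For fixed [t] the window condition confines [x] to [[t - s, t]], an interval of length [s],
     which cancels the factor [s^-1]. *)
  apply: (@le_trans _ _ (\int[mu]_(x in `[(t - s)%R, t]) ((s^-1 * h t)%:E))%E).
    rewrite [leRHS]integral_mkcond; apply: ge0_le_integral => //.
    - exact: (measurable_fun_pair1 t mH).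
    - by apply/(measurable_restrictT _ (measurable_itv `[t - s, t])); exact: measurable_cst.
    - move=> x _; rewrite patchE /H /= indicE.
      have [xtW|_] := boolP ((x, t) \in W); last first.
        by rewrite mulr0; case: ifP => // _; rewrite lee_fin mulr_ge0// invr_ge0 ltW.
      rewrite mulr1 mem_set//= in_itv /=.
      have [_ /andP[-> ?]] := iffLR (WE _ _) (set_mem xtW).
      by rewrite lerBlDr andbT.
  rewrite integral_cst//= lebesgue_measure_segment; last by rewrite lerBlDr lerDl ltW.
  rewrite opprB addrC subrK -EFinM lee_fin.
  by rewrite mulrAC mulVf ?mul1r// gt_eqF.
rewrite integral0_eq// => x _; rewrite /H indicE memNset ?mulr0//.
apply: contraNnot tab => /WE[/andP[h1 h2] /andP[h3 h4]].
by rewrite inE /= in_itv /= (le_trans h1 h3) (le_trans h4)// lerD2r.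
Qed.

Section AbsolutelyContinuous.
Variables (w g : R -> R) (A B : R).
Hypothesis mw : measurable_fun [set: R] w.
Hypothesis mg : measurable_fun [set: R] g.
Hypothesis ig2 : mu.-integrable `[A, B] (EFin \o (fun t => g t ^+ 2)).
Hypothesis wg : forall x y, A <= x -> x <= y -> y <= B ->
  w y - w x = \int[mu]_(t in `[x, y]) g t.

Lemma measurable_fwd s : measurable_fun [set: R] (fwd s w).
Proof.
apply: measurable_funM; last exact: measurable_cst.
apply: measurable_funB => //.
by apply: (measurableT_comp mw); exact: measurable_funD.
Qed.

(** The quotient is the mean of [g] over [[x, x + s]], so [jensen_sqr] bounds its square by a window
    average of [g ^ 2], and [window_tonelli] integrates that. *)
Lemma fwd_sqr_le (a b s : R) : 0 < s -> A <= a -> b + s <= B ->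
  (\int[mu]_(x in `[a, b]) (fwd s w x ^+ 2)%:E <=
   \int[mu]_(t in `[a, (b + s)%R]) (g t ^+ 2)%:E)%E.
Proof.
move=> s0 Aa bB.
have mg2 : measurable_fun [set: R] (fun t => g t ^+ 2) by exact: measurable_funX.
have [mW LW] := window_tonelli a b s0 mg2 (fun t => sqr_ge0 (g t)).
apply: le_trans LW.
apply: ge0_le_integral => //.
- by move=> x _; rewrite lee_fin sqr_ge0.
- by apply/measurable_EFinP/measurable_funTS/measurable_funX; exact: measurable_fwd.
move=> x; rewrite /= in_itv /= => /andP[ax xb].
have ig2x : mu.-integrable `[x, x + s] (EFin \o (fun t => g t ^+ 2)).
  apply: integrableS ig2 => // t; rewrite /= !in_itv /= => /andP[xt tx].
  by rewrite (le_trans Aa)?(le_trans ax)//= (le_trans tx)// (le_trans _ bB)// lerD2r.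
rewrite /fwd wg; last first.
- by rewrite (le_trans _ bB)// lerD2r.
- by rewrite lerDl ltW.
- exact: le_trans ax.
have := jensen_sqr s0 mg ig2x; rewrite -lee_fin => /le_trans; apply.
rewrite EFinM /Rintegral fineK//.
exact: integrable_fin_num.
Qed.

Lemma bwd_sqr_le (a b s : R) : 0 < s -> A <= a - s -> b <= B ->
  (\int[mu]_(x in `[a, b]) (fwd s w (x - s) ^+ 2)%:E <=
   \int[mu]_(t in `[(a - s)%R, b]) (g t ^+ 2)%:E)%E.
Proof.
move=> s0 Aa bB.
have := @fwd_sqr_le (a - s) (b - s) s s0 Aa; rewrite subrK => /(_ bB).
apply: le_trans; rewrite (@ge0_integral_translate _ (- s) `[(a - s)%R, (b - s)%R]%classic)//.
- rewrite (_ : (fun x => x - s) @^-1` _ = `[a, b]%classic)//.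
  by apply/seteqP; split => [x|x]; rewrite /= !in_itv /= !lerD2r.
- by apply/measurable_EFinP/measurable_funTS/measurable_funX; exact: measurable_fwd.
- by move=> x _; rewrite lee_fin sqr_ge0.
Qed.

(** [w] is a primitive of [g], so Lebesgue's differentiation theorem gives it the derivative [g]
    almost everywhere. The two sequences sample the difference quotient at steps of either sign. *)
Lemma ae_fwd_cvg : {ae mu, forall x, A < x -> x < B ->
  (fwd n.+1%:R^-1 w x @[n --> \oo] --> g x) /\
  (fwd n.+1%:R^-1 w (x - n.+1%:R^-1) @[n --> \oo] --> g x)}.
Proof.
have [BA|AB] := leP B A.
  by apply: aeW => x h1 h2; have := lt_trans h1 h2; rewrite ltNge BA.
(* Cutting [g] off outside [[A, B]] makes it integrable on the whole line; inside, its primitive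
   differs from [w] by a constant. *)
pose g0 := g \_ `[A, B]%classic.
have mI : measurable (`[A, B]%classic : set (measurableTypeR R)) by exact: measurable_itv.
have ig : mu.-integrable `[A, B] (EFin \o g).
  by apply: sqr_integrable => //; [exact: itv_finite|exact: measurable_funTS].
have ig0 : mu.-integrable setT (EFin \o g0).
  by rewrite -restrict_EFin; apply/integrable_restrict => //=; rewrite setTI.
have ig0y y : mu.-integrable [set` Interval (BLeft A) (BRight y)] (EFin \o g0).
  exact: integrableS ig0.
have locg : locally_integrable [set: R] g0.
  by apply: open_integrable_locally => //; exact: openT.
have := FTC1 ig0y locg.
apply: ae_mono.
move=> x /= + Ax xB; rewrite (@lte_fin R) => /(_ Ax).
set F := (fun _ => _); move=> [dF F'].
have FE y : A <= y <= B -> F y = w y - w A.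
  move=> /andP[Ay yB]; rewrite wg//; apply: eq_Rintegral => t.
  rewrite inE /= in_itv /= => /andP[At ty].
  by rewrite /g0 patchE mem_set//= in_itv /= At (le_trans ty).
have gx : g0 x = g x by rewrite /g0 patchE mem_set//= in_itv /= !ltW.
have cv : h^-1 *: (F (h + x) - F x) @[h --> (0:R)^'] --> g x.
  have /cvg_ex[l fl] := dF.
  have {}fl : h^-1 *: (F (h + x) - F x) @[h --> (0:R)^'] --> l.
    by move: fl; rewrite /=; under eq_fun do rewrite scaler1.
  by rewrite -gx -F' (_ : F^`()%classic x = l)//; exact/cvg_lim.
move/cvgr_dnbhsP : cv => cv.
have inv_gt0 (n : nat) : 0 < n.+1%:R^-1 :> R by rewrite invr_gt0.
have inv0 : (n.+1%:R^-1 : R) @[n --> \oo] --> 0 by exact: cvg_harmonic.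
have inv0' : (- n.+1%:R^-1 : R) @[n --> \oo] --> 0.
  by rewrite -[X in _ --> X]oppr0; exact: cvgN.
have small (e : R) : 0 < e -> \forall n \near \oo, n.+1%:R^-1 < e.
  by move=> e0; exact: (near_infty_natSinv_lt (PosNum e0)).
split.
  have := cv (fun n => n.+1%:R^-1) (conj (fun n => lt0r_neq0 (inv_gt0 n)) inv0).
  apply: cvg_trans; apply: near_eq_cvg.
  near=> n.
  have xn : x + n.+1%:R^-1 <= B.
    rewrite -lerBrDl ltW//; near: n; apply: small; by rewrite subr_gt0.
  rewrite /fwd [n.+1%:R^-1 + x]addrC !FE; first last.
  - by rewrite xn andbT (le_trans (ltW Ax))// lerDl ltW.
  - by rewrite (ltW Ax) (ltW xB).
  by rewrite opprB addrA subrK /GRing.scale /= mulrC.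
have := cv (fun n => - n.+1%:R^-1) (conj (fun n => ltr0_neq0 _) inv0').
have ninv n : - n.+1%:R^-1 < 0 :> R by rewrite oppr_lt0.
move=> /(_ ninv); apply: cvg_trans; apply: near_eq_cvg.
near=> n.
have xn : A <= x - n.+1%:R^-1.
  rewrite lerBrDr -lerBrDl ltW//; near: n; apply: small; by rewrite subr_gt0.
rewrite /fwd subrK [- n.+1%:R^-1 + x]addrC !FE; first last.
- by rewrite xn /= (le_trans _ (ltW xB))// gerBl ltW.
- by rewrite (ltW Ax) (ltW xB).
rewrite invrN /GRing.scale /= mulNr -mulrN mulrC; congr (_ * _).
by ring.
Unshelve. all: by end_near.
Qed.

End AbsolutelyContinuous.
End DifferenceQuotients.

(** * Tonelli's theorem on rectangles and averages over a cell *)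

Section PlaneIntegrals.
Variable R : realType.
Local Notation mu := (@lebesgue_measure R).
Local Notation leb2 := (@lebesgue_measure R \x @lebesgue_measure R)%E.
Implicit Types (f : R * R -> R) (A B : set R).

Section Tonelli.
Variables (f : R * R -> R) (A B : set R).
Hypothesis mf : measurable_fun [set: R * R] f.
Hypothesis f0 : forall z, 0 <= f z.
Hypothesis mA : measurable (A : set (measurableTypeR R)).
Hypothesis mB : measurable (B : set (measurableTypeR R)).

Let h z := ((f z * \1_(A `*` B) z)%:E).

Let mh : measurable_fun [set: R * R] h.
Proof.
apply/measurable_EFinP; apply: measurable_funM => //.
by apply: measurable_indic; exact: measurableX.
Qed.

Let h0 z : (0 <= h z)%E.
Proof. by rewrite lee_fin mulr_ge0. Qed.

Let hE : (\int[leb2]_(z in A `*` B) (f z)%:E = \int[leb2]_z h z)%E.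
Proof.
rewrite integral_mkcond; apply: eq_integral => z _.
rewrite patchE /h indicE; case: ifP => _; by rewrite ?mulr1 ?mulr0.
Qed.

Let hxE y : (\int[mu]_x h (x, y) = \int[mu]_(x in A) (f (x, y) * \1_B y)%:E)%E.
Proof.
rewrite [RHS]integral_mkcond; apply: eq_integral => x _.
rewrite patchE /h !indicE in_setX /=.
by case: (x \in A); rewrite /= ?andTb ?andFb ?mulr0.
Qed.

Let hyE x : (\int[mu]_y h (x, y) = \int[mu]_(y in B) (f (x, y) * \1_A x)%:E)%E.
Proof.
rewrite [RHS]integral_mkcond; apply: eq_integral => y _.
rewrite patchE /h !indicE in_setX /=.
by case: (y \in B); rewrite /= ?andbT ?andbF ?mulr0.
Qed.

Lemma tonelli_rect1 : (\int[leb2]_(z in A `*` B) (f z)%:E =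
  \int[mu]_(y in B) \int[mu]_(x in A) (f (x, y))%:E)%E.
Proof.
rewrite hE (@fubini_tonelli2 _ _ _ _ _ mu mu h mh h0) [RHS]integral_mkcond.
apply: eq_integral => y _; rewrite /fubini_G hxE patchE.
case: ifPn => yB.
  by apply: eq_integral => x _; rewrite indicE yB mulr1.
by rewrite integral0_eq// => x _; rewrite indicE (negbTE yB) mulr0.
Qed.

Lemma tonelli_rect2 : (\int[leb2]_(z in A `*` B) (f z)%:E =
  \int[mu]_(x in A) \int[mu]_(y in B) (f (x, y))%:E)%E.
Proof.
rewrite hE (@fubini_tonelli1 _ _ _ _ _ mu mu h mh h0) [RHS]integral_mkcond.
apply: eq_integral => x _; rewrite /fubini_F hyE patchE.
case: ifPn => xA.
  by apply: eq_integral => y _; rewrite indicE xA mulr1.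
by rewrite integral0_eq// => y _; rewrite indicE (negbTE xA) mulr0.
Qed.

Lemma measurable_rect1 :
  measurable_fun B (fun y => \int[mu]_(x in A) (f (x, y))%:E)%E.
Proof.
apply: (eq_measurable_fun (fun y => \int[mu]_x h (x, y))%E).
  move=> y yB; rewrite hxE; apply: eq_integral => x _.
  by rewrite indicE yB mulr1.
by apply: measurable_funTS; exact: (@measurable_fun_fubini_tonelli_G _ _ _ _ _ mu h mh h0).
Qed.

Lemma measurable_rect2 :
  measurable_fun A (fun x => \int[mu]_(y in B) (f (x, y))%:E)%E.
Proof.
apply: (eq_measurable_fun (fun x => \int[mu]_y h (x, y))%E).
  move=> x xA; rewrite hyE; apply: eq_integral => y _.
  by rewrite indicE xA mulr1.
by apply: measurable_funTS; exact: (@measurable_fun_fubini_tonelli_F _ _ _ _ _ mu h mh h0).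
Qed.

End Tonelli.

Lemma leb2_null1 (N : set (R * R)) : measurable N ->
  {ae mu, forall y, mu (ysection N y) = 0%E} -> leb2 N = 0%E.
Proof.
move=> mN H.
have mh : measurable_fun [set: R * R] (EFin \o (\1_N : R * R -> R)).
  by apply/measurable_EFinP; exact: measurable_indic.
have h0 z : (0 <= (EFin \o (\1_N : R * R -> R)) z)%E by rewrite lee_fin.
rewrite -[N]setIT -integral_indic// (@fubini_tonelli2 _ _ _ _ _ mu mu _ mh h0).
rewrite indic_fubini_tonelli_GE// (ae_eq_integral (cst 0%E)) ?integral0//.
  exact: measurable_fun_ysection.
by apply: ae_mono H.
Qed.

Lemma leb2_null2 (N : set (R * R)) : measurable N ->
  {ae mu, forall x, mu (xsection N x) = 0%E} -> leb2 N = 0%E.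
Proof.
move=> mN H; rewrite /product_measure1 (ae_eq_integral (cst 0%E)) ?integral0//.
  exact: measurable_fun_xsection.
by apply: ae_mono H.
Qed.

Lemma rect_fin (a b c d : R) : (leb2 (`[a, b]%classic `*` `[c, d]%classic) < +oo)%E.
Proof.
rewrite /= product_measure1E; [|exact: measurable_itv|exact: measurable_itv].
rewrite /= lte_mul_pinfty//; last exact: itv_finite.
by rewrite ge0_fin_numE//; exact: itv_finite.
Qed.

Lemma measurable_rect (a b c d : R) :
  measurable (`[a, b]%classic `*` `[c, d]%classic : set (R * R)).
Proof. by apply: measurableX; exact: measurable_itv. Qed.

Lemma rect_integrable (a b c d : R) f (M : R) : measurable_fun [set: R * R] f ->
  (forall z, `|f z| <= M) ->
  leb2.-integrable (`[a, b]%classic `*` `[c, d]%classic) (EFin \o f).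
Proof.
move=> mf fM; apply: (@bounded_integrable _ _ _ leb2 _ _ M) => //.
- exact: measurable_rect.
- exact: rect_fin.
- exact: measurable_funTS.
Qed.

Section CellAverage.
Variables (tau : R * R) (c : R).
Hypothesis t0 : 0 < tau.2.
Local Notation Q := (`[0%R, 1%R]%classic `*` `[c, (c + tau.2)%R]%classic : set (R * R)).

(** The cell is a rectangle of sides 1 and [tau.2] instead of the parallelogram of the lattice. This
    is legitimate because the row average forgets horizontal shifts and so has period [tau.2] in
    [y]; a translation then acts on each variable separately. *)
Lemma ge0_cell_translate (G : R * R -> R) (M : R) (w : R * R) :
  measurable_fun [set: R * R] G -> (forall z, 0 <= G z) -> (forall z, `|G z| <= M) ->
  (forall z m n, G (z + lattice_point tau m n) = G z) ->
  (\int[leb2]_(z in Q) (G (z + w))%:E = \int[leb2]_(z in Q) (G z)%:E)%E.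
Proof.
move=> mG G0 GM pG.
have mI := @measurable_itv R.
have mw : measurable_fun [set: R * R] (fun z => G (z + w)).
  exact: (measurableT_comp mG (measurable_translate w)).
rewrite (tonelli_rect1 mw)// (tonelli_rect1 mG)//.
pose g y := \int[mu]_(x in `[0, 1]) G (x, y).
have fin y : (\int[mu]_(x in `[0%R, 1%R]) (G (x, y))%:E = (g y)%:E)%E.
  rewrite /g /Rintegral fineK//; apply: integrable_fin_num => //.
  by apply: (@itv_integrable _ _ _ (fun x => G (x, y)) M) => //; exact: measurable_fun_pair1.
have mg : measurable_fun [set: R] g.
  have := measurable_rect1 mG G0 (mI `[0, 1]) (@measurableT _ (measurableTypeR R)).
  by move=> h; apply: (measurableT_comp _ h); exact: fine_measurable.
have gM y : `|g y| <= M.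
  rewrite ger0_norm; last by apply: Rintegral_ge0.
  have -> : M = \int[mu]_(x in `[0, 1]) (cst M x).
    by rewrite Rintegral_cst//= lebesgue_measure_segment//= subr0 mulr1.
  apply: le_Rintegral => //.
  - by apply: (@itv_integrable _ _ _ (fun x => G (x, y)) M) => //; exact: measurable_fun_pair1.
  - by apply: (@itv_integrable _ _ _ (cst M) `|M|) => //.
  - by move=> x _; rewrite (le_trans (ler_norm _)).
have gp y : g (y + tau.2) = g y := row_average_period mG GM pG y.
transitivity (\int[mu]_(y in `[c, (c + tau.2)%R]) (g (y + w.2))%:E)%E.
  apply: eq_integral => y _; rewrite -fin.
  have := row_average_translate mG GM pG w.1 (y + w.2).
  rewrite /Rintegral => E.
  have i1 z : (\int[mu]_(x in `[0%R, 1%R]) (G (x + w.1, z))%:E \is a fin_num)%E.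
    apply: integrable_fin_num => //.
    apply: (@itv_integrable _ _ _ (fun x => G (x + w.1, z)) M) => //.
    apply: (measurableT_comp mG); apply: measurable_fun_pair => //.
    exact: measurable_funD.
  have i2 z : (\int[mu]_(x in `[0%R, 1%R]) (G (x, z))%:E \is a fin_num)%E by rewrite fin.
  transitivity (\int[mu]_(x in `[0%R, 1%R]) (G (x + w.1, y + w.2))%:E)%E; first by [].
  by rewrite -(fineK (i1 _)) E fineK.
transitivity (\int[mu]_(y in `[c, (c + tau.2)%R]) (g y)%:E)%E; last first.
  by apply: eq_integral => y _; rewrite fin.
have := Rintegral_periodic c w.2 t0 mg gM gp.
have ig1 : mu.-integrable `[c, c + tau.2] (EFin \o g) by exact: itv_integrable gM.
have ig2 : mu.-integrable `[c, c + tau.2] (EFin \o (fun y => g (y + w.2))).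
  apply: (@itv_integrable _ _ _ _ M) => //.
  by apply: (measurableT_comp mg); exact: measurable_funD.
rewrite /Rintegral => E.
by rewrite -(fineK (integrable_fin_num _ ig2))// E fineK//; exact: integrable_fin_num.
Qed.

Lemma cell_translate (G : R * R -> R) (M : R) (w : R * R) :
  measurable_fun [set: R * R] G -> (forall z, `|G z| <= M) ->
  (forall z m n, G (z + lattice_point tau m n) = G z) ->
  \int[leb2]_(z in Q) G (z + w) = \int[leb2]_(z in Q) G z.
Proof.
move=> mG GM pG.
(* Adding the bound makes the function nonnegative, as Tonelli's theorem requires. *)
pose H z := G z + M.
have mH : measurable_fun [set: R * R] H by apply: measurable_funD => //; exact: measurable_cst.
have H0 z : 0 <= H z by have := GM z; rewrite ler_norml /H => /andP[]; lra.
have HM z : `|H z| <= M + M.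
  by rewrite ger0_norm//; have := GM z; rewrite ler_norml /H => /andP[]; lra.
have pH z m n : H (z + lattice_point tau m n) = H z by rewrite /H pG.
have mw : measurable_fun [set: R * R] (fun z => G (z + w)).
  exact: (measurableT_comp mG (measurable_translate w)).
have := ge0_cell_translate w mH H0 HM pH.
move=> /(congr1 fine); rewrite -!/(Rintegral _ _ _) /H.
have mQ := measurable_rect 0 1 c (c + tau.2).
have i0 : leb2.-integrable Q (EFin \o cst M) by apply: (@rect_integrable _ _ _ _ _ `|M|).
by rewrite !RintegralD//; [move/addIr|exact: (rect_integrable _ _ _ _ mG GM)|exact: (rect_integrable _ _ _ _ mw (fun z => GM (z + w)))].
Qed.

End CellAverage.
End PlaneIntegrals.

(** * Difference quotients of a Sobolev function *)

Section LineQuotients.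
Variable R : realType.
Local Notation mu := (@lebesgue_measure R).
Variables (w g : R -> R) (A B : R).
Hypothesis mw : measurable_fun [set: R] w.
Hypothesis mg : measurable_fun [set: R] g.
Hypothesis ig2 : mu.-integrable `[A, B] (EFin \o (fun t => g t ^+ 2)).
Hypothesis wg : forall x y, A <= x -> x <= y -> y <= B ->
  w y - w x = \int[mu]_(t in `[x, y]) g t.

Lemma quotient_bwdE (s x : R) : (w (x - s) - w x) / - s = fwd s w (x - s).
Proof. by rewrite /fwd subrK invrN mulrN -mulNr opprB. Qed.

(** Both signs of the step are covered, because the determinant will mix forward and backward
    quotients; the margin [eps] absorbs the windows on either side. *)
Lemma quotient_sqr_le (a b t eps : R) : t != 0 -> `|t| <= eps ->
  A <= a - eps -> b + eps <= B ->
  (\int[mu]_(x in `[a, b]) (((w (x + t) - w x) / t) ^+ 2)%:E <=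
   \int[mu]_(x in `[(a - eps)%R, (b + eps)%R]) (g x ^+ 2)%:E)%E.
Proof.
move=> tn teps Aa bB.
have e0 : 0 <= eps := le_trans (normr_ge0 t) teps.
have sub (a' b' : R) : a - eps <= a' -> b' <= b + eps ->
    (\int[mu]_(x in `[a', b']) (g x ^+ 2)%:E <=
     \int[mu]_(x in `[(a - eps)%R, (b + eps)%R]) (g x ^+ 2)%:E)%E.
  move=> h1 h2; apply: ge0_subset_integral => //.
  - by apply/measurable_EFinP/measurable_funTS; exact: measurable_funX.
  - by move=> x _; rewrite lee_fin sqr_ge0.
  - move=> x; rewrite /= !in_itv /= => /andP[h3 h4].
    by rewrite (le_trans h1 h3) (le_trans h4 h2).
have [t0|t0] := ltP 0 t.
  rewrite gtr0_norm// in teps.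
  apply: le_trans (fwd_sqr_le mw mg ig2 wg t0 _ _) (sub _ _ _ _).
  - by rewrite (le_trans Aa)// gerBl.
  - by rewrite (le_trans _ bB)// lerD2l.
  - by rewrite gerBl.
  - by rewrite lerD2l.
have {}t0 : 0 < - t by rewrite oppr_gt0 lt_neqAle tn.
rewrite ler0_norm in teps; last by rewrite -oppr_ge0 ltW.
apply: le_trans (sub (a - - t) b _ _); last 2 first.
- by rewrite lerD2l lerN2.
- by rewrite lerDl.
apply: le_trans (bwd_sqr_le mw mg ig2 wg t0 _ _).
- by apply: ge0_le_integral => //=; [by move=> x _; rewrite lee_fin sqr_ge0|
    apply/measurable_EFinP/measurable_funTS/measurable_funX/measurable_funM => //; apply: measurable_funB => //; apply: (measurableT_comp mw); exact: measurable_funD |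
    apply/measurable_EFinP/measurable_funTS/measurable_funX; apply: (measurableT_comp (measurable_fwd mw _)); exact: measurable_funD |
    move=> x _; rewrite -quotient_bwdE !opprK].
- by rewrite (le_trans Aa)// lerD2l lerN2.
- by rewrite (le_trans _ bB)// lerDl.
Qed.

Lemma ae_quotient_cvg : {ae mu, forall x, A < x -> x < B ->
  ((w (x + n.+1%:R^-1) - w x) / n.+1%:R^-1 @[n --> \oo] --> g x) /\
  ((w (x - n.+1%:R^-1) - w x) / - n.+1%:R^-1 @[n --> \oo] --> g x)}.
Proof.
have := ae_fwd_cvg mg ig2 wg.
apply: ae_mono.
move=> x H Ax xB; have [h1 h2] := H Ax xB; split => //.
by under eq_fun do rewrite quotient_bwdE.
Qed.

End LineQuotients.

Section Component.
Variable R : realType.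
Local Notation mu := (@lebesgue_measure R).
Local Notation leb2 := (@lebesgue_measure R \x @lebesgue_measure R)%E.
Variables (tau : R * R) (g p q : R * R -> R) (l1 l2 M : R).
Hypothesis t0 : 0 < tau.2.
Local Notation U := (punctured_plane tau).
Hypothesis cg : {in U, continuous g}.
Hypothesis per : forall z m n, U z ->
  g (z + lattice_point tau m n) =
  g z + (l1 * (lattice_point tau m n).1 + l2 * (lattice_point tau m n).2).
Hypothesis bnd : forall z, U z -> `|g z - (l1 * z.1 + l2 * z.2)| <= M.
Hypothesis sob : sobolev_derivatives U g p q.

Local Notation h := (periodic_part tau g l1 l2).

(* [g], with arbitrary values chosen at the punctures. *)
Definition total_part z := l1 * z.1 + l2 * z.2 + h z.
Local Notation G := total_part.

Definition quotient (t : R) (w z : R * R) := (G (z + w) - G z) / t.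

Let oU : open U := open_punctured_plane t0.
Let mU : measurable U := open_measurable2 oU.

Lemma total_partE z : U z -> G z = g z.
Proof. by move=> Uz; rewrite /G periodic_partE// addrC subrK. Qed.

Lemma measurable_total_part : measurable_fun [set: R * R] G.
Proof.
apply: measurable_funD; last exact: measurable_periodic_part.
by apply: measurable_funD; apply: measurable_funM.
Qed.

Lemma measurable_quotient t w : measurable_fun [set: R * R] (quotient t w).
Proof.
apply: measurable_funM => //; apply: measurable_funB; last exact: measurable_total_part.
exact: (measurableT_comp measurable_total_part (measurable_translate w)).
Qed.

Lemma quotientE t w z : quotient t w z =
  (l1 * w.1 + l2 * w.2) / t + (h (z + w) - h z) / t.
Proof. by rewrite /quotient /G /= -mulrDl; congr (_ / _); ring. Qed.

Lemma quotient_bound t w : exists B, forall z, `|quotient t w z| <= B.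
Proof.
exists (`|(l1 * w.1 + l2 * w.2) / t| + (`|M| + `|M|) * `|t^-1|) => z.
rewrite quotientE (le_trans (ler_normD _ _))// lerD2l normrM ler_wpM2r//.
by rewrite (le_trans (ler_normB _ _))// lerD// (periodic_part_bound bnd).
Qed.

(** The weak derivatives, extended by 0 over the lattice so as to be measurable on the whole
    plane. *)
Definition pU := p \_ U.
Definition qU := q \_ U.

Lemma measurable_pU : measurable_fun [set: R * R] pU.
Proof. by apply/(measurable_restrictT _ mU); case: sob => -[]. Qed.

Lemma measurable_qU : measurable_fun [set: R * R] qU.
Proof. by apply/(measurable_restrictT _ mU); case: sob => -[]. Qed.

Lemma measurable_gradient_sqr :
  measurable_fun [set: R * R] (fun z => pU z ^+ 2 + qU z ^+ 2).
Proof.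
by apply: measurable_funD; apply: measurable_funX; [exact: measurable_pU|exact: measurable_qU].
Qed.

Lemma gradient_sqr_ge0 z : 0 <= pU z ^+ 2 + qU z ^+ 2.
Proof. by rewrite addr_ge0 ?sqr_ge0. Qed.

Lemma sobolev_integrable (a b c d : R) :
  leb2.-integrable (`[a, b]%classic `*` `[c, d]%classic)
    (EFin \o (fun z => pU z ^+ 2 + qU z ^+ 2)).
Proof.
pose r := `|a| + `|b| + (`|c| + `|d|).
pose Q := `[a, b]%classic `*` `[c, d]%classic : set (R * R).
have mQ : measurable Q := measurable_rect a b c d.
have [_ /(_ r) iU _ _] := sob.
have mP : measurable_fun [set: R * R] (EFin \o (fun z => pU z ^+ 2 + qU z ^+ 2)).
  by apply/measurable_EFinP; exact: measurable_gradient_sqr.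
apply/integrableP; split; first exact: measurable_funTS.
have mD : measurable (U `&` [set z : R * R | cmod z <= r]).
  by apply: measurableI => //; exact: measurable_disk.
move/integrableP : iU => [_]; apply: le_lt_trans.
rewrite [leLHS]integral_mkcond [leRHS]integral_mkcond; apply: ge0_le_integral => //.
- by move=> z _; rewrite patchE; case: ifP.
- by apply/(measurable_restrictT _ mQ); apply: measurable_funTS; exact: measurableT_comp.
- apply/(measurable_restrictT _ mD).
  apply: (eq_measurable_fun (fun z => `|(pU z ^+ 2 + qU z ^+ 2)%:E|)%E).
    by move=> z; rewrite inE => -[Uz _]; rewrite /pU /qU !patchE mem_set.
  by apply: measurable_funTS; exact: measurableT_comp.
move=> z _; rewrite !patchE; case: ifPn => [|_]; last by case: ifP => // _; exact: abse_ge0.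
rewrite inE => -[/=]; rewrite !in_itv /= => /andP[z1 z2] /andP[z3 z4].
have zr : cmod z <= r.
  have r0 : 0 <= r by rewrite !addr_ge0.
  rewrite -(@ler_pXn2r _ 2)// ?nnegrE ?cmod_ge0// cmod_sqr.
  have nb (u v t : R) : u <= t -> t <= v -> `|t| <= `|u| + `|v|.
    have := ler_norm v; have := ler_norm (- u); rewrite normrN.
    have := normr_ge0 u; have := normr_ge0 v.
    by move=> *; rewrite ler_norml; apply/andP; split; lra.
  have n1 := nb _ _ _ z1 z2; have n2 := nb _ _ _ z3 z4.
  rewrite -(real_normK (num_real z.1)) -(real_normK (num_real z.2)).
  have k1 := normr_ge0 z.1; have k2 := normr_ge0 z.2.
  by rewrite /r; nra.
have [Uz|nUz] := pselect (U z).
  by rewrite mem_set//= /pU /qU !patchE mem_set.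
rewrite /= /pU /qU !patchE memNset// expr0n /= addr0 normr0.
by case: ifP => // _; rewrite lee_fin.
Qed.

Lemma ae_section (f : R -> R -> R) (A B : set R) :
  measurable (A : set (measurableTypeR R)) -> measurable (B : set (measurableTypeR R)) ->
  (forall y, measurable_fun [set: R] (f y)) -> (forall y x, 0 <= f y x) ->
  measurable_fun B (fun y => \int[mu]_(x in A) (f y x)%:E)%E ->
  (\int[mu]_(y in B) \int[mu]_(x in A) (f y x)%:E < +oo)%E ->
  {ae mu, forall y, B y -> mu.-integrable A (EFin \o f y)}.
Proof.
move=> mA mB mf f0 mI fin.
have I0 y : (0 <= \int[mu]_(x in A) (f y x)%:E)%E.
  by apply: integral_ge0 => x _; rewrite lee_fin.
have : mu.-integrable B (fun y => \int[mu]_(x in A) (f y x)%:E)%E.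
  apply/integrableP; split => //; apply: le_lt_trans fin.
  by under eq_integral do rewrite gee0_abs//.
move=> /(integrable_ae mB); apply: ae_mono => y H By; apply/integrableP; split.
  by apply/measurable_EFinP/measurable_funTS; exact: mf.
under eq_integral do rewrite /= ger0_norm//.
by have := H By; rewrite ge0_fin_numE.
Qed.

Lemma gradient_fin (a b c d : R) :
  (\int[leb2]_(z in `[a, b]%classic `*` `[c, d]%classic) (pU z ^+ 2 + qU z ^+ 2)%:E < +oo)%E.
Proof.
have /integrableP[_] := sobolev_integrable a b c d.
by under eq_integral do rewrite /= ger0_norm ?addr_ge0 ?sqr_ge0//.
Qed.

(* Almost every horizontal (vertical) line avoids the punctures; there the
   quotients are controlled by the line integrals of the derivative. *)
Lemma ae_line1 (A B C D : R) : {ae mu, forall y, C <= y <= D ->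
  [/\ measurable_fun [set: R] (fun x => G (x, y)),
      measurable_fun [set: R] (fun x => pU (x, y)),
      mu.-integrable `[A, B] (EFin \o (fun x => pU (x, y) ^+ 2)) &
      forall a b, A <= a -> a <= b -> b <= B ->
        G (b, y) - G (a, y) = \int[mu]_(x in `[a, b]) pU (x, y)]}.
Proof.
have [_ _ acl _] := sob.
have fin := gradient_fin A B C D.
rewrite (tonelli_rect1 measurable_gradient_sqr gradient_sqr_ge0)//= in fin.
have sec := @ae_section (fun y x => pU (x, y) ^+ 2 + qU (x, y) ^+ 2) _ _
  (measurable_itv `[A, B]) (measurable_itv `[C, D])
  (fun y => measurable_fun_pair1 y measurable_gradient_sqr) (fun _ _ => gradient_sqr_ge0 _)
  (measurable_rect1 measurable_gradient_sqr gradient_sqr_ge0 (measurable_itv _) (measurable_itv _)) fin.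
have hor := ae_horizontal tau.
have H := ae_and (ae_and acl sec) hor.
apply: ae_mono H.
move=> y [[Hacl Hsec] Uy] yCD.
have mpy := measurable_fun_pair1 y measurable_pU.
split => //.
- exact: measurable_fun_pair1 measurable_total_part.
- have := Hsec yCD; apply: le_integrable => //.
    by apply/measurable_EFinP/measurable_funTS; exact: measurable_funX.
  by move=> x _; rewrite /= lee_fin !ger0_norm ?addr_ge0 ?sqr_ge0// lerDl sqr_ge0.
- move=> a b _ ab _; rewrite !total_partE//.
  rewrite (Hacl a b ab) => [|x _]; last exact: Uy.
  by apply: eq_Rintegral => x _; rewrite /pU patchE mem_set.
Qed.

Lemma ae_line2 (A B C D : R) : {ae mu, forall x, A <= x <= B ->
  [/\ measurable_fun [set: R] (fun y => G (x, y)),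
      measurable_fun [set: R] (fun y => qU (x, y)),
      mu.-integrable `[C, D] (EFin \o (fun y => qU (x, y) ^+ 2)) &
      forall a b, C <= a -> a <= b -> b <= D ->
        G (x, b) - G (x, a) = \int[mu]_(y in `[a, b]) qU (x, y)]}.
Proof.
have [_ _ _ acl] := sob.
have fin := gradient_fin A B C D.
rewrite (tonelli_rect2 measurable_gradient_sqr gradient_sqr_ge0)//= in fin.
have sec := @ae_section (fun x y => pU (x, y) ^+ 2 + qU (x, y) ^+ 2) _ _
  (measurable_itv `[C, D]) (measurable_itv `[A, B])
  (fun x => measurable_fun_pair2 x measurable_gradient_sqr) (fun _ _ => gradient_sqr_ge0 _)
  (measurable_rect2 measurable_gradient_sqr gradient_sqr_ge0 (measurable_itv _) (measurable_itv _)) fin.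
have ver := ae_vertical tau.
have H := ae_and (ae_and acl sec) ver.
apply: ae_mono H.
move=> x [[Hacl Hsec] Ux] xAB.
have mqx := measurable_fun_pair2 x measurable_qU.
split => //.
- exact: measurable_fun_pair2 measurable_total_part.
- have := Hsec xAB; apply: le_integrable => //.
    by apply/measurable_EFinP/measurable_funTS; exact: measurable_funX.
  by move=> y _; rewrite /= lee_fin !ger0_norm ?addr_ge0 ?sqr_ge0// lerDr sqr_ge0.
- move=> a b _ ab _; rewrite !total_partE//.
  rewrite (Hacl a b ab) => [|y _]; last exact: Ux.
  by apply: eq_Rintegral => y _; rewrite /qU patchE mem_set.
Qed.

Section Rectangle.
Variables (a b c d eps : R).
Local Notation Q := (`[a, b]%classic `*` `[c, d]%classic : set (R * R)).
Local Notation Qe := (`[(a - eps)%R, (b + eps)%R]%classic `*`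
  `[(c - eps)%R, (d + eps)%R]%classic : set (R * R)).

(** The estimate on lines holds on almost every row and is integrated over the rows. The enlargement
    in the vertical direction is not forced here; it makes the right-hand domain the same as for the
    vertical quotients. *)
Lemma quotient1_sqr_le (t : R) : t != 0 -> `|t| <= eps ->
  (\int[leb2]_(z in Q) (quotient t (t, 0) z ^+ 2)%:E <=
   \int[leb2]_(z in Qe) (pU z ^+ 2)%:E)%E.
Proof.
move=> tn teps.
have e0 : 0 <= eps := le_trans (normr_ge0 t) teps.
have mI := @measurable_itv R.
have mq2 : measurable_fun [set: R * R] (fun z => quotient t (t, 0) z ^+ 2).
  by apply: measurable_funX; exact: measurable_quotient.
have mp2 : measurable_fun [set: R * R] (fun z => pU z ^+ 2).
  by apply: measurable_funX; exact: measurable_pU.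
rewrite (tonelli_rect1 mq2 (fun z => sqr_ge0 _))// (tonelli_rect1 mp2 (fun z => sqr_ge0 _))//.
apply: (@le_trans _ _ (\int[mu]_(y in `[c, d]) \int[mu]_(x in `[(a - eps)%R, (b + eps)%R]) (pU (x, y) ^+ 2)%:E)%E).
  apply: ae_ge0_le_integral => //.
  - by move=> y _; apply: integral_ge0 => x _; rewrite lee_fin sqr_ge0.
  - by apply: (@measurable_rect1 _ (fun z => quotient t (t, 0) z ^+ 2)) => // z; exact: sqr_ge0.
  - by move=> y _; apply: integral_ge0 => x _; rewrite lee_fin sqr_ge0.
  - by apply: (@measurable_rect1 _ (fun z => pU z ^+ 2)) => // z; exact: sqr_ge0.
  apply: ae_mono (ae_line1 (a - eps) (b + eps) c d).
  move=> y H; rewrite /= in_itv /= => ycd; have [m1 m2 i2 acl] := H ycd.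
  have := @quotient_sqr_le _ (fun x => G (x, y)) (fun x => pU (x, y)) _ _ m1 m2 i2 acl a b t eps tn teps (lexx _) (lexx _).
  by under eq_integral => x _ do rewrite -[X in G (_, X) - _](addr0 y).
apply: ge0_subset_integral => //.
- by apply: (@measurable_rect1 _ (fun z => pU z ^+ 2)) => // z; exact: sqr_ge0.
- by move=> y _; apply: integral_ge0 => x _; rewrite lee_fin sqr_ge0.
- move=> y; rewrite /= !in_itv /= => /andP[h1 h2].
  by rewrite (le_trans _ h1) ?gerBl//= (le_trans h2)// lerDl.
Qed.

Lemma quotient2_sqr_le (t : R) : t != 0 -> `|t| <= eps ->
  (\int[leb2]_(z in Q) (quotient t (0, t) z ^+ 2)%:E <=
   \int[leb2]_(z in Qe) (qU z ^+ 2)%:E)%E.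
Proof.
move=> tn teps.
have e0 : 0 <= eps := le_trans (normr_ge0 t) teps.
have mI := @measurable_itv R.
have mq2 : measurable_fun [set: R * R] (fun z => quotient t (0, t) z ^+ 2).
  by apply: measurable_funX; exact: measurable_quotient.
have mp2 : measurable_fun [set: R * R] (fun z => qU z ^+ 2).
  by apply: measurable_funX; exact: measurable_qU.
rewrite (tonelli_rect2 mq2 (fun z => sqr_ge0 _))// (tonelli_rect2 mp2 (fun z => sqr_ge0 _))//.
apply: (@le_trans _ _ (\int[mu]_(x in `[a, b]) \int[mu]_(y in `[(c - eps)%R, (d + eps)%R]) (qU (x, y) ^+ 2)%:E)%E).
  apply: ae_ge0_le_integral => //.
  - by move=> y _; apply: integral_ge0 => x _; rewrite lee_fin sqr_ge0.
  - by apply: (@measurable_rect2 _ (fun z => quotient t (0, t) z ^+ 2)) => // z; exact: sqr_ge0.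
  - by move=> y _; apply: integral_ge0 => x _; rewrite lee_fin sqr_ge0.
  - by apply: (@measurable_rect2 _ (fun z => qU z ^+ 2)) => // z; exact: sqr_ge0.
  apply: ae_mono (ae_line2 a b (c - eps) (d + eps)).
  move=> x H; rewrite /= in_itv /= => xab; have [m1 m2 i2 acl] := H xab.
  have := @quotient_sqr_le _ (fun y => G (x, y)) (fun y => qU (x, y)) _ _ m1 m2 i2 acl c d t eps tn teps (lexx _) (lexx _).
  by under eq_integral => y _ do rewrite -[X in G (X, _) - _](addr0 x).
apply: ge0_subset_integral => //.
- by apply: (@measurable_rect2 _ (fun z => qU z ^+ 2)) => // z; exact: sqr_ge0.
- by move=> y _; apply: integral_ge0 => x _; rewrite lee_fin sqr_ge0.
- move=> y; rewrite /= !in_itv /= => /andP[h1 h2].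
  by rewrite (le_trans _ h1) ?gerBl//= (le_trans h2)// lerDl.
Qed.

End Rectangle.

End Component.

(** * Almost everywhere convergence of the quotients in the plane *)

Section AlmostEverywhereConvergence.
Variable R : realType.
Local Notation mu := (@lebesgue_measure R).
Local Notation leb2 := (@lebesgue_measure R \x @lebesgue_measure R)%E.

(** Null sections make a null set only if the exceptional set is measurable, so convergence at a
    point is expressed through countably many measurable conditions. *)
Lemma measurable_cvg_set d (T : measurableType d) (f : nat -> T -> R) (p : T -> R) :
  (forall n, measurable_fun [set: T] (f n)) -> measurable_fun [set: T] p ->
  measurable [set x | f n x @[n --> \oo] --> p x].
Proof.
move=> mf mp.
rewrite (_ : [set x | _] = \bigcap_k \bigcup_m \bigcap_(n in [set n | (m <= n)%N])
    [set x | `|f n x - p x| <= k.+1%:R^-1]).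
  apply: bigcap_measurableType => k _; apply: bigcup_measurable => m _.
  apply: bigcap_measurableType => n _.
  rewrite (_ : [set x | _] = (fun x => `|f n x - p x|) @^-1` `]-oo, k.+1%:R^-1]).
    rewrite -[X in measurable X]setTI.
    have mg : measurable_fun [set: T] (fun x => `|f n x - p x|).
      by apply: measurableT_comp => //; exact: measurable_funB.
    by apply: mg => //; exact: measurable_itv.
  by apply/seteqP; split => x /=; rewrite in_itv.
apply/seteqP; split => x /= fx.
  move=> k _.
  have k0 : 0 < k.+1%:R^-1 :> R by rewrite invr_gt0.
  have /cvgrPdist_le/(_ _ k0)[m _ H] := fx.
  by exists m => // n /= mn; rewrite distrC; exact: H.
apply/cvgrPdist_le => e e0.
have [k _ /(_ k (leqnn _)) ke] := near_infty_natSinv_lt (PosNum e0).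
have [m _ H] := fx k I.
by exists m => // n /= mn; rewrite distrC (le_trans (H n mn))// ltW.
Qed.

Section Sections.
Variables (f g : nat -> R * R -> R) (p : R * R -> R) (S : set (R * R)).
Hypothesis mf : forall n, measurable_fun [set: R * R] (f n).
Hypothesis mg : forall n, measurable_fun [set: R * R] (g n).
Hypothesis mp : measurable_fun [set: R * R] p.
Hypothesis mS : measurable S.

Let N := S `\` [set z | (f n z @[n --> \oo] --> p z) /\ (g n z @[n --> \oo] --> p z)].

Let mN : measurable N.
Proof.
by apply: measurableD => //; apply: measurableI; exact: measurable_cvg_set.
Qed.

Lemma ae_cvg1 : {ae mu, forall y, {ae mu, forall x, S (x, y) ->
    (f n (x, y) @[n --> \oo] --> p (x, y)) /\ (g n (x, y) @[n --> \oo] --> p (x, y))}} ->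
  {ae leb2, forall z, S z ->
    (f n z @[n --> \oo] --> p z) /\ (g n z @[n --> \oo] --> p z)}.
Proof.
move=> H; exists N; split => //; last by move=> z /= /not_implyP.
apply: leb2_null1 => //; apply: ae_mono H => y [N' [mN' N'0 sub]].
apply: (subset_measure0 _ mN') => //; first exact: measurable_ysection.
by move=> x /ysectionP[Sz nc]; apply: sub => /= /(_ Sz).
Qed.

Lemma ae_cvg2 : {ae mu, forall x, {ae mu, forall y, S (x, y) ->
    (f n (x, y) @[n --> \oo] --> p (x, y)) /\ (g n (x, y) @[n --> \oo] --> p (x, y))}} ->
  {ae leb2, forall z, S z ->
    (f n z @[n --> \oo] --> p z) /\ (g n z @[n --> \oo] --> p z)}.
Proof.
move=> H; exists N; split => //; last by move=> z /= /not_implyP.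
apply: leb2_null2 => //; apply: ae_mono H => x [N' [mN' N'0 sub]].
apply: (subset_measure0 _ mN') => //; first exact: measurable_xsection.
by move=> y /xsectionP[Sz nc]; apply: sub => /= /(_ Sz).
Qed.

End Sections.

Section Component.
Variables (tau : R * R) (g p q : R * R -> R) (l1 l2 M : R).
Hypothesis t0 : 0 < tau.2.
Local Notation U := (punctured_plane tau).
Hypothesis cg : {in U, continuous g}.
Hypothesis per : forall z m n, U z ->
  g (z + lattice_point tau m n) =
  g z + (l1 * (lattice_point tau m n).1 + l2 * (lattice_point tau m n).2).
Hypothesis bnd : forall z, U z -> `|g z - (l1 * z.1 + l2 * z.2)| <= M.
Hypothesis sob : sobolev_derivatives U g p q.
Variables (a b c d : R).
Local Notation Q := (`[a, b]%classic `*` `[c, d]%classic : set (R * R)).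

Lemma ae_quotient1_cvg : {ae leb2, forall z, Q z ->
  (quotient tau g l1 l2 n.+1%:R^-1 (n.+1%:R^-1, 0) z @[n --> \oo] --> pU tau p z) /\
  (quotient tau g l1 l2 (- n.+1%:R^-1) (- n.+1%:R^-1, 0) z @[n --> \oo] --> pU tau p z)}.
Proof.
apply: ae_cvg1.
- by move=> n; exact: measurable_quotient.
- by move=> n; exact: measurable_quotient.
- exact: measurable_pU sob.
- exact: measurable_rect.
(* The margin 1 places the points of [[a, b]] in the interior of the interval on which the quotients
   are known to converge. *)
have := @ae_line1 _ _ _ _ _ l1 l2 t0 cg sob (a - 1) (b + 1) c d.
apply: ae_mono => y Hy.
have [ycd|ycd] := boolP (c <= y <= d); last first.
  by apply: aeW => x [_]; rewrite /= in_itv /= (negbTE ycd).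
have [m1 m2 i2 acl] := Hy ycd.
have := ae_quotient_cvg m2 i2 acl.
apply: ae_mono => x Hx [/=]; rewrite in_itv /= => /andP[ax xb] _.
have [||h1 h2] := Hx.
- by rewrite (lt_le_trans _ ax)// ltrBlDr ltrDl.
- by rewrite (le_lt_trans xb)// ltrDl.
split.
  by move: h1; rewrite /quotient; under [in X in _ -> X]eq_fun do rewrite /= -[X in total_part _ _ _ _ (_, X)]/(y + 0) addr0.
by move: h2; rewrite /quotient; under [in X in _ -> X]eq_fun do rewrite /= -[X in total_part _ _ _ _ (_, X)]/(y + 0) addr0.
Qed.

Lemma ae_quotient2_cvg : {ae leb2, forall z, Q z ->
  (quotient tau g l1 l2 n.+1%:R^-1 (0, n.+1%:R^-1) z @[n --> \oo] --> qU tau q z) /\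
  (quotient tau g l1 l2 (- n.+1%:R^-1) (0, - n.+1%:R^-1) z @[n --> \oo] --> qU tau q z)}.
Proof.
apply: ae_cvg2.
- by move=> n; exact: measurable_quotient.
- by move=> n; exact: measurable_quotient.
- exact: measurable_qU sob.
- exact: measurable_rect.
have := @ae_line2 _ _ _ _ _ l1 l2 t0 cg sob a b (c - 1) (d + 1).
apply: ae_mono => x Hx.
have [xab|xab] := boolP (a <= x <= b); last first.
  by apply: aeW => y [/=]; rewrite in_itv /= (negbTE xab).
have [m1 m2 i2 acl] := Hx xab.
have := ae_quotient_cvg m2 i2 acl.
apply: ae_mono => y Hy [/= _]; rewrite in_itv /= => /andP[cy yd].
have [||h1 h2] := Hy.
- by rewrite (lt_le_trans _ cy)// ltrBlDr ltrDl.
- by rewrite (le_lt_trans yd)// ltrDl.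
split.
  by move: h1; rewrite /quotient; under [in X in _ -> X]eq_fun do rewrite /= -[X in total_part _ _ _ _ (X, _)]/(x + 0) addr0.
by move: h2; rewrite /quotient; under [in X in _ -> X]eq_fun do rewrite /= -[X in total_part _ _ _ _ (X, _)]/(x + 0) addr0.
Qed.

End Component.
End AlmostEverywhereConvergence.

(** * Groetzsch's inequality *)

Lemma fatou_bound d (T : measurableType d) (R : realType) (m : {measure set T -> \bar R})
    (D : set T) (f : nat -> T -> R) (g : T -> R) (C : \bar R) (N : nat) : measurable D ->
  (forall n, measurable_fun D (f n)) -> (forall n x, 0 <= f n x) ->
  measurable_fun D g -> (forall x, 0 <= g x) ->
  {ae m, forall x, D x -> f n x @[n --> \oo] --> g x} ->
  (forall n, (N <= n)%N -> (\int[m]_(x in D) (f n x)%:E <= C)%E) ->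
  (\int[m]_(x in D) (g x)%:E <= C)%E.
Proof.
move=> mD mf f0 mg g0 fg fC.
have mF n : measurable_fun D (EFin \o f n) by exact/measurable_EFinP.
apply: (@le_trans _ _ (\int[m]_(x in D) limn_einf (fun n => (f n x)%:E))%E).
  apply: ae_ge0_le_integral => //.
  - by move=> x _; rewrite lee_fin.
  - exact/measurable_EFinP.
  - move=> x _; rewrite limn_einf_lim; apply: lime_ge; first exact: is_cvg_einfs.
    by apply: nearW => n; apply: le_ereal_inf_tmp => _ [k _ <-]; rewrite lee_fin.
  - apply: (eq_measurable_fun (fun x => - limn_esup (fun n => - (f n x)%:E))%E).
      by move=> x _; rewrite -limn_einfN; congr limn_einf; apply: funext => n /=; rewrite opprK.
    apply: measurableT_comp => //; apply: measurable_fun_limn_esup => n.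
    by apply/measurable_EFinP; exact: measurableT_comp (mf n).
  apply: ae_mono fg => x fgx Dx.
  have /cvg_limn_einf_sup[-> _]// : (f n x)%:E @[n --> \oo] --> (g x)%:E.
  by apply: cvg_EFin; [exact: nearW|exact: fgx].
have F0 n x : D x -> (0 <= (f n x)%:E)%E by move=> _; rewrite lee_fin.
apply: (le_trans (@fatou _ _ _ m D mD (fun n x => (f n x)%:E) mF F0)).
rewrite limn_einf_lim; apply: lime_le; first exact: is_cvg_einfs.
apply: nearW => n.
apply: (@le_trans _ _ (\int[m]_(x in D) (f (maxn n N) x)%:E)%E); last first.
  by apply: fC; rewrite leq_maxr.
by apply: ereal_inf_lbound; exists (maxn n N) => //=; rewrite leq_maxl.
Qed.

Section BoundedMeasurable.
Variable R : realType.
Local Notation leb2 := (@lebesgue_measure R \x @lebesgue_measure R)%E.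
Implicit Types G H : R * R -> R.

Definition bounded_measurable G : Prop :=
  measurable_fun [set: R * R] G /\ exists M : R, forall z, `|G z| <= M.

Lemma bounded_measurableD G H : bounded_measurable G -> bounded_measurable H ->
  bounded_measurable (fun z => G z + H z).
Proof.
move=> [mG [M GM]] [mH [N HN]]; split; first exact: measurable_funD.
by exists (M + N) => z; rewrite (le_trans (ler_normD _ _))// lerD.
Qed.

Lemma bounded_measurableM G H : bounded_measurable G -> bounded_measurable H ->
  bounded_measurable (fun z => G z * H z).
Proof.
move=> [mG [M GM]] [mH [N HN]]; split; first exact: measurable_funM.
by exists (M * N) => z; rewrite normrM ler_pM.
Qed.

Lemma bounded_measurable_cst (a : R) : bounded_measurable (fun=> a).
Proof. by split; [exact: measurable_cst|exists `|a|]. Qed.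

Lemma bounded_measurableZ (a : R) G : bounded_measurable G ->
  bounded_measurable (fun z => a * G z).
Proof. exact: bounded_measurableM (bounded_measurable_cst a). Qed.

Lemma bounded_measurable_integrable (a b c d : R) G : bounded_measurable G ->
  leb2.-integrable (`[a, b]%classic `*` `[c, d]%classic) (EFin \o G).
Proof. by move=> [mG [M GM]]; exact: rect_integrable GM. Qed.

End BoundedMeasurable.

(** * Functions of mean zero over a cell, and the determinant *)

Section NullMean.
Variable R : realType.
Local Notation leb2 := (@lebesgue_measure R \x @lebesgue_measure R)%E.
Variables (tau : R * R) (c : R).
Hypothesis t0 : 0 < tau.2.
Local Notation Q := (`[0%R, 1%R]%classic `*` `[c, (c + tau.2)%R]%classic : set (R * R)).

Definition null_mean (G : R * R -> R) : Prop :=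
  bounded_measurable G /\ \int[leb2]_(z in Q) G z = 0.

Let mQ : measurable Q := measurable_rect 0 1 c (c + tau.2).

Lemma null_meanD G H : null_mean G -> null_mean H -> null_mean (fun z => G z + H z).
Proof.
move=> [bG G0] [bH H0]; split; first exact: bounded_measurableD.
by rewrite RintegralD ?G0 ?H0 ?addr0//; exact: bounded_measurable_integrable.
Qed.

Lemma null_meanZ G (a : R) : null_mean G -> null_mean (fun z => a * G z).
Proof.
move=> [bG G0]; split; first exact: bounded_measurableZ.
by rewrite RintegralZl ?G0 ?mulr0//; exact: bounded_measurable_integrable.
Qed.

(** This is translation invariance of the cell integral; the error terms in the quotients and in
    their determinant are combinations of such differences. *)
Lemma null_mean_coboundary (G : R * R -> R) (w : R * R) : bounded_measurable G ->
  (forall z m n, G (z + lattice_point tau m n) = G z) ->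
  null_mean (fun z => G (z + w) - G z).
Proof.
move=> bG pG; have [mG [M GM]] := bG.
have bGw : bounded_measurable (fun z => G (z + w)).
  by split; [exact: (measurableT_comp mG (measurable_translate w))|exists M].
split.
  under [X in bounded_measurable X]funext => z do rewrite -mulN1r.
  by apply: bounded_measurableD => //; exact: bounded_measurableZ.
rewrite RintegralB//; last 2 first.
- exact: bounded_measurable_integrable.
- exact: bounded_measurable_integrable.
by rewrite (cell_translate c t0 w mG GM pG) subrr.
Qed.

Lemma cell_area : leb2 Q = tau.2%:E.
Proof.
rewrite product_measure1E; [|exact: measurable_itv|exact: measurable_itv].
rewrite /= !lebesgue_measure_segment ?lerDl ?(ltW t0)//.
by rewrite subr0 mul1e addrC addKr.
Qed.

Lemma cell_mean G (a : R) : null_mean G -> \int[leb2]_(z in Q) (a + G z) = a * tau.2.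
Proof.
move=> [bG G0]; rewrite RintegralD//; last 2 first.
- exact: (bounded_measurable_integrable _ _ _ _ (bounded_measurable_cst a)).
- exact: bounded_measurable_integrable.
rewrite G0 addr0 Rintegral_cst//=; have /= -> := cell_area.
by [].
Qed.

(** From [(a + G) ^ 2 >= a ^ 2 + 2 a G], whose last term has mean zero. *)
Lemma cell_sqr_ge G (a : R) : null_mean G ->
  ((a ^+ 2 * tau.2)%:E <= \int[leb2]_(z in Q) ((a + G z) ^+ 2)%:E)%E.
Proof.
move=> nG; have [bG _] := nG.
have bS : bounded_measurable (fun z => a + G z).
  by apply: bounded_measurableD => //; exact: bounded_measurable_cst.
have bL : bounded_measurable (fun z => a ^+ 2 + 2 * a * G z).
  apply: bounded_measurableD; first exact: bounded_measurable_cst.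
  exact: bounded_measurableZ.
have iL := bounded_measurable_integrable 0 1 c (c + tau.2) bL.
have iS := bounded_measurable_integrable 0 1 c (c + tau.2) (bounded_measurableM bS bS).
have <- : (\int[leb2]_(z in Q) (a ^+ 2 + 2 * a * G z)%:E)%E = (a ^+ 2 * tau.2)%:E.
  rewrite -(cell_mean _ (null_meanZ (2 * a) nG)) /Rintegral fineK//.
  exact: integrable_fin_num.
apply: le_integral => // z _.
by rewrite lee_fin; have := sqr_ge0 (G z); lra.
Qed.

End NullMean.

Section Determinant.
Variable R : realType.
Local Notation leb2 := (@lebesgue_measure R \x @lebesgue_measure R)%E.
Variables (tau : R * R) (c : R) (h k : R * R -> R) (l1 l2 m1 m2 s : R).
Hypothesis t0 : 0 < tau.2.
Hypothesis bh : bounded_measurable h.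
Hypothesis bk : bounded_measurable k.
Hypothesis ph : forall z m n, h (z + lattice_point tau m n) = h z.
Hypothesis pk : forall z m n, k (z + lattice_point tau m n) = k z.

(* Forward quotients in one row and backward ones in the other make the
   determinant differ from that of the linear part by coboundaries. *)
Lemma null_mean_det : null_mean tau c (fun z =>
  (l1 + (h (z + (s, 0)) - h z) / s) * (m2 + (k (z + (0, s)) - k z) / s) -
  (m1 + (k (z + (- s, 0)) - k z) / - s) * (l2 + (h (z + (0, - s)) - h z) / - s) -
  (l1 * m2 - m1 * l2)).
Proof.
have shift G w : bounded_measurable G -> bounded_measurable (fun z => G (z + w)).
  by move=> [mG [M GM]]; split; [exact: (measurableT_comp mG (measurable_translate w))|exists M].
have prod (v w x : R * R) :
    null_mean tau c (fun z => h (z + x + v) * k (z + x + w) - h (z + v) * k (z + w)).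
  apply: (@null_mean_coboundary _ _ _ t0 (fun z => h (z + v) * k (z + w))).
    by apply: bounded_measurableM; exact: shift.
  by move=> z m n; rewrite (addrAC z _ v) (addrAC z _ w) ph pk.
have cobh w := null_mean_coboundary c t0 w bh ph.
have cobk w := null_mean_coboundary c t0 w bk pk.
(* The first four terms are linear in [h] and [k]. In the quadratic part [h k] cancels outright, and
   the three remaining products of forward shifts are carried onto the three products of backward
   shifts by translation through [(- s, - s)], [(- s, 0)] and [(0, - s)]. *)
have := null_meanD (null_meanD (null_meanD (null_meanD (null_meanD (null_meanD
  (null_meanZ (l1 / s) (cobk (0, s))) (null_meanZ (m2 / s) (cobh (s, 0))))
  (null_meanZ (l2 / s) (cobk (- s, 0)))) (null_meanZ (m1 / s) (cobh (0, - s))))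
  (null_meanZ (- (s^-1 * s^-1)) (prod (s, 0) (0, s) (- s, - s))))
  (null_meanZ (s^-1 * s^-1) (prod (s, 0) 0 (- s, 0))))
  (null_meanZ (s^-1 * s^-1) (prod 0 (0, s) (0, - s))).
set G := (X in null_mean _ _ X -> _); set G' := (X in _ -> null_mean _ _ X).
suff -> : G' = G by [].
apply: funext => z; rewrite /G /G' {G G'}.
have E1 : z + (- s, - s) + (s, 0) = z + (0, - s).
  by apply: injective_projections => /=; ring.
have E2 : z + (- s, - s) + (0, s) = z + (- s, 0).
  by apply: injective_projections => /=; ring.
have E3 : z + (- s, 0) + (s, 0) = z.
  by apply: injective_projections => /=; ring.
have E4 : z + (0, - s) + (0, s) = z.
  by apply: injective_projections => /=; ring.
rewrite E1 E2 E3 E4 !addr0 invrN.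
ring.
Qed.

End Determinant.

Lemma ge0_integral_sqr4 d (T : measurableType d) (R : realType)
    (m : {measure set T -> \bar R}) (D : set T) (f g h k : T -> R) :
  measurable D -> measurable_fun [set: T] f -> measurable_fun [set: T] g ->
  measurable_fun [set: T] h -> measurable_fun [set: T] k ->
  (\int[m]_(x in D) ((f x ^+ 2 + g x ^+ 2) + (h x ^+ 2 + k x ^+ 2))%:E =
  (\int[m]_(x in D) (f x ^+ 2)%:E + \int[m]_(x in D) (g x ^+ 2)%:E) +
  (\int[m]_(x in D) (h x ^+ 2)%:E + \int[m]_(x in D) (k x ^+ 2)%:E))%E.
Proof.
move=> mD mf mg mh mk.
have mX (w : T -> R) : measurable_fun [set: T] w -> measurable_fun D (fun x => (w x ^+ 2)%:E).
  by move=> mw; apply/measurable_EFinP/measurable_funTS/measurable_funX.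
have sq x : (0 <= ((x : R) ^+ 2)%:E)%E by rewrite lee_fin sqr_ge0.
under eq_integral do rewrite EFinD 2!EFinD.
rewrite ge0_integralD//; last 4 first.
- by move=> x _; exact: adde_ge0.
- by apply: emeasurable_funD; apply: mX.
- by move=> x _; exact: adde_ge0.
- by apply: emeasurable_funD; apply: mX.
by rewrite !ge0_integralD//; apply: mX.
Qed.

Section Energy.
Variable R : realType.
Local Notation mu := (@lebesgue_measure R).
Local Notation leb2 := (@lebesgue_measure R \x @lebesgue_measure R)%E.
Variables (tau : R * R) (c : R) (u v p1 q1 p2 q2 : R * R -> R) (l1 l2 m1 m2 M : R).
Hypothesis t0 : 0 < tau.2.
Local Notation U := (punctured_plane tau).
Hypothesis cu : {in U, continuous u}.
Hypothesis cv : {in U, continuous v}.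
Hypothesis peru : forall z m n, U z -> u (z + lattice_point tau m n) =
  u z + (l1 * (lattice_point tau m n).1 + l2 * (lattice_point tau m n).2).
Hypothesis perv : forall z m n, U z -> v (z + lattice_point tau m n) =
  v z + (m1 * (lattice_point tau m n).1 + m2 * (lattice_point tau m n).2).
Hypothesis bndu : forall z, U z -> `|u z - (l1 * z.1 + l2 * z.2)| <= M.
Hypothesis bndv : forall z, U z -> `|v z - (m1 * z.1 + m2 * z.2)| <= M.
Hypothesis su : sobolev_derivatives U u p1 q1.
Hypothesis sv : sobolev_derivatives U v p2 q2.

Local Notation Qe eps := (`[(0 - eps)%R, (1 + eps)%R]%classic `*`
  `[(c - eps)%R, (c + tau.2 + eps)%R]%classic : set (R * R)).
Local Notation Q := (`[0%R, 1%R]%classic `*` `[c, (c + tau.2)%R]%classic : set (R * R)).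

Local Notation h := (periodic_part tau u l1 l2).
Local Notation k := (periodic_part tau v m1 m2).
(** [A1] and [B2] are forward quotients of [u] in [x] and of [v] in [y]; [A2] and [B1] are backward
    ones. This is the mixture for which [null_mean_det] holds. *)
Local Notation A1 s := (quotient tau u l1 l2 s (s, 0)).
Local Notation A2 s := (quotient tau v m1 m2 (- s) (- s, 0)).
Local Notation B1 s := (quotient tau u l1 l2 (- s) (0, - s)).
Local Notation B2 s := (quotient tau v m1 m2 s (0, s)).
Local Notation P1 := (pU tau p1).
Local Notation P2 := (pU tau p2).
Local Notation Q1 := (qU tau q1).
Local Notation Q2 := (qU tau q2).

Definition energy_density z := (P1 z ^+ 2 + Q1 z ^+ 2) + (P2 z ^+ 2 + Q2 z ^+ 2).
Local Notation HS := energy_density.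
Definition det_density z := P1 z * Q2 z - P2 z * Q1 z.
Local Notation J := det_density.
(** The enlargement by [eps] contains every point that the quotients of step at most [eps] reach
    from the cell. *)
Definition energy eps := \int[leb2]_(z in Qe eps) HS z.

Let bh : bounded_measurable h.
Proof.
by split; [exact: measurable_periodic_part|exists `|M|; exact: (periodic_part_bound bndu)].
Qed.
Let bk : bounded_measurable k.
Proof.
by split; [exact: measurable_periodic_part|exists `|M|; exact: (periodic_part_bound bndv)].
Qed.

Let bA1 s w : bounded_measurable (quotient tau u l1 l2 s w).
Proof. by split; [exact: measurable_quotient|exact: (quotient_bound bndu)]. Qed.
Let bA2 s w : bounded_measurable (quotient tau v m1 m2 s w).
Proof. by split; [exact: measurable_quotient|exact: (quotient_bound bndv)]. Qed.

Let mP1 : measurable_fun [set: R * R] P1 := measurable_pU t0 su.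
Let mP2 : measurable_fun [set: R * R] P2 := measurable_pU t0 sv.
Let mQ1 : measurable_fun [set: R * R] Q1 := measurable_qU t0 su.
Let mQ2 : measurable_fun [set: R * R] Q2 := measurable_qU t0 sv.
Let mQ : measurable Q := measurable_rect 0 1 c (c + tau.2).
Let mQe eps : measurable (Qe eps).
Proof. exact: measurable_rect. Qed.

Lemma measurable_energy_density : measurable_fun [set: R * R] HS.
Proof. by apply: measurable_funD; apply: measurable_funD; exact: measurable_funX. Qed.

Lemma measurable_det_density : measurable_fun [set: R * R] J.
Proof. by apply: measurable_funB; exact: measurable_funM. Qed.

Lemma energy_density_ge0 z : 0 <= HS z.
Proof. by rewrite !addr_ge0 ?sqr_ge0. Qed.

Lemma energy_integrable (a b a' b' : R) :
  leb2.-integrable (`[a, b]%classic `*` `[a', b']%classic) (EFin \o HS).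
Proof.
have := @integrableD _ _ _ leb2 _ (measurable_rect a b a' b') _ _ (sobolev_integrable t0 su a b a' b')
  (sobolev_integrable t0 sv a b a' b').
by apply: eq_integrable => //; exact: measurable_rect.
Qed.

Lemma det_density_le z : `|2 * J z| <= HS z.
Proof.
rewrite ler_norml /energy_density /det_density.
have := sqr_ge0 (P1 z + Q2 z); have := sqr_ge0 (P1 z - Q2 z).
have := sqr_ge0 (P2 z + Q1 z); have := sqr_ge0 (P2 z - Q1 z).
by move=> *; apply/andP; split; lra.
Qed.

Lemma det_integrable : leb2.-integrable Q (EFin \o (fun z => 2 * J z)).
Proof.
have := energy_integrable 0 1 c (c + tau.2); apply: le_integrable => //.
  apply/measurable_EFinP/measurable_funTS/measurable_funM; first exact: measurable_cst.
  exact: measurable_det_density.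
move=> z _; rewrite /= lee_fin (ger0_norm (energy_density_ge0 z)).
exact: det_density_le.
Qed.

Let quotE t (x y : R) z g (n1 n2 : R) : t != 0 -> quotient tau g n1 n2 t (t * x, t * y) z =
  (n1 * x + n2 * y) +
  (periodic_part tau g n1 n2 (z + (t * x, t * y)) - periodic_part tau g n1 n2 z) / t.
Proof.
move=> tn; rewrite quotientE /=; congr (_ + _).
by rewrite !(mulrCA _ t) -mulrDr mulrC mulKf.
Qed.

Let A1E s z : s != 0 -> A1 s z = l1 + (h (z + (s, 0)) - h z) / s.
Proof. by move=> s0; have := quotE 1 0 z u l1 l2 s0; rewrite !mulr1 !mulr0 addr0. Qed.
Let A2E s z : s != 0 -> A2 s z = m1 + (k (z + (- s, 0)) - k z) / - s.
Proof.
by rewrite -oppr_eq0 => s0; have := quotE 1 0 z v m1 m2 s0; rewrite !mulr1 !mulr0 addr0.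
Qed.
Let B1E s z : s != 0 -> B1 s z = l2 + (h (z + (0, - s)) - h z) / - s.
Proof.
by rewrite -oppr_eq0 => s0; have := quotE 0 1 z u l1 l2 s0; rewrite !mulr1 !mulr0 add0r.
Qed.
Let B2E s z : s != 0 -> B2 s z = m2 + (k (z + (0, s)) - k z) / s.
Proof. by move=> s0; have := quotE 0 1 z v m1 m2 s0; rewrite !mulr1 !mulr0 add0r. Qed.

Lemma quotient_det_mean s : s != 0 ->
  \int[leb2]_(z in Q) (A1 s z * B2 s z - A2 s z * B1 s z) = (l1 * m2 - m1 * l2) * tau.2.
Proof.
move=> s0.
have := null_mean_det c l1 l2 m1 m2 s t0 bh bk
  (periodic_part_period peru) (periodic_part_period perv).
move=> /(cell_mean t0 (l1 * m2 - m1 * l2)) <-.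
by apply: eq_Rintegral => z _; rewrite A1E// A2E// B1E// B2E// [RHS]addrC subrK.
Qed.

Definition quotient_energy s z := (A1 s z ^+ 2 + B1 s z ^+ 2) + (A2 s z ^+ 2 + B2 s z ^+ 2).

Lemma bounded_quotient_energy s : bounded_measurable (quotient_energy s).
Proof.
have sq G : bounded_measurable G -> bounded_measurable (fun z => G z ^+ 2).
  by move=> bG; exact: bounded_measurableM.
by apply: bounded_measurableD; apply: bounded_measurableD; apply: sq.
Qed.

Lemma quotient_energyE s : (\int[leb2]_(z in Q) (quotient_energy s z)%:E =
  (\int[leb2]_(z in Q) (A1 s z ^+ 2)%:E + \int[leb2]_(z in Q) (B1 s z ^+ 2)%:E) +
  (\int[leb2]_(z in Q) (A2 s z ^+ 2)%:E + \int[leb2]_(z in Q) (B2 s z ^+ 2)%:E))%E.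
Proof. by apply: ge0_integral_sqr4 => //; [case: (bA1 s (s, 0))|case: (bA1 (- s) (0, - s))|case: (bA2 (- s) (- s, 0))|case: (bA2 s (0, s))]. Qed.

Lemma quotient_energy_le s eps : 0 < s -> s <= eps ->
  (\int[leb2]_(z in Q) (quotient_energy s z)%:E <= (energy eps)%:E)%E.
Proof.
move=> s0 seps; rewrite quotient_energyE.
have sn : s != 0 by rewrite gt_eqF.
have nsn : - s != 0 by rewrite oppr_eq0.
have ns : `|s| <= eps by rewrite gtr0_norm.
have nns : `|- s| <= eps by rewrite normrN gtr0_norm.
rewrite /energy /Rintegral fineK; last first.
  exact: (@integrable_fin_num _ _ _ leb2 _ (mQe eps) (EFin \o HS) (energy_integrable _ _ _ _)).
apply: le_trans (leeD (leeD _ _) (leeD _ _)) _.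
- exact: (quotient1_sqr_le l1 l2 t0 cu su 0 1 c (c + tau.2) sn ns).
- exact: (quotient2_sqr_le l1 l2 t0 cu su 0 1 c (c + tau.2) nsn nns).
- exact: (quotient1_sqr_le m1 m2 t0 cv sv 0 1 c (c + tau.2) nsn nns).
- exact: (quotient2_sqr_le m1 m2 t0 cv sv 0 1 c (c + tau.2) sn ns).
by rewrite -(ge0_integral_sqr4 leb2 (mQe eps) mP1 mQ1 mP2 mQ2).
Qed.

(** Quotients of the single step [eps] suffice: their cell means are the coefficients of the linear
    part, and the mean of a square is at least the square of the mean. *)
Lemma linear_energy_le eps : 0 < eps ->
  ((l1 ^+ 2 + l2 ^+ 2) + (m1 ^+ 2 + m2 ^+ 2)) * tau.2 <= energy eps.
Proof.
move=> e0; rewrite -lee_fin.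
apply: le_trans (quotient_energy_le e0 (lexx _)); rewrite quotient_energyE.
have en : eps != 0 by rewrite gt_eqF.
have cobh (t : R) w := null_meanZ t^-1 (null_mean_coboundary c t0 w bh (periodic_part_period peru)).
have cobk (t : R) w := null_meanZ t^-1 (null_mean_coboundary c t0 w bk (periodic_part_period perv)).
rewrite !mulrDl !EFinD; apply: leeD; apply: leeD.
- have := cell_sqr_ge t0 l1 (cobh eps (eps, 0)).
  by under eq_integral => z _ do rewrite [eps^-1 * _]mulrC -A1E//.
- have := cell_sqr_ge t0 l2 (cobh (- eps) (0, - eps)).
  by under eq_integral => z _ do rewrite [(- eps)^-1 * _]mulrC -B1E//.
- have := cell_sqr_ge t0 m1 (cobk (- eps) (- eps, 0)).
  by under eq_integral => z _ do rewrite [(- eps)^-1 * _]mulrC -A2E//.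
- have := cell_sqr_ge t0 m2 (cobk eps (0, eps)).
  by under eq_integral => z _ do rewrite [eps^-1 * _]mulrC -B2E//.
Qed.

(* The determinant has no sign, but adding the squared norm makes it a sum of
   squares, to which Fatou's lemma applies. *)
Lemma energy_det_le eps : 0 < eps ->
  \int[leb2]_(z in Q) (HS z + 2 * J z) <= energy eps + 2 * ((l1 * m2 - m1 * l2) * tau.2).
Proof.
move=> e0.
pose s n : R := n.+1%:R^-1.
have s0 n : 0 < s n by rewrite invr_gt0.
pose f n z := (A1 (s n) z + B2 (s n) z) ^+ 2 + (A2 (s n) z - B1 (s n) z) ^+ 2.
pose D n z := A1 (s n) z * B2 (s n) z - A2 (s n) z * B1 (s n) z.
pose g z := (P1 z + Q2 z) ^+ 2 + (P2 z - Q1 z) ^+ 2.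
have gE z : HS z + 2 * J z = g z.
  by rewrite /energy_density /det_density /g; ring.
have fE n z : f n z = quotient_energy (s n) z + 2 * D n z.
  by rewrite /f /quotient_energy /D; ring.
have bD n : bounded_measurable (D n).
  apply: bounded_measurableD; first exact: bounded_measurableM.
  under [X in bounded_measurable X]funext => z do rewrite -mulN1r.
  by apply: bounded_measurableZ; exact: bounded_measurableM.
have b2D n : bounded_measurable (fun z => 2 * D n z).
  exact: bounded_measurableZ.
have mf n : measurable_fun Q (f n).
  rewrite (funext (fE n)); apply: measurable_funTS.
  by have [] := bounded_measurableD (bounded_quotient_energy (s n)) (b2D n).
have mg : measurable_fun [set: R * R] g.
  by apply: measurable_funD; apply: measurable_funX; [exact: measurable_funD|exact: measurable_funB].
have [N _ HN] := near_infty_natSinv_lt (PosNum e0).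
have ig : leb2.-integrable Q (EFin \o g).
  have := @integrableD _ _ _ leb2 _ mQ _ _ (energy_integrable 0 1 c (c + tau.2)) det_integrable.
  by apply: eq_integrable => // z _ /=; rewrite -EFinD gE.
rewrite -lee_fin; under eq_Rintegral do rewrite gE.
rewrite /Rintegral fineK; last exact: integrable_fin_num.
apply: (@fatou_bound _ _ _ leb2 _ f g _ N) => //.
- by move=> n z; rewrite addr_ge0// sqr_ge0.
- exact: measurable_funTS.
- by move=> z; rewrite addr_ge0// sqr_ge0.
- have c1 := ae_quotient1_cvg l1 l2 t0 cu su 0 1 c (c + tau.2).
  have c2 := ae_quotient1_cvg m1 m2 t0 cv sv 0 1 c (c + tau.2).
  have c3 := ae_quotient2_cvg l1 l2 t0 cu su 0 1 c (c + tau.2).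
  have c4 := ae_quotient2_cvg m1 m2 t0 cv sv 0 1 c (c + tau.2).
  apply: ae_mono (ae_and (ae_and c1 c2) (ae_and c3 c4)) => z [[H1 H2] [H3 H4]] Qz.
  have [a1 _] := H1 Qz; have [_ a2] := H2 Qz; have [_ b1] := H3 Qz; have [b2 _] := H4 Qz.
  rewrite /f /g; under eq_fun do rewrite !expr2; rewrite !expr2.
  by apply: cvgD; apply: cvgM; (exact: cvgD a1 b2 || exact: cvgB a2 b1).
- move=> n Nn.
  under eq_integral => z _ do rewrite fE EFinD.
  rewrite integralD//; last 2 first.
  + exact: (bounded_measurable_integrable _ _ _ _ (bounded_quotient_energy (s n))).
  + exact: (bounded_measurable_integrable _ _ _ _ (b2D n)).
  rewrite EFinD; apply: leeD.
    by apply: quotient_energy_le => //; exact/ltW/HN.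
  have iD := bounded_measurable_integrable 0 1 c (c + tau.2) (b2D n).
  rewrite -[leLHS](fineK (@integrable_fin_num _ _ _ leb2 _ mQ _ iD)) lee_fin.
  have := @RintegralZl _ _ _ leb2 _ _ 2 mQ (bounded_measurable_integrable 0 1 c (c + tau.2) (bD n)).
  rewrite /Rintegral => ->.
  have := quotient_det_mean (lt0r_neq0 (s0 n)); rewrite /Rintegral => ->.
  exact: lexx.
Qed.

(** The enlarged cells decrease to the closed cell, and the density on the enlargement by 1
    dominates. A point outside the closed cell lies outside all small enlargements. *)
Lemma energy_cvg : energy n.+1%:R^-1 @[n --> \oo] --> \int[leb2]_(z in Q) HS z.
Proof.
pose s n : R := n.+1%:R^-1.
have s0 n : 0 < s n by rewrite invr_gt0.
have s1 n : s n <= 1 by rewrite invf_le1// ler1n.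
pose f n := (EFin \o HS) \_ (Qe (s n)).
pose f0 := (EFin \o HS) \_ Q.
pose gg := (EFin \o HS) \_ (Qe 1).
have mHS : measurable_fun [set: R * R] (EFin \o HS).
  by apply/measurable_EFinP; exact: measurable_energy_density.
have H0 z : (0 <= (HS z)%:E)%E by rewrite lee_fin energy_density_ge0.
have [|||||_ _ +] := @dominated_convergence _ _ _ leb2 setT measurableT f f0 gg.
- by move=> n; apply/(measurable_restrictT _ (mQe _)); exact: measurable_funTS.
- by apply/(measurable_restrictT _ mQ); exact: measurable_funTS.
- apply: aeW => z _.
  have [Qz|nQz] := pselect (Q z).
    rewrite /f /f0; apply: cvg_near_cst; apply: nearW => n; rewrite !patchE !mem_set//.
    have [/=] := Qz; rewrite !in_itv /= => /andP[h1 h2] /andP[h3 h4].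
    by have := s0 n; split; rewrite /= ?in_itv /=; apply/andP; split; lra.
  have far (e : R) : 0 < e -> (forall t : R, t < e -> ~ Qe t z) ->
      f n z @[n --> \oo] --> f0 z.
    move=> e0 He; have [N _ HN] := near_infty_natSinv_lt (PosNum e0).
    rewrite /f /f0; apply: cvg_near_cst; exists N => // n /= Nn; rewrite !patchE !memNset//.
    by apply: He; exact: HN.
  have [z1|z1] := ltP z.1 0.
    apply: (far (- z.1)); first by rewrite oppr_gt0.
    by move=> t te [/=]; rewrite in_itv /= => /andP[]; lra.
  have [z2|z2] := ltP 1 z.1.
    apply: (far (z.1 - 1)); first by rewrite subr_gt0.
    by move=> t te [/=]; rewrite in_itv /= => /andP[]; lra.
  have [z3|z3] := ltP z.2 c.
    apply: (far (c - z.2)); first by rewrite subr_gt0.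
    by move=> t te [/= _]; rewrite in_itv /= => /andP[]; lra.
  have [z4|z4] := ltP (c + tau.2) z.2.
    apply: (far (z.2 - (c + tau.2))); first by rewrite subr_gt0.
    by move=> t te [/= _]; rewrite in_itv /= => /andP[]; lra.
  by exfalso; apply: nQz; split; rewrite /= in_itv /= ?z1 ?z3.
- apply/(@integrable_restrict _ _ _ leb2 _ (mQe 1) _ measurableT (EFin \o HS)).
  by rewrite setTI; exact: energy_integrable.
- apply: aeW => z n _; rewrite /f /gg !patchE.
  case: ifPn => [|_]; last first.
    by rewrite [leLHS]abse0; case: ifP => // _; exact: H0.
  rewrite inE => -[/=]; rewrite !in_itv /= => /andP[h1 h2] /andP[h3 h4].
  rewrite mem_set; first by rewrite /= ger0_norm// energy_density_ge0.
  by have := s1 n; split; rewrite /= ?in_itv /=; apply/andP; split; lra.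
rewrite [X in _ --> X -> _](_ : _ = (\int[leb2]_(z in Q) HS z)%:E); last first.
  rewrite /f0 -integral_mkcond /Rintegral fineK//.
  exact: (@integrable_fin_num _ _ _ leb2 _ mQ (EFin \o HS) (energy_integrable _ _ _ _)).
move=> /fine_cvg; apply: cvg_trans; apply: near_eq_cvg; apply: nearW => n /=.
by rewrite /f -integral_mkcond.
Qed.

(** With [E0] and [E1] the cell integrals of [HS] and [2 J], the chain is [|L| ^ 2 tau.2 <= E0 <=
    kappa E1 / 2 <= kappa det L tau.2]. In the last step [E0] cancels from both sides of
    [energy_det_le] once [eps] tends to 0. *)
Lemma energy_le (kappa : R) : 0 < kappa ->
  {ae leb2, forall z, HS z <= kappa * J z} ->
  (l1 ^+ 2 + l2 ^+ 2) + (m1 ^+ 2 + m2 ^+ 2) <= kappa * (l1 * m2 - m1 * l2).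
Proof.
move=> k0 HJ.
pose E0 := \int[leb2]_(z in Q) HS z.
pose E1 := \int[leb2]_(z in Q) (2 * J z).
have iE := energy_integrable 0 1 c (c + tau.2).
have iJ := det_integrable.
have le1 : E1 <= 2 * ((l1 * m2 - m1 * l2) * tau.2).
  rewrite -(lerD2l E0).
  have <- : \int[leb2]_(z in Q) (HS z + 2 * J z) = E0 + E1 by exact: RintegralD.
  have cvgE : energy n.+1%:R^-1 + 2 * ((l1 * m2 - m1 * l2) * tau.2) @[n --> \oo] -->
      E0 + 2 * ((l1 * m2 - m1 * l2) * tau.2).
    by apply: cvgD; [exact: energy_cvg|exact: cvg_cst].
  rewrite -(cvg_lim _ cvgE)//; apply: limr_ge; first by apply/cvg_ex; eexists; exact: cvgE.
  by apply: nearW => n; apply: energy_det_le; rewrite invr_gt0.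
have le0 : ((l1 ^+ 2 + l2 ^+ 2) + (m1 ^+ 2 + m2 ^+ 2)) * tau.2 <= E0.
  rewrite /E0 -(cvg_lim _ energy_cvg)//; apply: limr_ge.
    by apply/cvg_ex; eexists; exact: energy_cvg.
  by apply: nearW => n; apply: linear_energy_le; rewrite invr_gt0.
have le2 : 2 * E0 <= kappa * E1.
  (* The hypothesis holds only almost everywhere, and [J] may be negative on a null set. [G]
     dominates [2 HS] everywhere and agrees with the right-hand integrand almost everywhere. *)
  pose G z := Num.max (2 * HS z) (kappa * (2 * J z)).
  have mH2 : measurable_fun [set: R * R] (fun z => 2 * HS z).
    by apply: measurable_funM; [exact: measurable_cst|exact: measurable_energy_density].
  have mJ2 : measurable_fun [set: R * R] (fun z => kappa * (2 * J z)).
    apply: measurable_funM; first exact: measurable_cst.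
    by apply: measurable_funM; [exact: measurable_cst|exact: measurable_det_density].
  have mG : measurable_fun [set: R * R] G by exact: measurable_maxr.
  have i1 : leb2.-integrable Q (EFin \o (fun z => 2 * HS z)).
    by have := @integrableZl _ _ _ leb2 _ mQ 2 _ iE; apply: eq_integrable.
  have i2 : leb2.-integrable Q (EFin \o (fun z => kappa * (2 * J z))).
    by have := @integrableZl _ _ _ leb2 _ mQ kappa _ iJ; apply: eq_integrable.
  have <- : \int[leb2]_(z in Q) (2 * HS z) = 2 * E0 by exact: RintegralZl.
  have <- : \int[leb2]_(z in Q) (kappa * (2 * J z)) = kappa * E1 by exact: RintegralZl.
  rewrite -lee_fin /Rintegral !fineK; [|exact: integrable_fin_num..].
  apply: (@le_trans _ _ (\int[leb2]_(z in Q) (G z)%:E)%E); last first.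
    rewrite le_eqVlt; apply/orP; left; apply/eqP.
    apply: ae_eq_integral => //.
    + by apply/measurable_EFinP; exact: measurable_funTS.
    + by apply/measurable_EFinP; exact: measurable_funTS.
    apply: ae_mono HJ => z Hz _; rewrite /= /G; congr EFin; apply: max_idPr.
    by rewrite mulrCA ler_pM2l.
  - apply: ge0_le_integral => //.
    + by move=> z _; rewrite lee_fin mulr_ge0// energy_density_ge0.
    + by apply/measurable_EFinP; exact: measurable_funTS.
    + by apply/measurable_EFinP; exact: measurable_funTS.
    + by move=> z _; rewrite /= lee_fin le_max lexx.
rewrite -(ler_pM2r t0); apply: le_trans le0 _.
have := ler_wpM2l (ltW k0) le1.
by move: le2; move: (E0) (E1) => x y; lra.
Qed.

End Energy.

(** * Affine maps *)

Section LinearBound.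
Variable R : realType.
Local Notation leb2 := (@lebesgue_measure R \x @lebesgue_measure R)%E.
Implicit Types (tau rho : R * R).

(** The pointwise inequality of [dilatation_hs] passes to the linear part with the same constant
    [K + K^-1]. Unimodularity is still up to sign. *)
Lemma quasiconformal_linear_part K tau rho F : 0 < tau.2 -> 0 < rho.2 -> 1 <= K ->
  quasiconformal K tau rho F ->
  exists (a b c d : int) (e f : R * R),
  [/\ (a * d - b * c) ^+ 2 = 1, e = lattice_point rho a b,
      directional e f tau = lattice_point rho c d &
      hs e f <= (K + K^-1) * jacobian_det e f].
Proof.
move=> t0 r0 K1 [hF [Fx [Fy [s1 s2 J0 dil]]]].
have [a [b [c [d [e [f [M [abcd ee ef per bnd]]]]]]]] := torus_homeo_linear t0 r0 hF.
exists a, b, c, d, e, f; split => //.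
pose U := punctured_plane tau.
have oU : open U := open_punctured_plane t0.
have cF : {in U, continuous F}.
  by have [G [_ _ + _ _]] := hF; rewrite continuous_open_subspace.
have [c1 c2] := continuous_components cF.
have [per1 per2] := period_components per; have [bnd1 bnd2] := bound_components bnd.
have K0 : 0 < K by rewrite (lt_le_trans _ K1).
have k0 : 0 < K + K^-1 by rewrite addr_gt0// invr_gt0.
have HJ : {ae leb2, forall z, energy_density tau (fun z => (Fx z).1) (fun z => (Fy z).1)
    (fun z => (Fx z).2) (fun z => (Fy z).2) z <= (K + K^-1) *
    det_density tau (fun z => (Fx z).1) (fun z => (Fy z).1)
    (fun z => (Fx z).2) (fun z => (Fy z).2) z}.
  apply: ae_mono (ae_and J0 dil) => z [Jz dz].
  rewrite /energy_density /det_density /pU /qU !patchE.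
  have [Uz|nUz] := pselect (U z); last first.
    by rewrite memNset//= expr0n /= !mul0r !addr0 subr0 mulr0.
  rewrite mem_set//; have := dilatation_hs K1 (Jz Uz) (dz Uz).
  rewrite /hs /jacobian_det; lra.
have := energy_le 0 t0 c1 c2 per1 per2 bnd1 bnd2 s1 s2 k0 HJ.
rewrite /hs /jacobian_det [e.2 * f.1]mulrC; lra.
Qed.

End LinearBound.

Section AffineMaps.
Variable R : realType.
Local Notation mu := (@lebesgue_measure R).
Local Notation leb2 := (@lebesgue_measure R \x @lebesgue_measure R)%E.
Implicit Types (tau rho : R * R).

Lemma linear_sobolev (U : set (R * R)) (l1 l2 : R) : measurable U ->
  sobolev_derivatives U (fun z => z.1 * l1 + z.2 * l2) (fun=> l1) (fun=> l2).
Proof.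
move=> mU; split.
- by split; exact: measurable_cst.
- move=> r.
  apply: (@integrableS _ _ _ leb2 (`[- r, r]%classic `*` `[- r, r]%classic : set (R * R))).
  + exact: measurable_rect.
  + apply: measurableI => //.
    exact: measurable_disk.
  + move=> z [_ /= zr]; have [z1 z2] := ler_norm_cmod z; rewrite !in_itv /= -!ler_norml.
    by rewrite (le_trans z1 zr) (le_trans z2 zr).
  apply: (@rect_integrable _ _ _ _ _ (fun=> l1 ^+ 2 + l2 ^+ 2) `|l1 ^+ 2 + l2 ^+ 2|) => //.
- apply: aeW => y a b ab _ /=.
  by rewrite Rintegral_cst//= lebesgue_measure_segment//=; ring.
- apply: aeW => x a b ab _ /=.
  by rewrite Rintegral_cst//= lebesgue_measure_segment//=; ring.
Qed.

(** The image of [i] under the real-linear map that fixes [1] and sends [tau] to [rho]. *)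
Definition affine_col tau rho : R * R := ((rho.1 - tau.1) / tau.2, rho.2 / tau.2).
Definition affine tau rho : R * R -> R * R := directional (1, 0) (affine_col tau rho).

Lemma affine_lattice tau rho m n : 0 < tau.2 ->
  affine tau rho (lattice_point tau m n) = lattice_point rho m n.
Proof.
move=> t0; rewrite /affine /directional /affine_col /lattice_point.
have tn : tau.2 != 0 by rewrite gt_eqF.
by apply: injective_projections => /=; field.
Qed.

Lemma affineK tau rho : 0 < tau.2 -> 0 < rho.2 -> cancel (affine tau rho) (affine rho tau).
Proof.
move=> t0 r0 z; rewrite /affine /directional /affine_col.
have tn : tau.2 != 0 by rewrite gt_eqF.
have rn : rho.2 != 0 by rewrite gt_eqF.
by apply: injective_projections => /=; field; rewrite ?tn ?rn.
Qed.

Lemma affineB tau rho z w : affine tau rho (z - w) = affine tau rho z - affine tau rho w.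
Proof. by apply: injective_projections; rewrite /affine /directional /=; ring. Qed.

Lemma lattice_affine tau rho z : 0 < tau.2 -> 0 < rho.2 ->
  lattice tau z <-> lattice rho (affine tau rho z).
Proof.
move=> t0 r0; split.
  move=> /latticeE[m [n ->]]; rewrite affine_lattice//.
  exact: lattice_pointP.
move=> /latticeE[m [n E]]; apply/latticeE; exists m, n.
by rewrite -[LHS](affineK t0 r0) E affine_lattice.
Qed.

Lemma continuous_directional (e f : R * R) : continuous (directional e f).
Proof.
move=> z; have c1 : (fun w : R * R => w.1) w @[w --> z] --> z.1 by exact: cvg_fst.
have c2 : (fun w : R * R => w.2) w @[w --> z] --> z.2 by exact: cvg_snd.
exact: (cvg_pair (cvgD (cvgM c1 (cvg_cst e.1)) (cvgM c2 (cvg_cst f.1)))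
  (cvgD (cvgM c1 (cvg_cst e.2)) (cvgM c2 (cvg_cst f.2)))).
Qed.

Lemma affine_torus_homeo tau rho : 0 < tau.2 -> 0 < rho.2 ->
  torus_homeo tau rho (affine tau rho).
Proof.
move=> t0 r0; exists (affine rho tau); split.
- move=> z Uz; split; last exact: affineK.
  by move: Uz; apply: contra_not => /(lattice_affine _ t0 r0).
- move=> z Uz; split; last exact: affineK.
  by move: Uz; apply: contra_not => /(lattice_affine _ r0 t0).
- by apply: continuous_subspaceT; exact: continuous_directional.
- by apply: continuous_subspaceT; exact: continuous_directional.
- by move=> z w _ _; rewrite -affineB; exact: lattice_affine.
Qed.

Lemma affine_quasiconformal tau rho K : 0 < tau.2 -> 0 < rho.2 -> 1 <= K ->
  hs (1, 0) (affine_col tau rho) = (K + K^-1) * jacobian_det (1, 0) (affine_col tau rho) ->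
  quasiconformal K tau rho (affine tau rho).
Proof.
move=> t0 r0 K1 hK; split; first exact: affine_torus_homeo.
have mU := open_measurable2 (open_punctured_plane t0).
have J0 : 0 < jacobian_det (1, 0) (affine_col tau rho).
  by rewrite /jacobian_det /= mul1r mul0r subr0 divr_gt0.
exists (fun=> (1, 0)), (fun=> affine_col tau rho); split.
- exact: linear_sobolev.
- exact: linear_sobolev.
- by apply: aeW => z _; exact: ltW.
- by apply: aeW => z _; exact: hs_dilatation.
Qed.

(** Makes the set under the infimum in [teichmuller_dist] nonempty. [K] solves
    [K + 1 / K = |L| ^ 2 / det L] for the affine map, which is possible because the right-hand side
    is at least 2. *)
Lemma quasiconformal_exists tau rho : 0 < tau.2 -> 0 < rho.2 ->
  exists K, 1 <= K /\ exists F, quasiconformal K tau rho F.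
Proof.
move=> t0 r0.
pose e : R * R := (1, 0); pose f := affine_col tau rho.
have J0 : 0 < jacobian_det e f.
  by rewrite /jacobian_det /= mul1r mul0r subr0 divr_gt0.
have [|K [K1 KK]] := @dilatation_exists R (hs e f / jacobian_det e f).
  rewrite ler_pdivlMr//; move: (f) => g; rewrite /hs /jacobian_det /= !expr0n /=.
  by have := sqr_ge0 (1 - g.2); have := sqr_ge0 g.1; nra.
exists K; split => //; exists (affine tau rho); apply: affine_quasiconformal => //.
by rewrite KK divfK// gt_eqF.
Qed.

End AffineMaps.

(** * The nearest rectangular torus *)

(** Otherwise [q ^ 2 >= (P + r) ^ 2 + 2 (P + r) + 1 > 4 P r + 1]. *)
Lemma form_coef_le (P q r : int) : 0 <= P -> 0 <= q -> 0 <= r ->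
  q * q = 4 * (P * r) + 1 -> 0 < P + r -> q <= P + r.
Proof.
move=> P0 q0 r0 E Pr; rewrite leNgt; apply/negP => lt.
have : (P + r + 1) * (P + r + 1) <= q * q.
  by apply: ler_pM; rewrite ?addr_ge0//; lia.
have := sqr_ge0 (P - r); rewrite E; nia.
Qed.

Section Minimum.
Variable R : realType.
Implicit Types (tau rho : R * R).

(* The form [A B s - (A D + B C) x + C D] has discriminant [1], hence an odd
   middle coefficient. *)
Lemma unimodular_form_ge (A B C D : int) (x s : R) :
  A * D - B * C = 1 -> `|x| <= 1 / 2 -> 1 <= s ->
  `|x| <= `|(A * B)%:~R * s - (A * D + B * C)%:~R * x + (C * D)%:~R|.
Proof.
move=> det hx hs.
set P := A * B; set q := A * D + B * C; set r := C * D.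
have E : q * q = 4 * (P * r) + 1.
  (* The discriminant identity [(A D + B C) ^ 2 = 4 A B C D + (A D - B C) ^ 2]. It forces
     [P r >= 0], since [4 P r + 1] is a square. *)
  transitivity (4 * (P * r) + (A * D - B * C) * (A * D - B * C)); last by rewrite det.
  by rewrite /q /P /r; ring.
have Pr : 0 <= P * r by have := sqr_ge0 q; rewrite expr2 E; lia.
have E' : `|q| * `|q| = 4 * (`|P| * `|r|) + 1.
  by rewrite -!normrM E (ger0_norm Pr) ger0_norm//; lia.
(* If both outer coefficients vanish, the discriminant leaves [q] equal to 1 or -1, and the form is
   [x] up to sign. *)
have [P0|Pn] := eqVneq (`|P| + `|r|) 0.
  have [PP rr] : P = 0 /\ r = 0 by split; lia.
  rewrite PP rr mul0r sub0r addr0 normrN normrM.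
  have -> : `|q%:~R : R| = 1; last by rewrite mul1r.
  have : `|q| * `|q| = 1 by rewrite E' PP rr normr0 mul0r mulr0.
  rewrite -intr_norm => qq; suff -> : `|q| = 1 by [].
  by have := normr_ge0 q; nia.
have m0 : 0 < `|P| + `|r| by rewrite lt_neqAle eq_sym Pn addr_ge0.
have qm := form_coef_le (normr_ge0 _) (normr_ge0 _) (normr_ge0 _) E' m0.
have m1 : (1 : R) <= (`|P| + `|r|)%:~R by rewrite (_ : 1 = 1%:~R)// ler_int; lia.
have qmR : `|q%:~R : R| <= (`|P| + `|r|)%:~R by rewrite -intr_norm ler_int.
(* [P] and [r] do not have opposite signs, so nothing cancels, and [s >= 1]. *)
have PrR : (`|P| + `|r|)%:~R <= `|P%:~R * s + r%:~R : R|.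
  rewrite intrD !intr_norm.
  have [Pp|Pp] := leP 0 P.
    have [rp|rp] := leP 0 r.
      have p1 : 0 <= P%:~R :> R by rewrite ler0z.
      have r1 : 0 <= r%:~R :> R by rewrite ler0z.
      by rewrite !ger0_norm ?addr_ge0 ?mulr_ge0//; [rewrite lerD2r ler_peMr|lra].
    have -> : P = 0 by nia.
    by rewrite mul0r normr0 !add0r.
  have [rp|rp] := leP r 0.
    have p1 : P%:~R < 0 :> R by rewrite ltrz0.
    have r1 : r%:~R <= 0 :> R by rewrite lerz0.
    rewrite (ltr0_norm p1) (ler0_norm r1) ler0_norm; last by nra.
    by nra.
  by exfalso; nia.
(* With [m = |P| + |r|], the value is at least [m - m |x|], hence at least [1 - |x|], and
   [|x| <= 1 / 2]. *)
have := lerB_normD (P%:~R * s + r%:~R) (- (q%:~R * x)).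
rewrite normrN normrM addrAC.
have := ler_wpM2r (normr_ge0 x) qmR.
move: hx PrR m1; move: (_%:~R) `|x| => m y.
by move: `|_ + _| `|_ - _ + _| (`|_| * _) => X Y Z; nra.
Qed.

(** [N1] and [N2] are the squared moduli of [A tau - C] and [B tau - D]. By Lagrange's identity
    their product is [X ^ 2 + tau.2 ^ 2], where [X] is the form of [unimodular_form_ge], so it is at
    least [|tau| ^ 2]. The arithmetic-geometric mean inequality concludes. *)
Lemma lattice_form_ge tau (t : R) (A B C D : int) : modular_domain tau -> 0 < t ->
  A * D - B * C = 1 ->
  2 * t * cmod tau <= (A%:~R * tau.1 - C%:~R) ^+ 2 + A%:~R ^+ 2 * tau.2 ^+ 2 +
    t ^+ 2 * ((B%:~R * tau.1 - D%:~R) ^+ 2 + B%:~R ^+ 2 * tau.2 ^+ 2).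
Proof.
move=> [y0 c1 x1] t0 det.
pose N1 := (A%:~R * tau.1 - C%:~R) ^+ 2 + A%:~R ^+ 2 * tau.2 ^+ 2.
pose N2 := (B%:~R * tau.1 - D%:~R) ^+ 2 + B%:~R ^+ 2 * tau.2 ^+ 2.
rewrite -[leRHS]/(N1 + t ^+ 2 * N2).
have sq2 (u v w : R) : 0 <= u ^+ 2 + v ^+ 2 * w ^+ 2.
  by rewrite addr_ge0 ?sqr_ge0// mulr_ge0 ?sqr_ge0.
have N10 : 0 <= N1 := sq2 _ _ _; have N20 : 0 <= N2 := sq2 _ _ _.
have hx : `|tau.1| <= 1 / 2 by rewrite ler_norml; lra.
have s1 : 1 <= tau.1 ^+ 2 + tau.2 ^+ 2.
  by rewrite -cmod_sqr -(expr1n _ 2) ler_pXn2r// ?nnegrE ?cmod_ge0.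
have := unimodular_form_ge det hx s1; set X := (X in _ <= `|X|) => xX.
have NN : N1 * N2 = X ^+ 2 + tau.2 ^+ 2.
  have -> : tau.2 ^+ 2 = (A * D - B * C)%:~R ^+ 2 * tau.2 ^+ 2 by rewrite det mulr1z expr1n mul1r.
  by rewrite /N1 /N2 /X !(intrD, intrM, intrB); ring.
have XX : tau.1 ^+ 2 <= X ^+ 2.
  by rewrite -(real_normK (num_real tau.1)) -(real_normK (num_real X)) ler_pXn2r.
rewrite -(@ler_pXn2r _ 2)// ?nnegrE ?mulr_ge0 ?cmod_ge0 ?(ltW t0)//; last first.
  by rewrite addr_ge0// mulr_ge0// sqr_ge0.
rewrite exprMn cmod_sqr.
have := sqr_ge0 (N1 - t ^+ 2 * N2).
have : 4 * t ^+ 2 * (tau.1 ^+ 2 + tau.2 ^+ 2) <= 4 * t ^+ 2 * (N1 * N2).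
  by rewrite NN; apply: ler_wpM2l; [rewrite mulr_ge0 ?sqr_ge0|rewrite lerD2r].
by nra.
Qed.

(** Following the linear part of [F] by that of the conformal map from [rho] to [i t] multiplies
    both [hs] and the jacobian by [n0], so the ratio can be computed for a target lattice with basis
    [1], [i t]. There it is the quantity bounded in [lattice_form_ge]. *)
Lemma quasiconformal_rectangular_ge tau rho K F : modular_domain tau ->
  rectangular rho -> 1 <= K -> quasiconformal K tau rho F ->
  2 * cmod tau / tau.2 <= K + K^-1.
Proof.
move=> mt [r0 [t [t1 [F0 [F0' [h0 dF0 cF0]]]]]] K1 qF.
have [y0 _ _] := mt; have {}t0 : 0 < t by lra.
have {}r0 : 0 < rho.2 by [].
have [a [b [c [d [e [f [det1 ee ef hJ]]]]]]] := quasiconformal_linear_part y0 r0 K1 qF.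
have t0' : 0 < ((0, t) : R * R).2 by [].
have [a' [b' [c' [d' [e0 [f0 [M [det2 ee0 ef0 per bnd]]]]]]]] := torus_homeo_linear r0 t0' h0.
have f0E := conformal_linear_part r0 (fun z Uz => (dF0 z Uz).1) cF0 per bnd.
(* The composite linear map sends [1] to [A + B i t] and [tau] to [C + D i t]. *)
pose A := a * a' + b * c'; pose B := a * b' + b * d'.
pose C := c * a' + d * c'; pose D := c * b' + d * d'.
have det : (A * D - B * C) ^+ 2 = 1.
  by rewrite -[RHS]mulr1 -{1}det1 -det2 /A /B /C /D; ring.
pose n0 := e0.1 ^+ 2 + e0.2 ^+ 2.
have n00 : 0 < n0.
  rewrite lt_neqAle addr_ge0 ?sqr_ge0// andbT eq_sym /n0.
  apply: contra_eq_neq det2 => /eqP; rewrite paddr_eq0 ?sqr_ge0// !sqrf_eq0 ee0 /lattice_point /=.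
  rewrite mul0r addr0 mulf_eq0 (gt_eqF t0) orFb !intr_eq0 => /andP[/eqP -> /eqP ->].
  by rewrite !mul0r subrr expr0n.
have fy1 : tau.2 * f.1 = c%:~R + d%:~R * rho.1 - tau.1 * e.1.
  by move: ef => /(congr1 fst) /=; rewrite /directional /lattice_point /=; lra.
have fy2 : tau.2 * f.2 = d%:~R * rho.2 - tau.1 * e.2.
  by move: ef => /(congr1 snd) /=; rewrite /directional /lattice_point /=; lra.
have e1E : e.1 = a%:~R + b%:~R * rho.1 by rewrite ee /= mulrC.
have e2E : e.2 = b%:~R * rho.2 by rewrite ee /= mulrC.
have a'E : a'%:~R = e0.1 by rewrite ee0 /lattice_point /= mul0r addr0.
have b'E : b'%:~R * t = e0.2 by rewrite ee0 /lattice_point /= mulrC.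
have c'E : c'%:~R = e0.1 * rho.1 - e0.2 * rho.2.
  by move: ef0 => /(congr1 fst) /=; rewrite f0E /directional /lattice_point /= mul0r addr0; lra.
have d'E : d'%:~R * t = e0.1 * rho.2 + e0.2 * rho.1.
  by move: ef0 => /(congr1 snd) /=; rewrite f0E /directional /lattice_point /=; lra.
have AE : A%:~R = e0.1 * e.1 - e0.2 * e.2.
  by rewrite /A intrD !intrM a'E c'E e1E e2E; ring.
have BE : B%:~R * t = e0.1 * e.2 + e0.2 * e.1.
  transitivity (a%:~R * (b'%:~R * t) + b%:~R * (d'%:~R * t)); first by rewrite /B intrD !intrM; ring.
  by rewrite b'E d'E e1E e2E; ring.
have CE : C%:~R = e0.1 * (c%:~R + d%:~R * rho.1) - e0.2 * (d%:~R * rho.2).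
  by rewrite /C intrD !intrM a'E c'E; ring.
have DE : D%:~R * t = e0.1 * (d%:~R * rho.2) + e0.2 * (c%:~R + d%:~R * rho.1).
  transitivity (c%:~R * (b'%:~R * t) + d%:~R * (d'%:~R * t)); first by rewrite /D intrD !intrM; ring.
  by rewrite b'E d'E; ring.
have form : n0 * tau.2 ^+ 2 * hs e f =
    (A%:~R * tau.1 - C%:~R) ^+ 2 + A%:~R ^+ 2 * tau.2 ^+ 2 +
    t ^+ 2 * ((B%:~R * tau.1 - D%:~R) ^+ 2 + B%:~R ^+ 2 * tau.2 ^+ 2).
  transitivity (n0 * (tau.2 ^+ 2 * (e.1 ^+ 2 + e.2 ^+ 2) + (tau.2 * f.1) ^+ 2 + (tau.2 * f.2) ^+ 2)).
    by rewrite /hs; ring.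
  rewrite fy1 fy2 AE CE.
  transitivity (((e0.1 * e.1 - e0.2 * e.2) * tau.1 - (e0.1 * (c%:~R + d%:~R * rho.1) - e0.2 * (d%:~R * rho.2))) ^+ 2 +
    (e0.1 * e.1 - e0.2 * e.2) ^+ 2 * tau.2 ^+ 2 +
    ((B%:~R * t * tau.1 - D%:~R * t) ^+ 2 + (B%:~R * t) ^+ 2 * tau.2 ^+ 2)); last by ring.
  by rewrite BE DE /n0; ring.
have jac : n0 * tau.2 * jacobian_det e f = t * (A * D - B * C)%:~R.
  transitivity (A%:~R * (D%:~R * t) - B%:~R * t * C%:~R).
    rewrite AE BE CE DE.
    transitivity (n0 * (e.1 * (tau.2 * f.2) - e.2 * (tau.2 * f.1))); first by rewrite /jacobian_det; ring.
    by rewrite fy1 fy2 /n0; ring.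
  by rewrite intrB !intrM; ring.
have Kp : 0 < K := lt_le_trans ltr01 K1.
have k0 : 0 < K + K^-1 by rewrite addr_gt0 ?invr_gt0.
have hJ' : n0 * tau.2 ^+ 2 * hs e f <= (K + K^-1) * tau.2 * (t * (A * D - B * C)%:~R).
  rewrite -jac (_ : _ * _ * (_ * _ * _) = n0 * tau.2 ^+ 2 * ((K + K^-1) * jacobian_det e f)); last by ring.
  by rewrite ler_wpM2l// mulr_ge0 ?sqr_ge0 ?ltW.
(* Orientation is decided here: for determinant -1 the right-hand side of [hJ'] would be negative,
   while the left-hand side is a sum of squares. *)
have det_1 : A * D - B * C = 1.
  move/eqP : det; rewrite sqrf_eq1 => /orP[/eqP//|/eqP dN].
  exfalso; move: hJ'; rewrite dN form mulrN1z mulrN mulrN leNgt => /negP; apply.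
  apply: (@lt_le_trans _ _ 0); first by rewrite oppr_lt0 !mulr_gt0.
  have sq2 (u v w : R) : 0 <= u ^+ 2 + v ^+ 2 * w ^+ 2.
    by rewrite addr_ge0 ?sqr_ge0// mulr_ge0 ?sqr_ge0.
  by apply: addr_ge0 => //; rewrite mulr_ge0 ?sqr_ge0.
move: hJ'; rewrite form det_1 mulr1 => hJ'.
have := le_trans (lattice_form_ge mt t0 det_1) hJ'.
rewrite ler_pdivrMr// => H.
by rewrite -(ler_pM2l t0); move: H; lra.
Qed.

Lemma cmod_addr_gt0 tau : 0 < tau.2 -> 0 < cmod tau + `|tau.1|.
Proof.
move=> y0; have : 0 < cmod tau ^+ 2.
  by rewrite cmod_sqr ltr_wpDl ?sqr_ge0// exprn_gt0.
rewrite exprn_even_gt0//= => cn; rewrite ltr_pwDl// lt_neqAle eq_sym cn; exact: cmod_ge0.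
Qed.

(* The dilatation of the affine map onto the torus of [i * cmod tau]. *)
Definition least_dilatation tau : R := (cmod tau + `|tau.1|) / tau.2.

(** Since [(|tau| + |x|) (|tau| - |x|) = y ^ 2], the inverse is [(|tau| - |x|) / y]. *)
Lemma least_dilatation_sum tau : 0 < tau.2 ->
  least_dilatation tau + (least_dilatation tau)^-1 = 2 * cmod tau / tau.2.
Proof.
move=> y0; rewrite /least_dilatation.
have c2 := cmod_sqr tau; rewrite -(real_normK (num_real tau.1)) in c2.
have c0 := cmod_addr_gt0 y0.
apply: (mulIf (lt0r_neq0 y0)); rewrite divfK ?gt_eqF//.
rewrite mulrDl divfK ?gt_eqF// invf_div.
apply: (mulIf (lt0r_neq0 c0)); rewrite mulrDl mulrAC divfK ?gt_eqF//.
by move: c2; move: (cmod tau) `|tau.1| => u v c2; nra.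
Qed.

Lemma least_dilatation_ge1 tau : modular_domain tau -> 1 <= least_dilatation tau.
Proof.
move=> [y0 _ _]; rewrite /least_dilatation ler_pdivlMr// mul1r.
apply: (@le_trans _ _ (cmod tau)); last by rewrite lerDl.
by rewrite -(@ler_pXn2r _ 2)// ?nnegrE ?cmod_ge0 ?(ltW y0)// cmod_sqr lerDr sqr_ge0.
Qed.

Lemma rectangular_imaginary (s : R) : 1 <= s -> rectangular (0, s).
Proof.
move=> s1; split; first by rewrite /upper_half_plane /=; lra.
exists s; split => //; exists id, (fun=> (1, 0)); split.
- exists id; split => //.
  + by apply: continuous_subspaceT => z; exact: cvg_id.
  + by apply: continuous_subspaceT => z; exact: cvg_id.
- move=> z _; split; last by rewrite xpair_eqE oner_eq0.
  have -> : cmul (1, 0) = (idfun : R * R -> R * R).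
    by apply: funext => w; apply: injective_projections; rewrite /cmul /=; ring.
  exact: is_diff_id.
- by apply: continuous_subspaceT => z; exact: cvg_cst.
Qed.

Lemma teichmuller_dist_min tau : modular_domain tau ->
  is_minimum (teichmuller_dist tau @` rectangular) (ln (least_dilatation tau)).
Proof.
move=> mt; have [y0 c1 _] := mt.
have k1 := least_dilatation_ge1 mt.
have kS := least_dilatation_sum y0.
have low rho K : rectangular rho -> 1 <= K /\ (exists F, quasiconformal K tau rho F) ->
    least_dilatation tau <= K.
  move=> rr [K1 [F qF]]; apply: dilatation_mono => //; rewrite kS.
  exact: quasiconformal_rectangular_ge rr K1 qF.
have inf_ge rho : rectangular rho ->
    least_dilatation tau <= inf [set K | 1 <= K /\ exists F, quasiconformal K tau rho F].
  move=> rr; apply: lb_le_inf; last by move=> K; exact: low rr.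
  by have [r0 _] := rr; have [K HK] := quasiconformal_exists y0 r0; exists K.
have kp : 0 < least_dilatation tau by lra.
split; last first.
  move=> _ [rho rr <-]; rewrite /teichmuller_dist ler_ln ?posrE//; first exact: inf_ge.
  exact: lt_le_trans (inf_ge _ rr).
(* The condition [1 <= cmod tau] of the modular domain is what places [i * cmod tau] among the
   rectangular tori. *)
have rr := rectangular_imaginary c1.
exists (0, cmod tau) => //; rewrite /teichmuller_dist; congr ln.
apply/eqP; rewrite eq_le inf_ge// andbT; apply: ge_inf.
  by exists 1 => K /= [].
split => //; exists (affine tau (0, cmod tau)).
have cp : 0 < cmod tau by lra.
apply: affine_quasiconformal => //; rewrite kS /hs /jacobian_det /affine_col /= expr1n expr0n /=.
have c2 := cmod_sqr tau.
have yn : tau.2 != 0 by rewrite gt_eqF.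
transitivity ((tau.2 ^+ 2 + tau.1 ^+ 2 + cmod tau ^+ 2) / tau.2 ^+ 2); first by field.
rewrite (_ : tau.2 ^+ 2 + tau.1 ^+ 2 + cmod tau ^+ 2 = 2 * cmod tau ^+ 2); last by rewrite c2; ring.
by field.
Qed.

End Minimum.

(** * Distribution of the distance *)

Section HyperbolicFunctions.
Variable R : realType.
Local Notation mu := (@lebesgue_measure R).
Local Notation sinh := (@sinh R).
Local Notation cosh := (@cosh R).
Implicit Types (r s x y : R).

Definition arsinh x : R := ln (x + Num.sqrt (x ^+ 2 + 1)).

Lemma expRNr r : expR r * expR (- r) = 1.
Proof. by rewrite -expRD subrr expR0. Qed.

Lemma cosh2_sinh2 r : cosh r ^+ 2 = sinh r ^+ 2 + 1.
Proof. by rewrite /cosh /sinh; have := expRNr r; move: (expR r) (expR _) => a b; nra. Qed.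

Lemma cosh_gt0 r : 0 < cosh r.
Proof. by rewrite divr_gt0// addr_gt0// expR_gt0. Qed.

Lemma arsinh_arg_gt0 x : 0 < x + Num.sqrt (x ^+ 2 + 1).
Proof.
have s0 := sqrtr_ge0 (x ^+ 2 + 1).
have s2 : Num.sqrt (x ^+ 2 + 1) ^+ 2 = x ^+ 2 + 1 by rewrite sqr_sqrtr// addr_ge0// sqr_ge0.
by move: s0 s2; move: (Num.sqrt _) => s; nra.
Qed.

Lemma sinhK : cancel sinh arsinh.
Proof.
move=> r; rewrite /arsinh -cosh2_sinh2 sqrtr_sqr gtr0_norm ?cosh_gt0//.
rewrite (_ : sinh r + cosh r = expR r) ?expRK// /sinh /cosh; lra.
Qed.

Lemma arsinhK : cancel arsinh sinh.
Proof.
move=> x; have p0 := arsinh_arg_gt0 x; rewrite /sinh /arsinh expRN lnK ?posrE//.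
have s2 : Num.sqrt (x ^+ 2 + 1) ^+ 2 = x ^+ 2 + 1 by rewrite sqr_sqrtr// addr_ge0// sqr_ge0.
move: s2 p0; move: (Num.sqrt _) => s s2 p0.
have -> : (x + s)^-1 = s - x.
  apply: (mulfI (lt0r_neq0 p0)); rewrite mulfV ?gt_eqF//.
  by rewrite (_ : (x + s) * (s - x) = s ^+ 2 - x ^+ 2); [rewrite s2 addrC addKr|ring].
by field.
Qed.

Lemma ltr_sinh : {mono sinh : x y / x < y}.
Proof.
apply: leW_mono; apply: le_mono => x y xy; rewrite /sinh ltr_pM2r// ltrD//.
  by rewrite ltr_expR.
by rewrite ltrN2 ltr_expR ltrN2.
Qed.

Lemma ler_sinh : {mono sinh : x y / x <= y}.
Proof. by move=> x y; rewrite !leNgt ltr_sinh. Qed.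

Lemma sinh0 : sinh 0 = 0.
Proof. by rewrite /sinh oppr0 subrr mul0r. Qed.

Lemma is_derive_sinh r : is_derive r 1 sinh (cosh r).
Proof.
rewrite /sinh /cosh; apply: is_derive_eq.
by rewrite /GRing.scale /=; lra.
Qed.

Lemma continuous_sinh : continuous sinh.
Proof.
move=> r; apply: differentiable_continuous; apply/derivable1_diffP.
by have [] := is_derive_sinh r.
Qed.

Lemma continuous_cosh : continuous cosh.
Proof.
move=> r; apply: cvgM; last exact: cvg_cst.
apply: cvgD; first exact: continuous_expR.
by apply: (@continuous_comp _ _ _ -%R expR); [exact: opp_continuous|exact: continuous_expR].
Qed.

Lemma measurable_sinh : measurable_fun [set: R] sinh.
Proof. by apply: continuous_measurable_fun; exact: continuous_sinh. Qed.

Lemma measurable_cosh : measurable_fun [set: R] cosh.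
Proof. by apply: continuous_measurable_fun; exact: continuous_cosh. Qed.

Lemma integral_cosh s (a b : R) : 0 < s -> a <= b ->
  (\int[mu]_(r in `]a, b]) (s * cosh r)%:E = (s * sinh b - s * sinh a)%:E)%E.
Proof.
move=> s0; rewrite le_eqVlt => /predU1P[->|ab].
  by rewrite set_itvoc0 integral_set0 subrr.
rewrite integral_itv_obnd_cbnd; last first.
  by apply/measurable_EFinP/measurable_funTS/measurable_funM => //; exact: measurable_cosh.
have dF r : is_derive r 1 (fun t => s * sinh t) (s * cosh r).
  by have := is_derive_sinh r => h; apply: is_deriveZ.
rewrite (@continuous_FTC2 _ (fun r => s * cosh r) (fun r => s * sinh r))//.
- apply: continuous_subspaceT => r; apply: cvgM; first exact: cvg_cst.
  exact: continuous_cosh.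
- split.
  + by move=> r _; have [] := dF r.
  + apply: cvg_at_right_filter; apply: cvgM; first exact: cvg_cst.
    exact: continuous_sinh.
  + apply: cvg_at_left_filter; apply: cvgM; first exact: cvg_cst.
    exact: continuous_sinh.
- by move=> r _; rewrite derive1E; exact: derive_val.
Qed.

Section Substitution.
Variable s : R.

(* The image under [r |-> s * sinh r] of its jacobian density, to be identified
   with Lebesgue measure on intervals. *)
Definition sinh_measure (X : set (measurableTypeR R)) : \bar R :=
  (\int[mu]_(r in (fun r => (s * sinh r)%R) @^-1` X) (`|s| * cosh r)%:E)%E.

Let measurable_ssinh : measurable_fun [set: R] (fun r => s * sinh r).
Proof. by apply: measurable_funM => //; exact: measurable_sinh. Qed.

Let mpre (X : set (measurableTypeR R)) : measurable X ->
  measurable ((fun r => s * sinh r) @^-1` X : set (measurableTypeR R)).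
Proof. by move=> mX; rewrite -[X in measurable X]setTI; exact: measurable_ssinh. Qed.

(** The absolute value in [sinh_measure] yields this for every [s], so the measure instance carries
    no hypothesis on the sign of [s]. *)
Let density_ge0 r : (0 <= (`|s| * cosh r)%:E)%E.
Proof. by rewrite lee_fin mulr_ge0// ltW// cosh_gt0. Qed.

Let sinh_measure0 : sinh_measure set0 = 0%E.
Proof. by rewrite /sinh_measure preimage_set0 integral_set0. Qed.

Let sinh_measure_ge0 X : (0 <= sinh_measure X)%E.
Proof. exact: integral_ge0. Qed.

Let sinh_measure_sigma_additive :
  semi_sigma_additive sinh_measure.
Proof.
move=> /= F mF tF mUF; rewrite /sinh_measure; apply: cvg_toP.
  apply: ereal_nondecreasing_is_cvgn => m n mn.
  by apply: lee_sum_nneg_natr => // k _ _; exact: integral_ge0.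
rewrite preimage_bigcup ge0_integral_bigcup//=.
- by move=> k; exact: mpre.
- apply/measurable_EFinP/measurable_funTS/measurable_funM => //.
  exact: measurable_cosh.
- by move=> i j _ _ [r [Fi Fj]]; apply: tF => //; exists (s * sinh r).
Qed.

HB.instance Definition _ := isMeasure.Build _ _ _
  sinh_measure sinh_measure0 sinh_measure_ge0 sinh_measure_sigma_additive.

End Substitution.

(** Both sides are measures in [X], so half-open intervals suffice. Their preimages are again
    half-open intervals, because [s sinh] is an increasing bijection of the line, and
    [integral_cosh] evaluates the density on them. *)
Lemma lebesgue_measure_sinh s (X : set (measurableTypeR R)) : 0 < s -> measurable X ->
  mu X = (\int[mu]_(r in (fun r => (s * sinh r)%R) @^-1` X) (s * cosh r)%:E)%E.
Proof.
move=> s0 mX.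
rewrite [RHS](_ : _ = sinh_measure s X); last by rewrite /sinh_measure gtr0_norm.
suff H : forall Y, ocitv Y -> mu Y = sinh_measure s Y.
  exact: (@lebesgue_measure_unique R (sinh_measure s) H X mX).
move=> _ [[a b] /= _ <-]; rewrite /sinh_measure (gtr0_norm s0).
have sE x : s * sinh (arsinh (x / s)) = x by rewrite arsinhK mulrC divfK// gt_eqF.
have E r : (arsinh (a / s) < r <= arsinh (b / s)) = (a < s * sinh r <= b).
  rewrite -(ltr_sinh (arsinh (a / s)) r) -(ler_sinh r (arsinh (b / s))) !arsinhK.
  by rewrite ltr_pdivrMr// ler_pdivlMr// [sinh r * s]mulrC.
have [ab|ba] := leP a b; last first.
  rewrite set_itv_ge; last by rewrite bnd_simp -leNgt ltW.
  by rewrite preimage_set0 integral_set0 measure0.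
rewrite (_ : _ @^-1` _ = `]arsinh (a / s), arsinh (b / s)]%classic); last first.
  by apply/seteqP; split => r; rewrite /= !in_itv /= E.
rewrite integral_cosh//; last by rewrite -ler_sinh -(ler_pM2l s0) !sE.
rewrite !sE lebesgue_measure_itv /= lte_fin.
by move: ab; rewrite le_eqVlt => /predU1P[->|->]; rewrite ?ltxx ?subrr.
Qed.

End HyperbolicFunctions.

(** * Slices of the modular domain and the density *)

Section Density.
Variable R : realType.
Local Notation mu := (@lebesgue_measure R).
Local Notation leb2 := (@lebesgue_measure R \x @lebesgue_measure R)%E.
Local Notation sinh := (@sinh R).
Local Notation cosh := (@cosh R).
Implicit Types (tau : R * R) (r y : R).

(** The logarithm of [least_dilatation] on the upper half-plane, as a difference of logarithms so
    that measurability on the whole plane is immediate. *)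
Definition rectangular_dist tau : R := ln (cmod tau + `|tau.1|) - ln tau.2.

Lemma measurable_rectangular_dist : measurable_fun [set: R * R] rectangular_dist.
Proof.
apply: measurable_funB; apply: (measurableT_comp (@measurable_ln R)); last exact: measurable_snd.
apply: measurable_funD; first exact: measurable_cmod.
by apply: measurableT_comp => //; exact: measurable_fst.
Qed.

Lemma rectangular_distE tau : 0 < tau.2 -> rectangular_dist tau = ln (least_dilatation tau).
Proof.
by move=> y0; rewrite /rectangular_dist -ln_div// posrE//; exact: cmod_addr_gt0.
Qed.

Lemma rectangular_dist_arsinh tau : 0 < tau.2 ->
  rectangular_dist tau = arsinh (`|tau.1| / tau.2).
Proof.
move=> y0; rewrite rectangular_distE// /least_dilatation /arsinh; congr ln.
have -> : (`|tau.1| / tau.2) ^+ 2 + 1 = (cmod tau / tau.2) ^+ 2.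
  rewrite !expr_div_n cmod_sqr real_normK ?num_real//.
  by field; rewrite gt_eqF.
rewrite sqrtr_sqr (@ger0_norm _ (cmod tau / tau.2)); last first.
  by rewrite divr_ge0 ?cmod_ge0// ltW.
by rewrite -mulrDl addrC.
Qed.

Lemma measurable_arsinh : measurable_fun [set: R] (@arsinh R).
Proof.
apply: (measurableT_comp (@measurable_ln R)); apply: measurable_funD => //.
apply: measurableT_comp => //.
  by apply: continuous_measurable_fun; exact: sqrt_continuous.
by apply: measurable_funD => //; exact: measurable_funX.
Qed.

(* [y^-1] for [y > 0], written so that it is measurable on the whole line. *)
Definition pos_inv y : R := expR (- ln y).

Lemma pos_invE y : 0 < y -> pos_inv y = y^-1.
Proof. by move=> y0; rewrite /pos_inv expRN lnK. Qed.

Lemma measurable_pos_inv : measurable_fun [set: R] pos_inv.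
Proof. by apply: (measurableT_comp (@measurable_expR R)); exact: measurableT_comp. Qed.

Lemma integral_pos_inv (a b : R) : 0 < a -> a <= b ->
  (\int[mu]_(y in `[a, b[) (pos_inv y)%:E = (ln b - ln a)%:E)%E.
Proof.
move=> a0; rewrite le_eqVlt => /predU1P[->|ab].
  by rewrite set_itvco0 integral_set0 subrr.
rewrite integral_itv_bndo_bndc; last first.
  by apply/measurable_EFinP/measurable_funTS; exact: measurable_pos_inv.
have pos y : a <= y -> 0 < y by exact: lt_le_trans.
have cln y : 0 < y -> {for y, continuous (@ln R)}.
  move=> y0; apply: differentiable_continuous; apply/derivable1_diffP.
  by have [] := is_derive1_ln y0.
rewrite (@continuous_FTC2 _ pos_inv (@ln R))//.
- apply: continuous_in_subspaceT => y; rewrite inE /= in_itv /= => /andP[ay _].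
  apply: (@continuous_comp _ _ _ (fun y => - ln y) expR); last exact: continuous_expR.
  by apply: cvgN; apply: cln; exact: pos.
- split.
  + move=> y; rewrite in_itv /= => /andP[ay _].
    by have [] := is_derive1_ln (pos _ (ltW ay)).
  + by apply: cvg_at_right_filter; apply: cln.
  + by apply: cvg_at_left_filter; apply: cln; apply: pos; exact: ltW.
- move=> y; rewrite in_itv /= => /andP[ay _]; rewrite derive1E pos_invE; last exact/pos/ltW.
  by have h := is_derive1_ln (pos _ (ltW ay)); rewrite derive_val.
Qed.

Section Slices.
Variable A : set (measurableTypeR R).
Hypothesis mA : measurable A.

(** The part of [slice y] with [0 < x < 1 / 2], where the absolute value in the distance disappears
    and [x = y sinh r] can be substituted. *)
Definition half_slice y : set (measurableTypeR R) :=
  [set x : R | (A (arsinh (x / y)) /\ 0 < x < 1 / 2) /\ 1 <= x ^+ 2 + y ^+ 2].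

Definition slice y : set (measurableTypeR R) :=
  [set x : R | A (rectangular_dist (x, y)) /\ modular_domain (x, y)].

Lemma measurable_half_slice y : measurable (half_slice y).
Proof.
apply: measurableI; first apply: measurableI.
- have m : measurable_fun [set: R] (fun x => arsinh (x / y)).
    by apply: (measurableT_comp measurable_arsinh); exact: measurable_funM.
  exact: (measurable_preimage m).
- rewrite (_ : (fun x : R => _) = `]0, 1 / 2[%classic); first exact: measurable_itv.
  by apply/funext => x; rewrite /= in_itv.
- have m : measurable_fun [set: R] (fun x : R => x ^+ 2 + y ^+ 2).
    by apply: measurable_funD => //; exact: measurable_funX.
  rewrite (_ : (fun x : R => _) = (fun x : R => x ^+ 2 + y ^+ 2) @^-1` `[1, +oo[%classic).
    by apply: (measurable_preimage m); exact: measurable_itv.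
  by apply/funext => x; rewrite /= in_itv /= andbT.
Qed.

Lemma measurable_modular_domain : measurable (@modular_domain R).
Proof.
rewrite (_ : modular_domain = ((@snd R R) @^-1` `]0, +oo[%classic `&` (@cmod R) @^-1` `[1, +oo[%classic)
   `&` (@fst R R) @^-1` `](- (1 / 2)), (1 / 2)]%classic).
  by apply: measurableI; first apply: measurableI; rewrite -[X in measurable X]setTI;
    [apply: measurable_snd|apply: measurable_cmod|apply: measurable_fst] => //; exact: measurable_itv.
apply/seteqP; split => z /=; rewrite !in_itv /= !andbT; first by move=> [? ? ?].
by move=> [[? ?] ?].
Qed.

Definition domain_part : set (R * R) := rectangular_dist @^-1` A `&` @modular_domain R.

Lemma measurable_domain_part : measurable domain_part.
Proof.
apply: measurableI; last exact: measurable_modular_domain.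
exact: measurable_preimage measurable_rectangular_dist mA.
Qed.

Lemma measurable_slice y : measurable (slice y).
Proof.
rewrite (_ : slice y = ysection domain_part y).
  by apply: measurable_ysection; exact: measurable_domain_part.
by apply/seteqP; split => x; rewrite /ysection /= inE.
Qed.

(** The distance depends on [x] only through its absolute value. The reflection fails to preserve
    the slice only at the edge [x = 1 / 2], which the domain contains on one side; this point and
    [x = 0] form a null set. *)
Lemma slice_measure y : 0 < y -> mu (slice y) = (2%:E * mu (half_slice y))%E.
Proof.
move=> y0.
have mH := measurable_half_slice y; have mS := measurable_slice y.
have mN : measurable ((-%R : R -> R) @^-1` half_slice y : set (measurableTypeR R)).
  by rewrite -[X in measurable X]setTI; apply: (@oppr_measurable R).
have cmodE x : (1 <= cmod (x, y)) = (1 <= x ^+ 2 + y ^+ 2).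
  by rewrite -(@ler_pXn2r _ 2)// ?nnegrE ?cmod_ge0// cmod_sqr expr1n.
pose E := slice y `&` [set 0; 1 / 2].
have E0 : mu E = 0%E.
  by apply: countable_lebesgue_measure0; apply: sub_countable (finite_set_countable (finite_set2 0 (1 / 2))); exact: subset_card_le (@subIsetr _ _ _).
have mE : measurable E.
  by apply: measurableI => //; apply: measurableU; exact: measurable_set1.
have -> : slice y = (half_slice y `|` (-%R : R -> R) @^-1` half_slice y) `|` E.
  apply/seteqP; split => x.
    move=> Sx; have [AS [_ /= c1 /andP[x1 x2]]] := Sx.
    rewrite cmodE in c1; rewrite rectangular_dist_arsinh// /= in AS.
    have [x0|x0|x0] := ltgtP x 0.
    - left; right; rewrite /half_slice /= sqrrN; split => //; split.
        by rewrite ltr0_norm in AS.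
      by apply/andP; split; lra.
    - have [xE|xn] := eqVneq x (1 / 2).
        by right; split => //; right.
      left; left; rewrite /half_slice /=; split => //; split.
        by rewrite gtr0_norm in AS.
      by rewrite x0 lt_neqAle xn.
    - by right; split => //; left.
  move=> [[|]|[]//].
    move=> [[Ax /andP[x0 x1]] c1]; split.
      by rewrite rectangular_dist_arsinh//= gtr0_norm.
    by split; rewrite ?cmodE//=; apply/andP; split; lra.
  move=> [/= [Ax /andP[x0 x1]] c1]; rewrite sqrrN in c1; split.
    by rewrite rectangular_dist_arsinh//= ltr0_norm//; lra.
  by split; rewrite ?cmodE//=; apply/andP; split; lra.
rewrite measureU//; last first.
- apply/seteqP; split => // x [[|] + [_ /= x01]] => -[[_ /andP[x0 x1]] _]; case: x01; lra.
- exact: measurableU.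
rewrite [X in (_ + X)%E]E0 adde0 measureU//; last first.
  by apply/seteqP; split => // x [[[_ /andP[x0 x1]] _] [[_ /andP[/= x2 x3]] _]]; lra.
have /= -> : mu ((-%R : R -> R) @^-1` half_slice y) = mu (half_slice y) := lebesgue_measureN mH.
by rewrite -mule2n mule_natl.
Qed.

(** The variables are [z = (y, r)] with [x = y sinh r], so that [|tau| = y cosh r]: the last two
    conditions are [|tau| >= 1] and [x < 1 / 2]. *)
Definition sinh_slice : set (R * R) :=
  [set z | [/\ A z.2, 0 < z.2, 0 < z.1, 1 <= z.1 * cosh z.2 & z.1 * sinh z.2 < 1 / 2]].

Lemma half_slice_measure y : 0 < y ->
  mu (half_slice y) = (\int[mu]_(r in [set r | sinh_slice (y, r)]) (y * cosh r)%:E)%E.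
Proof.
move=> y0; rewrite (lebesgue_measure_sinh y0 (measurable_half_slice y)).
congr (integral _ _ _); apply/seteqP; split => r; rewrite /half_slice /sinh_slice /=.
  move=> [[Ar /andP[r0 r1]] c1].
  have {}r0 : 0 < r by rewrite -ltr_sinh sinh0 -(pmulr_rgt0 _ y0).
  split => //; first by move: Ar; rewrite mulrAC mulfV ?gt_eqF// mul1r sinhK.
  rewrite -(@ler_pXn2r _ 2)// ?nnegrE ?mulr_ge0 ?(ltW y0) ?(ltW (cosh_gt0 _))//.
  by rewrite expr1n [leRHS]exprMn cosh2_sinh2 mulrDr mulr1 -exprMn.
move=> [Ar r0 _ c1 r1]; split.
  split; first by rewrite mulrAC mulfV ?gt_eqF// mul1r sinhK.
  by rewrite r1 andbT mulr_gt0// -[X in X < _]sinh0 ltr_sinh.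
move: c1; rewrite -(@ler_pXn2r _ 2)// ?nnegrE ?mulr_ge0 ?(ltW y0) ?(ltW (cosh_gt0 _))//.
by rewrite expr1n [leRHS]exprMn cosh2_sinh2 mulrDr mulr1 -exprMn.
Qed.

Lemma measurable_sinh_slice : measurable sinh_slice.
Proof.
have m1 : measurable_fun [set: R * R] (fun z : R * R => z.1 * cosh z.2).
  apply: measurable_funM; first exact: measurable_fst.
  by apply: (measurableT_comp (@measurable_cosh R)); exact: measurable_snd.
have m2 : measurable_fun [set: R * R] (fun z : R * R => z.1 * sinh z.2).
  apply: measurable_funM; first exact: measurable_fst.
  by apply: (measurableT_comp (@measurable_sinh R)); exact: measurable_snd.
rewrite (_ : sinh_slice = ((@snd R R) @^-1` A `&` (@snd R R) @^-1` `]0, +oo[%classic) `&`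
  ((@fst R R) @^-1` `]0, +oo[%classic `&` ((fun z : R * R => z.1 * cosh z.2) @^-1` `[1, +oo[%classic `&`
  (fun z : R * R => z.1 * sinh z.2) @^-1` `]-oo, 1 / 2[%classic))).
  apply: measurableI; [apply: measurableI|apply: measurableI; [|apply: measurableI]].
  - by apply: measurable_preimage => //; exact: measurable_snd.
  - by apply: measurable_preimage; [exact: measurable_snd|exact: measurable_itv].
  - by apply: measurable_preimage; [exact: measurable_fst|exact: measurable_itv].
  - by apply: (measurable_preimage m1); exact: measurable_itv.
  - by apply: (measurable_preimage m2); exact: measurable_itv.
apply/seteqP; split => z /=; rewrite !in_itv /= ?andbT; first by move=> [? ? ? ? ?].
by move=> [[? ?] [? [? ?]]].
Qed.

Definition area_density z : R := 3 / pi * pos_inv z.2 ^+ 2 * \1_domain_part z.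
(** The coefficient 3 of the normalised area is doubled by the reflection in [x], and the jacobian
    [y cosh r] cancels one of the two factors [1 / y]. *)
Definition sinh_density z : R := 6 / pi * cosh z.2 * pos_inv z.1 * \1_sinh_slice z.

Lemma pos_inv_ge0 y : 0 <= pos_inv y. Proof. exact: expR_ge0. Qed.

Lemma area_density_ge0 z : 0 <= area_density z.
Proof. apply: mulr_ge0 => //; apply: mulr_ge0; last exact: sqr_ge0.
by apply: divr_ge0 => //; exact: pi_ge0. Qed.

Lemma sinh_density_ge0 z : 0 <= sinh_density z.
Proof.
apply: mulr_ge0 => //; apply: mulr_ge0; last exact: pos_inv_ge0.
apply: mulr_ge0; last exact/ltW/cosh_gt0.
by apply: divr_ge0 => //; exact: pi_ge0.
Qed.

Lemma measurable_area_density : measurable_fun [set: R * R] area_density.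
Proof.
apply: measurable_funM; last by apply: measurable_indic; exact: measurable_domain_part.
apply: measurable_funM; first exact: measurable_cst.
by apply: measurable_funX; apply: (measurableT_comp measurable_pos_inv); exact: measurable_snd.
Qed.

Lemma measurable_sinh_density : measurable_fun [set: R * R] sinh_density.
Proof.
apply: measurable_funM; last by apply: measurable_indic; exact: measurable_sinh_slice.
apply: measurable_funM; last by apply: (measurableT_comp measurable_pos_inv); exact: measurable_fst.
apply: measurable_funM; first exact: measurable_cst.
by apply: (measurableT_comp (@measurable_cosh R)); exact: measurable_snd.
Qed.

Lemma uniform_moduliE :
  uniform_moduli (rectangular_dist @^-1` A) = (\int[leb2]_z (area_density z)%:E)%E.
Proof.
rewrite /uniform_moduli integral_mkcond; apply: eq_integral => z _; rewrite patchE /area_density indicE.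
case: ifPn => zD; last by rewrite mulr0.
have [_ [y0 _ _]] := set_mem zD.
rewrite mulr1 pos_invE//; congr EFin.
have := pi_gt0 R; move: (@pi R) => c c0.
by field; rewrite !gt_eqF.
Qed.

Lemma area_slice y : (\int[mu]_x (area_density (x, y))%:E =
  \int[mu]_r (sinh_density (y, r))%:E)%E.
Proof.
have [y0|y0] := ltP 0 y; last first.
  rewrite !integral0_eq// => x _.
    by rewrite /sinh_density indicE memNset ?mulr0// => -[_ _ /=]; rewrite ltNge y0.
  by rewrite /area_density indicE memNset ?mulr0// => -[_ [/=]]; rewrite ltNge y0.
have mW : measurable ([set r | sinh_slice (y, r)] : set (measurableTypeR R)).
  rewrite (_ : [set r | _] = xsection sinh_slice y).
    by apply: measurable_xsection; exact: measurable_sinh_slice.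
  by apply/seteqP; split => r; rewrite /xsection /= inE.
transitivity ((3 / pi * pos_inv y ^+ 2)%:E * mu (slice y))%E.
  rewrite -integral_cst; last exact: measurable_slice.
  rewrite [RHS]integral_mkcond; apply: eq_integral => x _; rewrite patchE /area_density indicE /=.
  have -> : (x \in slice y) = ((x, y) \in domain_part).
    by apply/idP/idP => /set_mem h; apply/mem_set.
  by case: ifP => _; rewrite ?mulr1 ?mulr0.
rewrite slice_measure// half_slice_measure// muleA -EFinM -ge0_integralZl//; last 3 first.
- apply/measurable_EFinP/measurable_funTS; apply: measurable_funM => //; exact: measurable_cosh.
- by move=> r _; rewrite lee_fin mulr_ge0 ?(ltW y0) ?(ltW (cosh_gt0 _)).
- rewrite lee_fin; apply: mulr_ge0 => //; apply: mulr_ge0; last exact: sqr_ge0.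
  by apply: divr_ge0 => //; exact: pi_ge0.
rewrite integral_mkcond; apply: eq_integral => r _; rewrite patchE /sinh_density indicE /=.
have -> : (r \in [set r | sinh_slice (y, r)]) = ((y, r) \in sinh_slice).
  by apply/idP/idP => /set_mem h; apply/mem_set.
case: ifP => _; rewrite ?mulr1 ?mulr0// -EFinM pos_invE//; congr EFin.
have := pi_gt0 R; move: (@pi R) (cosh r) => c ch c0.
by field; rewrite !gt_eqF.
Qed.

(** Both sides say that [exp (2 r) <= 3]. *)
Lemma ler_artanh_half r : (r <= artanh (1 / 2)) = (2 * sinh r <= cosh r).
Proof.
rewrite /artanh (_ : (1 + 1 / 2) / (1 - 1 / 2) = 3 :> R); last by field.
rewrite ler_pdivlMr// -(ler_expR (r * 2)) lnK ?posrE// mulr_natr mulr2n expRD.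
rewrite /sinh /cosh; have := expRNr r; have := expR_gt0 r; have := expR_gt0 (- r).
move: (expR r) (expR _) => a b b0 a0 ab.
apply/idP/idP => h; last by nra.
have : a * a * b <= 3 * b by rewrite ler_wpM2r// ltW.
rewrite -mulrA ab; lra.
Qed.

Lemma sinh_slice_integral r : 0 < r -> A r ->
  (\int[mu]_y (sinh_density (y, r))%:E = (Sigma r)%:E)%E.
Proof.
move=> r0 Ar.
have s0 : 0 < sinh r by rewrite -sinh0 ltr_sinh.
have c0 := cosh_gt0 r.
have s2 : 0 < 2 * sinh r by exact: mulr_gt0.
have WE y : sinh_slice (y, r) <-> (cosh r)^-1 <= y < (2 * sinh r)^-1.
  rewrite /sinh_slice /=.
  have e1 : ((cosh r)^-1 <= y) = (1 <= y * cosh r) by rewrite -ler_pdivrMr// div1r.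
  have e2 : (y < (2 * sinh r)^-1) = (y * sinh r < 1 / 2).
    rewrite -ltr_pdivlMr// (_ : 1 / 2 / sinh r = (2 * sinh r)^-1)//.
    by rewrite mul1r (invfM 2).
  rewrite -e1 -e2; split => [[_ _ _ -> ->//]|/andP[h1 h2]]; split => //.
  by rewrite (lt_le_trans _ h1)// invr_gt0.
transitivity (\int[mu]_(y in `[((cosh r)^-1)%R, ((2 * sinh r)^-1)%R[) ((6 / pi * cosh r)%:E * (pos_inv y)%:E))%E.
  rewrite [RHS]integral_mkcond; apply: eq_integral => y _; rewrite patchE /sinh_density indicE /=.
  have -> : ((y, r) \in sinh_slice) = (y \in `[(cosh r)^-1, (2 * sinh r)^-1[%classic).
    apply/idP/idP => /set_mem h; apply/mem_set; first by rewrite /= in_itv /=; exact/WE.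
    by apply/WE; move: h; rewrite /= in_itv.
  by case: ifP => _; rewrite ?mulr1 ?mulr0.
rewrite ge0_integralZl//; last 3 first.
- by apply/measurable_EFinP/measurable_funTS; exact: measurable_pos_inv.
- by move=> y _; rewrite lee_fin pos_inv_ge0.
- by rewrite lee_fin mulr_ge0 ?divr_ge0 ?pi_ge0 ?(ltW c0).
(* Above [artanh (1 / 2)] the interval for [y] is empty; below it, the logarithm of the ratio of its
   endpoints is that of [cosh r / (2 sinh r)]. *)
rewrite /Sigma ler_artanh_half; case: ifPn => h; last first.
  rewrite set_itv_ge; last first.
    rewrite bnd_simp -leNgt lef_pV2 ?posrE//.
    by rewrite ltW// ltNge.
  by rewrite integral_set0 mule0.
rewrite integral_pos_inv ?invr_gt0//; last by rewrite lef_pV2 ?posrE.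
rewrite -EFinM; congr (_ * _)%:E.
rewrite -ln_div ?posrE ?invr_gt0// /coth; congr ln.
by field; rewrite !gt_eqF.
Qed.

(** The substitution is made at fixed [y]; exchanging the integrals afterwards puts [r] outermost,
    and the inner integral over [y] is the density. The points at distance 0 form a null set already
    dropped in [half_slice]. *)
Lemma uniform_moduli_Sigma : uniform_moduli (rectangular_dist @^-1` A) =
  (\int[mu]_(r in A `&` `]0%R, +oo[) (Sigma r)%:E)%E.
Proof.
rewrite uniform_moduliE.
have := tonelli_rect1 measurable_area_density area_density_ge0 measurableT measurableT.
rewrite setXTT => ->.
under eq_integral do rewrite area_slice.
rewrite (@fubini_tonelli _ _ _ _ _ mu mu (EFin \o sinh_density)).
- rewrite [RHS]integral_mkcond; apply: eq_integral => r _; rewrite patchE.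
  case: ifPn => [|rN].
    rewrite inE /= in_itv /= andbT => -[Ar r0]; exact: sinh_slice_integral.
  rewrite integral0_eq// => y _; rewrite /= /sinh_density indicE memNset ?mulr0//.
  by apply: contraNnot rN => -[/= Ar r0 _ _ _]; rewrite inE /= in_itv /= andbT.
- by apply/measurable_EFinP; exact: measurable_sinh_density.
- by move=> z; rewrite lee_fin sinh_density_ge0.
Qed.

End Slices.
End Density.

Theorem theorem5p11 (R : realType) (d : measure_display)
    (T : measurableType d) (P : probability T R)
    (tau : {RV P >-> (R * R)%type})
    (tau_domain : forall omega : T, modular_domain (tau omega))
    (tau_uniform : forall B : set (R * R), measurable B ->
       distribution P tau B = uniform_moduli B) :
  exists D : {RV P >-> R},
    (forall omega : T,
       is_minimum (teichmuller_dist (tau omega) @` rectangular) (D omega)) /\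
    (forall A : set R, measurable A ->
       distribution P D A =
         (\int[@lebesgue_measure R]_(r in A `&` `]0%R, +oo[) (Sigma r)%:E)%E).
Proof.
have mD : measurable_fun [set: T] (@rectangular_dist R \o tau).
  by apply: (measurableT_comp (@measurable_rectangular_dist R)).
exists (mfun_Sub (mem_set mD)); split.
  move=> omega /=; rewrite rectangular_distE; last by have [] := tau_domain omega.
  exact: teichmuller_dist_min.
move=> A mA; rewrite -uniform_moduli_Sigma// -tau_uniform//.
exact: (measurable_preimage (@measurable_rectangular_dist R) mA).
Qed.
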